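(* Let $\beta\in(\pi,2\pi]$, let $K\subset\mathbb{R}^2$ be an unbounded convex set and let $\Lambda$ be a sector of opening angle $\beta$ (a rotated and translated copy of $\Lambda_\beta$) whose vertex lies in the interior of $K$. Assume $\partial K\cap\partial\Lambda=\emptyset$. Then the Hardy constant of $\Omega=K\cap\Lambda$ equals $c_\beta$.
   Context: The Hardy constant of a domain $\Omega\subset\mathbb{R}^2$ is the largest $c\ge0$ such that $\int_\Omega|\nabla u|^2\ge c\int_\Omega u^2/d^2$ for all $u\in C_c^\infty(\Omega)$, $d(x)=\mathrm{dist}(x,\partial\Omega)$. For $\beta\in[\pi,2\pi]$, $\Lambda_\beta=\{(r\cos\theta,r\sin\theta): r>0,\ 0<\theta<\beta\}$ and $c_\beta$ is the Hardy constant of $\Lambda_\beta$. It is known that $c_\beta\in(0,1/4]$; $c_\beta=1/4$ for $\pi\le\beta\le\beta_{cr}$, where $\beta_{cr}\in(\pi,2\pi)$ is the unique solution in $(\pi,2\pi)$ of $\tan\big(\frac{\beta_{cr}-\pi}{4}\big)=4\big(\Gamma(3/4)/\Gamma(1/4)\big)^2$; for $\beta_{cr}\le\beta<2\pi$, $c_\beta$ is the unique solution of $\sqrt{c}\tan\big(\sqrt{c}\,\frac{\beta-\pi}{2}\big)=2\Big(\frac{\Gamma(\frac{3+\sqrt{1-4c}}{4})}{\Gamma(\frac{1+\sqrt{1-4c}}{4})}\Big)^2$. *)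

(* Defs.v *)
From Stdlib Require Import Reals Lra Classical ClassicalEpsilon.
Open Scope R_scope.

Definition pt : Type := (R * R)%type.

Definition pdist (p q : pt) : R :=
  sqrt ((fst p - fst q) ^ 2 + (snd p - snd q) ^ 2).

Definition pnorm (p : pt) : R := sqrt (fst p ^ 2 + snd p ^ 2).

Definition interior2 (S : pt -> Prop) (p : pt) : Prop :=
  exists eps, eps > 0 /\ forall q, pdist p q < eps -> S q.

Definition closure2 (S : pt -> Prop) (p : pt) : Prop :=
  forall eps, eps > 0 -> exists q, S q /\ pdist p q < eps.

Definition boundary2 (S : pt -> Prop) (p : pt) : Prop :=
  closure2 S p /\ ~ interior2 S p.

Definition bounded2 (S : pt -> Prop) : Prop :=
  exists M, forall p, S p -> pnorm p <= M.

Definition unbounded_set (S : pt -> Prop) : Prop := ~ bounded2 S.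

Definition convex_set (S : pt -> Prop) : Prop :=
  forall p q t, S p -> S q -> 0 <= t <= 1 ->
    S ((1 - t) * fst p + t * fst q, (1 - t) * snd p + t * snd q).

Definition is_inf (E : R -> Prop) (m : R) : Prop :=
  (forall x, E x -> m <= x) /\
  (forall m', (forall x, E x -> m' <= x) -> m' <= m).

Definition Rinf (E : R -> Prop) : R :=
  epsilon (inhabits 0) (fun m => is_inf E m).

Definition bdist (Om : pt -> Prop) (p : pt) : R :=
  Rinf (fun r => exists q, boundary2 Om q /\ r = pdist p q).

Definition cont2 (f : pt -> R) : Prop :=
  forall p eps, eps > 0 -> exists del, del > 0 /\
    forall q, pdist p q < del -> Rabs (f q - f p) < eps.

Definition partial_x (f g : pt -> R) : Prop :=
  forall x y, derivable_pt_lim (fun t => f (t, y)) x (g (x, y)).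

Definition partial_y (f g : pt -> R) : Prop :=
  forall x y, derivable_pt_lim (fun t => f (x, t)) y (g (x, y)).

CoInductive smooth (f : pt -> R) : Prop :=
  smooth_intro : forall fx fy,
    cont2 f -> partial_x f fx -> partial_y f fy ->
    smooth fx -> smooth fy -> smooth f.

Definition support (u : pt -> R) : pt -> Prop :=
  closure2 (fun p => u p <> 0).

Definition test_fn (Om : pt -> Prop) (u : pt -> R) : Prop :=
  smooth u /\ bounded2 (support u) /\ (forall p, support u p -> Om p).

Definition Rint (f : R -> R) (a b I : R) : Prop :=
  exists pr : Riemann_integrable f a b, RiemannInt pr = I.

(* Integral over R^2 of a compactly supported function, as an iterated
   Riemann integral over any large enough square [-L,L]^2. *)
Definition integral2 (f : pt -> R) (I : R) : Prop :=
  exists L0, forall L, L0 <= L ->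
    exists g : R -> R,
      (forall x, Rint (fun y => f (x, y)) (- L) L (g x)) /\ Rint g (- L) L I.

Definition hardy_ineq (Om : pt -> Prop) (c : R) : Prop :=
  forall (u ux uy : pt -> R) (A B : R),
    test_fn Om u -> partial_x u ux -> partial_y u uy ->
    integral2 (fun p => ux p ^ 2 + uy p ^ 2) A ->
    integral2 (fun p => u p ^ 2 / bdist Om p ^ 2) B ->
    c * B <= A.

Definition is_hardy_const (Om : pt -> Prop) (c : R) : Prop :=
  0 <= c /\ hardy_ineq Om c /\
  (forall c', 0 <= c' -> hardy_ineq Om c' -> c' <= c).

Definition Lambda (beta : R) (p : pt) : Prop :=
  exists r th, r > 0 /\ 0 < th < beta /\ p = (r * cos th, r * sin th).

Definition sector (beta phi : R) (v : pt) (p : pt) : Prop :=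
  exists q, Lambda beta q /\
    p = (fst v + cos phi * fst q - sin phi * snd q,
         snd v + sin phi * fst q + cos phi * snd q).

(* Main.v *)
Require Import Defs.
From Stdlib Require Import Reals Factorial Lra Lia List Classical ClassicalEpsilon.
From Stdlib Require Import FunctionalExtensionality PropExtensionality.
From Coquelicot Require Import Coquelicot.
Open Scope R_scope.

(** Put [b = (beta - PI) / 2] and let [x] be the angle measured from the axis of the sector, so
that the distance to the sector's boundary is [r * kk b x].  The Hardy inequality with constant
[c] is shown to be equivalent, for the sector and for [Omega] alike, to a condition on [c] and
[b] only: for every [c' < c] the even solution of [psi'' = - c' / kk^2 * psi] is positive on
[|x| < b + PI/2].

Necessity: if [psi] first vanishes at [a], a test function [f(ln r) * psi(x)^(1+eta)] on
[|x| < a], supported near the vertex, where [Omega] and the sector agree, violates the inequality.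

Sufficiency: since the boundaries are disjoint, [K] contains the complement of the sector.  On
the support of a test function, finitely many supporting half planes [l_i] of [K] suffice to
describe the distance.  Take the fields [- grad psi / psi] for the sector and
[- al * grad l_i / l_i], [al * (1 - al) = c'], for the half planes, and glue them with the weights
[w_i = exp(-N d_i) / sum_j exp(-N d_j)].  The divergence of the glued field gains
[- N/2 * sum_ij w_i w_j (grad d_i - grad d_j).(T_i - T_j)], which is nonnegative up to an
error that vanishes as [N] grows, because the inner normals of [K] point away from the normal cone of the
complement of the sector and because [|psi'/psi| <= 1/2 < al] where the nearest boundary point of
the sector is its vertex. *)

(** * Iterated integrals of continuous functions *)

(** The distance in [Omega] is a minimum of functions each of which has its own Hardy field, and
    these fields jump where the minimizer changes. Exponential weights keep the glued field C1, so
    that the divergence theorem is needed on squares only; the price is the covariance term, which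
    carries the sign of the jump. The jump can be unfavourable only where the nearest boundary point
    of the sector is its vertex. There the sector field has size [|F| / r <= 1 / (2 * r)] with
    [F = - psi' / psi], against [al / l] for a half plane, and [l] is about [r] at the interface; so
    any [al > 1 / 2] wins. The bound [1 / 2] is [tan (PI / 4) / 2]: comparing [F' = F^2 + c'] with
    [c' = 1 / 4] gives [|F| <= tan (|x| / 2) / 2], and [|x| <= b <= PI / 2] because
    [beta <= 2 * PI]. Having [al > 1 / 2] requires [c' < 1 / 4] strictly, which is why constants
    below the critical one are treated first and the critical one is reached by a limit. The
    critical value is never computed: the sector is the case where [K] is the whole plane, so both
    Hardy constants are the same supremum. *)

Definition cts (f : pt -> R) : Prop := forall p, continuous f p.

Lemma pdist_bounds (p q : pt) :
  Rabs (fst q - fst p) <= pdist p q /\ Rabs (snd q - snd p) <= pdist p q /\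
  pdist p q <= Rabs (fst q - fst p) + Rabs (snd q - snd p).
Proof.
  destruct p as [x y], q as [s t]; unfold pdist; simpl.
  assert (H1 : Rabs (s - x) ^ 2 = (s - x) ^ 2) by apply pow2_abs.
  assert (H2 : Rabs (t - y) ^ 2 = (t - y) ^ 2) by apply pow2_abs.
  pose proof (Rabs_pos (s - x)); pose proof (Rabs_pos (t - y)).
  simpl in H1, H2.
  repeat split.
  - apply Rsqr_incr_0_var; [|apply sqrt_pos]. rewrite Rsqr_sqrt; [unfold Rsqr|]; nra.
  - apply Rsqr_incr_0_var; [|apply sqrt_pos]. rewrite Rsqr_sqrt; [unfold Rsqr|]; nra.
  - apply Rsqr_incr_0_var; [|lra]. rewrite Rsqr_sqrt; [unfold Rsqr|]; nra.
Qed.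

(** Balls of the product uniform space are squares; this passes to Euclidean discs. *)
Lemma locally_pdist (p : pt) (P : pt -> Prop) :
  locally p P <-> exists eps, 0 < eps /\ forall q, pdist p q < eps -> P q.
Proof.
  split.
  - intros [e He]. exists e. split; [apply cond_pos|].
    intros q Hq. apply He. destruct (pdist_bounds p q) as (H1 & H2 & _).
    split; (eapply Rle_lt_trans; [|exact Hq]); assumption.
  - intros [e [He HP]]. assert (He2 : 0 < e / 2) by lra.
    exists (mkposreal _ He2). intros q [H1 H2]. apply HP.
    destruct (pdist_bounds p q) as (_ & _ & H3).
    unfold ball in H1, H2; simpl in H1, H2.
    unfold AbsRing_ball, abs, minus, plus, opp in H1, H2; simpl in H1, H2.
    unfold Rminus in *. lra.
Qed.

Lemma cts_pdist (f : pt -> R) (p : pt) :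
  continuous f p <-> forall eps, 0 < eps -> exists del, 0 < del /\
    forall q, pdist p q < del -> Rabs (f q - f p) < eps.
Proof.
  split.
  - intros H eps Heps. apply locally_pdist.
    apply (H (fun y => Rabs (y - f p) < eps)). exists (mkposreal _ Heps). intros y Hy. exact Hy.
  - intros H P [e HP]. destruct (H e (cond_pos e)) as [d [Hd Hq]].
    apply locally_pdist. exists d. split; [assumption|]. intros q Hpq. apply HP, Hq, Hpq.
Qed.

Lemma cont2_cts (f : pt -> R) : cont2 f <-> cts f.
Proof.
  unfold cont2, cts. split; intros H p.
  - apply (proj2 (cts_pdist f p)). intros e He. exact (H p e He).
  - intros e He. pose proof (proj1 (cts_pdist f p) (H p) e He) as [d Hd]. exists d. exact Hd.
Qed.

Lemma pdist_sym (p q : pt) : pdist p q = pdist q p.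
Proof. unfold pdist. f_equal. ring. Qed.

Lemma pdist_refl (p : pt) : pdist p p = 0.
Proof. unfold pdist. replace (_ + _) with 0 by ring. apply sqrt_0. Qed.

Lemma pdist_pos (p q : pt) : 0 <= pdist p q.
Proof. apply sqrt_pos. Qed.

Lemma pdist_sq (p q : pt) : pdist p q ^ 2 = (fst p - fst q) ^ 2 + (snd p - snd q) ^ 2.
Proof. unfold pdist. apply pow2_sqrt. apply Rplus_le_le_0_compat; apply pow2_ge_0. Qed.

Lemma pdist_tri (p q s : pt) : pdist p s <= pdist p q + pdist q s.
Proof.
  pose proof (pdist_pos p q); pose proof (pdist_pos q s); pose proof (pdist_pos p s).
  apply Rsqr_incr_0_var; [|lra]. unfold Rsqr.
  pose proof (pdist_sq p q) as A; pose proof (pdist_sq q s) as B; pose proof (pdist_sq p s) as C.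
  set (a := pdist p q) in *; set (b := pdist q s) in *; set (c := pdist p s) in *.
  set (u1 := fst p - fst q) in *; set (u2 := snd p - snd q) in *.
  set (v1 := fst q - fst s) in *; set (v2 := snd q - snd s) in *.
  assert (E1 : fst p - fst s = u1 + v1) by (unfold u1, v1; ring).
  assert (E2 : snd p - snd s = u2 + v2) by (unfold u2, v2; ring).
  rewrite E1, E2 in C.
  assert (CS : u1 * v1 + u2 * v2 <= a * b).
  { destruct (Rle_or_lt (u1 * v1 + u2 * v2) 0); [nra|].
    apply Rsqr_incr_0_var; [|nra]. unfold Rsqr.
    replace (a * b * (a * b)) with (a ^ 2 * b ^ 2) by ring. rewrite A, B.
    pose proof (pow2_ge_0 (u1 * v2 - u2 * v1)). lra. }
  replace (c * c) with (c ^ 2) by ring. rewrite C.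
  replace ((a + b) * (a + b)) with (a ^ 2 + b ^ 2 + 2 * (a * b)) by ring. rewrite A, B. lra.
Qed.

(** * Continuity of integrals with a parameter *)

Section ParamIntegral.
Context {T : UniformSpace}.

(** Compactness of [[a, b]] makes continuity at the points [(s, z0)] uniform in [s]. The radius is
    chosen for [eps / 2] because both [h s z] and [h s z0] are compared with the value at a centre
    [t] near [s]. *)
Lemma tube (h : R -> T -> R) (a b : R) (z0 : T) :
  (forall s, a <= s <= b -> continuous (fun p : R * T => h (fst p) (snd p)) (s, z0)) ->
  forall eps, 0 < eps ->
    locally z0 (fun z => forall s, a <= s <= b -> Rabs (h s z - h s z0) < eps).
Proof.
  intros Hc eps Heps.
  assert (Hd : forall s, exists d : posreal, a <= s <= b -> forall s' z,
     Rabs (s' - s) < d -> ball z0 d z -> Rabs (h s' z - h s z0) < eps / 2).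
  { intros s. destruct (classic (a <= s <= b)) as [Hs|Hs].
    - assert (He2 : 0 < eps / 2) by lra.
      destruct (Hc s Hs (fun y => Rabs (y - h s z0) < eps / 2)) as [d Hd].
      { exists (mkposreal _ He2). intros y Hy. exact Hy. }
      exists d. intros _ s' z H1 H2. apply (Hd (s', z)). split; assumption.
    - exists (mkposreal 1 Rlt_0_1). tauto. }
  set (delta := fun s => proj1_sig (constructive_indefinite_description _ (Hd s))).
  destruct (compactness_value_1d a b delta) as [d Hcomp].
  exists d. intros z Hz s Hs. apply NNPP. intros Hn.
  apply (Hcomp s Hs). intros [t [Ht [H1 H2]]]. apply Hn. clear Hn.
  pose proof (proj2_sig (constructive_indefinite_description _ (Hd t)) Ht) as Hp.
  fold (delta t) in Hp.
  assert (A1 := Hp s z H1 (ball_le z0 d (delta t) H2 z Hz)).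
  assert (A2 := Hp s z0 H1 (ball_center z0 (delta t))).
  replace (h s z - h s z0) with ((h s z - h t z0) - (h s z0 - h t z0)) by ring.
  eapply Rle_lt_trans; [apply Rabs_triang|]. rewrite Rabs_Ropp. lra.
Qed.

Lemma continuous_RInt_param (h : R -> T -> R) (a b : R) (z0 : T) :
  a <= b ->
  (forall s, a <= s <= b -> continuous (fun p : R * T => h (fst p) (snd p)) (s, z0)) ->
  (forall z s, continuous (fun s => h s z) s) ->
  continuous (fun z => RInt (fun s => h s z) a b) z0.
Proof.
  intros Hab Hc Hs P [eps HP].
  (* The added 1 keeps the denominator positive when [a = b] and makes the final inequality
     strict. *)
  assert (He : 0 < eps / (b - a + 1)) by (apply Rdiv_lt_0_compat; [apply cond_pos|lra]).
  destruct (tube h a b z0 Hc _ He) as [d Hd].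
  exists d. intros z Hz. apply HP. unfold ball; simpl; unfold AbsRing_ball, abs, minus, plus, opp; simpl.
  assert (E : forall z, ex_RInt (fun s => h s z) a b)
    by (intros; apply (@ex_RInt_continuous R_CompleteNormedModule); intros; apply Hs).
  pose proof (RInt_minus (V := R_CompleteNormedModule) (fun s => h s z) (fun s => h s z0) a b (E z) (E z0)) as Em.
  unfold minus at 2, plus, opp in Em; simpl in Em.
  change (Rabs (RInt (fun s => h s z) a b + - RInt (fun s => h s z0) a b) < eps).
  rewrite <- Em.
  eapply Rle_lt_trans.
  - apply abs_RInt_le_const with (M := eps / (b - a + 1)); [assumption| |].
    + apply (ex_RInt_minus (V := R_NormedModule)); apply E.
    + intros t Ht. apply Rlt_le, (Hd z Hz t Ht).
  - apply Rle_lt_trans with ((b - a) / (b - a + 1) * eps).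
    + right; field; lra.
    + pose proof (cond_pos eps). assert ((b - a) / (b - a + 1) < 1) by (apply Rlt_div_l; lra). nra.
Qed.
End ParamIntegral.

Definition inner (L : R) (f : pt -> R) (x : R) : R := RInt (fun y => f (x, y)) (- L) L.
Definition I2 (L : R) (f : pt -> R) : R := RInt (inner L f) (- L) L.

Lemma cts_snd_slice (f : pt -> R) (x y : R) : cts f -> continuous (fun y => f (x, y)) y.
Proof.
  intros H. apply (continuous_comp_2 (fun _ : R => x) (fun y : R => y) (fun a b : R => f (a, b))).
  - apply continuous_const.
  - apply continuous_id.
  - apply (continuous_ext f); [intros [? ?]; reflexivity|apply H].
Qed.

Lemma cts_fst_slice (f : pt -> R) (x y : R) : cts f -> continuous (fun x => f (x, y)) x.
Proof.
  intros H. apply (continuous_comp_2 (fun x : R => x) (fun _ : R => y) (fun a b : R => f (a, b))).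
  - apply continuous_id.
  - apply continuous_const.
  - apply (continuous_ext f); [intros [? ?]; reflexivity|apply H].
Qed.

Lemma cts_ex_slice (f : pt -> R) (x a b : R) : cts f -> ex_RInt (fun y => f (x, y)) a b.
Proof.
  intros H. apply (@ex_RInt_continuous R_CompleteNormedModule). intros; apply cts_snd_slice, H.
Qed.

Lemma cts_inner (L : R) (f : pt -> R) (x : R) : 0 <= L -> cts f -> continuous (inner L f) x.
Proof.
  intros HL H. unfold inner.
  apply (continuous_RInt_param (fun s x => f (x, s))).
  - lra.
  - intros s _. apply (continuous_comp_2 (fun p : R * R => snd p) (fun p : R * R => fst p) (fun a b : R => f (a, b))).
    + apply continuous_snd.
    + apply continuous_fst.
    + apply (continuous_ext f); [intros [? ?]; reflexivity|apply H].
  - intros z s. apply cts_snd_slice, H.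
Qed.

Lemma cts_ex_inner (L : R) (f : pt -> R) (a b : R) : 0 <= L -> cts f -> ex_RInt (inner L f) a b.
Proof.
  intros HL H. apply (@ex_RInt_continuous R_CompleteNormedModule). intros; apply cts_inner; assumption.
Qed.

Definition ex_I2 (L : R) (f : pt -> R) : Prop :=
  (forall x, ex_RInt (fun y => f (x, y)) (- L) L) /\ ex_RInt (inner L f) (- L) L.

Lemma cts_ex_I2 (L : R) (f : pt -> R) : 0 <= L -> cts f -> ex_I2 L f.
Proof. intros HL H. split; [intros; apply cts_ex_slice|apply cts_ex_inner]; assumption. Qed.

Lemma ex_I2_plus (L : R) (f g : pt -> R) : ex_I2 L f -> ex_I2 L g ->
  ex_I2 L (fun p => f p + g p) /\ I2 L (fun p => f p + g p) = I2 L f + I2 L g.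
Proof.
  intros [F1 F2] [G1 G2].
  assert (E : forall x, inner L (fun p => f p + g p) x = plus (inner L f x) (inner L g x)).
  { intros x. unfold inner. apply (RInt_plus (V := R_CompleteNormedModule)); [apply F1|apply G1]. }
  split; [split|].
  - intros x. apply (ex_RInt_plus (V := R_NormedModule)); [apply F1|apply G1].
  - apply (ex_RInt_ext (fun x => plus (inner L f x) (inner L g x))).
    + intros; symmetry; apply E.
    + apply (ex_RInt_plus (V := R_NormedModule)); assumption.
  - unfold I2. rewrite (RInt_ext _ (fun x => plus (inner L f x) (inner L g x))) by (intros; apply E).
    apply (RInt_plus (V := R_CompleteNormedModule)); assumption.
Qed.

Lemma ex_I2_scal (L k : R) (f : pt -> R) : ex_I2 L f ->
  ex_I2 L (fun p => k * f p) /\ I2 L (fun p => k * f p) = k * I2 L f.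
Proof.
  intros [F1 F2].
  assert (E : forall x, inner L (fun p => k * f p) x = scal k (inner L f x)).
  { intros x. unfold inner. apply (RInt_scal (V := R_CompleteNormedModule)). apply F1. }
  split; [split|].
  - intros x. apply (ex_RInt_scal (V := R_NormedModule)). apply F1.
  - apply (ex_RInt_ext (fun x => scal k (inner L f x))).
    + intros; symmetry; apply E.
    + apply (ex_RInt_scal (V := R_NormedModule)); assumption.
  - unfold I2. rewrite (RInt_ext _ (fun x => scal k (inner L f x))) by (intros; apply E).
    apply (RInt_scal (V := R_CompleteNormedModule)); assumption.
Qed.

Lemma I2_le (L : R) (f g : pt -> R) : 0 <= L -> ex_I2 L f -> ex_I2 L g ->
  (forall x y, - L < x < L -> - L < y < L -> f (x, y) <= g (x, y)) -> I2 L f <= I2 L g.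
Proof.
  intros HL [F1 F2] [G1 G2] H.
  apply RInt_le; [lra|assumption|assumption|]. intros x Hx.
  apply RInt_le; [lra|apply F1|apply G1|]. intros y Hy. apply H; assumption.
Qed.

Lemma I2_ext (L : R) (f g : pt -> R) :
  (forall p, f p = g p) -> I2 L f = I2 L g.
Proof. intros H. replace g with f; [reflexivity|]. apply functional_extensionality, H. Qed.

Lemma I2_const (L k : R) : I2 L (fun _ => k) = k * (2 * L) ^ 2.
Proof.
  unfold I2, inner. rewrite (RInt_ext _ (fun _ => 2 * L * k)).
  - rewrite RInt_const. unfold scal; simpl; unfold mult; simpl. ring.
  - intros. rewrite RInt_const. unfold scal; simpl; unfold mult; simpl. ring.
Qed.

Lemma ex_I2_const (L k : R) : 0 <= L -> ex_I2 L (fun _ => k).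
Proof. intros. apply cts_ex_I2; [assumption|]. intros p. apply continuous_const. Qed.

Definition outside0 (L : R) (f : pt -> R) : Prop :=
  forall x y, L <= Rabs x \/ L <= Rabs y -> f (x, y) = 0.

Lemma Rabs_ge (L x : R) : x <= - L \/ L <= x -> L <= Rabs x.
Proof. intros [H|H]; unfold Rabs; destruct (Rcase_abs x); lra. Qed.

Lemma RInt_outside (g : R -> R) (L0 L : R) : 0 <= L0 <= L ->
  (forall x, continuous g x) -> (forall x, L0 <= Rabs x -> g x = 0) ->
  RInt g (- L) L = RInt g (- L0) L0.
Proof.
  intros HL Hg H0.
  assert (E : forall a b, ex_RInt g a b)
    by (intros; apply (@ex_RInt_continuous R_CompleteNormedModule); intros; apply Hg).
  rewrite <- (RInt_Chasles g (- L) (- L0) L) by apply E.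
  rewrite <- (RInt_Chasles g (- L0) L0 L) by apply E.
  rewrite (RInt_ext g (fun _ => 0) (- L) (- L0)).
  2:{ intros x. rewrite Rmin_left, Rmax_right by lra. intros. apply H0, Rabs_ge. lra. }
  rewrite (RInt_ext g (fun _ => 0) L0 L).
  2:{ intros x. rewrite Rmin_left, Rmax_right by lra. intros. apply H0, Rabs_ge. lra. }
  rewrite !RInt_const. unfold plus, scal; simpl; unfold mult; simpl. ring.
Qed.

Lemma I2_outside (L0 L : R) (f : pt -> R) : 0 <= L0 <= L -> cts f -> outside0 L0 f ->
  I2 L f = I2 L0 f.
Proof.
  intros HL Hc H0. unfold I2.
  rewrite (RInt_outside (inner L f) L0 L HL).
  - apply RInt_ext. intros x _. unfold inner. apply RInt_outside; [assumption| |].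
    + intros; apply cts_snd_slice, Hc.
    + intros y Hy. apply H0. right; assumption.
  - intros; apply cts_inner; [lra|assumption].
  - intros x Hx. unfold inner. rewrite (RInt_ext _ (fun _ => 0)).
    + rewrite RInt_const. unfold scal; simpl; unfold mult; simpl. ring.
    + intros y _. apply H0. left; assumption.
Qed.

Lemma Rint_RInt (f : R -> R) (a b I : R) : Rint f a b I <-> ex_RInt f a b /\ RInt f a b = I.
Proof.
  split.
  - intros [pr Hpr]. split; [apply ex_RInt_Reals_1, pr|]. rewrite (RInt_Reals f a b pr). exact Hpr.
  - intros [H1 H2]. exists (ex_RInt_Reals_0 f a b H1). rewrite <- RInt_Reals. exact H2.
Qed.

(** Turns the existential inner integral [g] of [integral2] into the function [inner L f], so that
    linearity and monotonicity can be used on one fixed square. *)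
Lemma integral2_I2 (f : pt -> R) (I : R) :
  integral2 f I <-> exists L0, forall L, L0 <= L -> ex_I2 L f /\ I2 L f = I.
Proof.
  split; intros [L0 H]; exists L0; intros L HL; specialize (H L HL).
  - destruct H as [g [Hg HI]].
    assert (E : forall x, inner L f x = g x) by (intros x; apply (Rint_RInt (fun y => f (x, y))), Hg).
    assert (E' : inner L f = g) by (apply functional_extensionality, E).
    apply Rint_RInt in HI. unfold ex_I2, I2. rewrite E'. split; [split|]; try apply HI.
    intros x. apply (Rint_RInt _ _ _ (g x)), Hg.
  - destruct H as [[H1 H2] H3]. exists (inner L f). split.
    + intros x. apply Rint_RInt. split; [apply H1|reflexivity].
    + apply Rint_RInt. split; assumption.
Qed.

Lemma integral2_cts (L : R) (f : pt -> R) : 0 <= L -> cts f -> outside0 L f -> integral2 f (I2 L f).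
Proof.
  intros HL Hc H0. apply integral2_I2. exists L. intros L' HL'. split.
  - apply cts_ex_I2; [lra|assumption].
  - apply I2_outside; [lra|assumption|assumption].
Qed.

Lemma continuity_2d_cts (f : pt -> R) (x y : R) : continuous f (x, y) -> continuity_2d_pt (fun u v => f (u, v)) x y.
Proof.
  intros H. apply continuity_2d_pt_filterlim. simpl.
  apply (continuous_ext f (fun z => f (fst z, snd z))); [intros [? ?]; reflexivity|exact H].
Qed.

Lemma inner_derive (L : R) (P Px : pt -> R) (x : R) :
  cts P -> cts Px -> (forall x y, is_derive (fun t => P (t, y)) x (Px (x, y))) ->
  is_derive (inner L P) x (inner L Px x).
Proof.
  intros HP HPx Hd. unfold inner.
  assert (E : forall u v, Derive (fun z => P (z, v)) u = Px (u, v))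
    by (intros; apply is_derive_unique, Hd).
  rewrite <- (RInt_ext (fun t => Derive (fun u => P (u, t)) x)) by (intros; apply E).
  apply (is_derive_RInt_param (fun u t => P (u, t))).
  - apply filter_forall. intros u t _. eexists. apply Hd.
  - intros t _. apply continuity_2d_pt_ext with (fun u v => Px (u, v)).
    + intros; symmetry; apply E.
    + apply continuity_2d_cts, HPx.
  - apply filter_forall. intros u. apply cts_ex_slice, HP.
Qed.

(** The derivative is taken out of the inner integral and the fundamental theorem is applied to the
    outer one. Treating the two coordinate directions separately avoids exchanging the order of
    integration. *)
Lemma I2_dx (L : R) (P Px : pt -> R) : 0 <= L -> cts P -> cts Px ->
  (forall x y, is_derive (fun t => P (t, y)) x (Px (x, y))) -> outside0 L P -> I2 L Px = 0.
Proof.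
  intros HL HP HPx Hd H0. unfold I2.
  assert (Z : forall x, L <= Rabs x -> inner L P x = 0).
  { intros x Hx. unfold inner. rewrite (RInt_ext _ (fun _ => 0)).
    - rewrite RInt_const. unfold scal; simpl; unfold mult; simpl. ring.
    - intros y _. apply H0. left; assumption. }
  apply is_RInt_unique.
  replace 0 with (minus (inner L P L) (inner L P (- L))).
  - apply (is_RInt_derive (inner L P) (inner L Px)).
    + intros; apply inner_derive; assumption.
    + intros; apply cts_inner; assumption.
  - rewrite !Z by (apply Rabs_ge; lra). unfold minus, plus, opp; simpl. ring.
Qed.

Lemma I2_dy (L : R) (P Py : pt -> R) : 0 <= L -> cts P -> cts Py ->
  (forall x y, is_derive (fun t => P (x, t)) y (Py (x, y))) -> outside0 L P -> I2 L Py = 0.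
Proof.
  intros HL HP HPy Hd H0. unfold I2.
  rewrite (RInt_ext _ (fun _ => 0)).
  - rewrite RInt_const. unfold scal; simpl; unfold mult; simpl. ring.
  - intros x _. unfold inner. apply is_RInt_unique.
    replace 0 with (minus (P (x, L)) (P (x, - L))).
    + apply (is_RInt_derive (fun y => P (x, y))).
      * intros; apply Hd.
      * intros; apply cts_snd_slice, HPy.
    + rewrite !H0 by (right; apply Rabs_ge; lra). unfold minus, plus, opp; simpl. ring.
Qed.

Lemma I2_pos (L : R) (f : pt -> R) (x0 y0 : R) : cts f -> (forall p, 0 <= f p) ->
  - L < x0 < L -> - L < y0 < L -> 0 < f (x0, y0) -> 0 < I2 L f.
Proof.
  intros Hc Hp Hx Hy H0.
  assert (pos : forall g a b x, a < x < b -> (forall t, continuous g t) -> (forall t, 0 <= g t) -> 0 < g x -> 0 < RInt g a b).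
  { intros g a b x Hab Hg Hg0 Hgx.
    assert (E : forall a b, ex_RInt g a b)
      by (intros; apply (@ex_RInt_continuous R_CompleteNormedModule); intros; apply Hg).
    assert (He : 0 < g x / 2) by lra.
    destruct (Hg x (fun y => Rabs (y - g x) < g x / 2)) as [d Hd].
    { exists (mkposreal _ He). intros y Hy'. exact Hy'. }
    set (e := Rmin (d / 2) (Rmin (x - a) (b - x))).
    assert (He' : 0 < e) by (pose proof (cond_pos d); unfold e; repeat apply Rmin_pos; lra).
    assert (e <= d / 2 /\ e <= x - a /\ e <= b - x).
    { unfold e. pose proof (Rmin_l (d / 2) (Rmin (x - a) (b - x))).
      pose proof (Rmin_r (d / 2) (Rmin (x - a) (b - x))).
      pose proof (Rmin_l (x - a) (b - x)). pose proof (Rmin_r (x - a) (b - x)). lra. }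
    rewrite <- (RInt_Chasles g a x b) by apply E.
    rewrite <- (RInt_Chasles g x (x + e) b) by apply E.
    assert (0 <= RInt g a x) by (apply RInt_ge_0; [lra|apply E|intros; apply Hg0]).
    assert (0 <= RInt g (x + e) b) by (apply RInt_ge_0; [lra|apply E|intros; apply Hg0]).
    assert (g x / 2 * e <= RInt g x (x + e)).
    { apply Rle_trans with (RInt (fun _ => g x / 2) x (x + e)).
      - rewrite RInt_const. unfold scal; simpl; unfold mult; simpl. lra.
      - apply RInt_le; [lra|apply ex_RInt_const|apply E|]. intros t Ht.
        assert (Hgt : Rabs (g t - g x) < g x / 2).
        { apply Hd. unfold ball; simpl; unfold AbsRing_ball, abs, minus, plus, opp; simpl.
          rewrite Rabs_pos_eq; lra. }
        apply Rabs_def2 in Hgt. lra. }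
    unfold plus; simpl. nra. }
  apply (pos _ _ _ x0); [assumption| | |].
  - intros; apply cts_inner; [lra|assumption].
  - intros t. apply RInt_ge_0; [lra|apply cts_ex_slice, Hc|intros; apply Hp].
  - apply (pos _ _ _ y0); [assumption| | |assumption].
    + intros; apply cts_snd_slice, Hc.
    + intros; apply Hp.
Qed.

(** * Functions of class C1 and the divergence theorem *)

(** A pointwise predicate, so that one global function can be checked separately near its support
    and away from it, by [C1p_ext_loc] and [C1p_zero]. The derivatives are carried as explicit
    functions because divergences enter pointwise inequalities. *)
Definition C1p (F Fx Fy : pt -> R) (p : pt) : Prop :=
  is_derive (fun t => F (t, snd p)) (fst p) (Fx p) /\
  is_derive (fun t => F (fst p, t)) (snd p) (Fy p) /\
  continuous F p /\ continuous Fx p /\ continuous Fy p.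

Lemma pt_eta (p : pt) : (fst p, snd p) = p.
Proof. destruct p; reflexivity. Qed.

Lemma C1p_const (k : R) (p : pt) : C1p (fun _ => k) (fun _ => 0) (fun _ => 0) p.
Proof.
  split; [|split; [|split; [|split]]]; try apply continuous_const; apply (is_derive_const k).
Qed.

Lemma C1p_fst (p : pt) : C1p (fun q => fst q) (fun _ => 1) (fun _ => 0) p.
Proof.
  split; [|split; [|split; [|split]]]; try apply continuous_const.
  - apply (is_derive_id (fst p)).
  - apply (is_derive_const (fst p)).
  - apply (continuous_fst (U := R_UniformSpace) (V := R_UniformSpace)).
Qed.

Lemma C1p_snd (p : pt) : C1p (fun q => snd q) (fun _ => 0) (fun _ => 1) p.
Proof.
  split; [|split; [|split; [|split]]]; try apply continuous_const.
  - apply (is_derive_const (snd p)).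
  - apply (is_derive_id (snd p)).
  - apply (continuous_snd (U := R_UniformSpace) (V := R_UniformSpace)).
Qed.

Lemma cont_plus (F G : pt -> R) (p : pt) : continuous F p -> continuous G p -> continuous (fun q => F q + G q) p.
Proof. intros. apply (continuous_plus (V := R_NormedModule) F G p); assumption. Qed.

Lemma cont_mult (F G : pt -> R) (p : pt) : continuous F p -> continuous G p -> continuous (fun q => F q * G q) p.
Proof. intros. apply (continuous_mult (K := R_AbsRing) F G p); assumption. Qed.

Lemma cont_comp (h : R -> R) (F : pt -> R) (p : pt) : continuous h (F p) -> continuous F p -> continuous (fun q => h (F q)) p.
Proof. intros. apply (continuous_comp F h); assumption. Qed.

Lemma C1p_plus (F Fx Fy G Gx Gy : pt -> R) (p : pt) : C1p F Fx Fy p -> C1p G Gx Gy p ->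
  C1p (fun q => F q + G q) (fun q => Fx q + Gx q) (fun q => Fy q + Gy q) p.
Proof.
  intros (A1 & A2 & A3 & A4 & A5) (B1 & B2 & B3 & B4 & B5).
  split; [|split; [|split; [|split]]]; [| |apply cont_plus; assumption..].
  - apply (is_derive_plus (V := R_NormedModule) (fun t => F (t, snd p)) (fun t => G (t, snd p))); assumption.
  - apply (is_derive_plus (V := R_NormedModule) (fun t => F (fst p, t)) (fun t => G (fst p, t))); assumption.
Qed.

Lemma C1p_mult (F Fx Fy G Gx Gy : pt -> R) (p : pt) : C1p F Fx Fy p -> C1p G Gx Gy p ->
  C1p (fun q => F q * G q) (fun q => Fx q * G q + F q * Gx q) (fun q => Fy q * G q + F q * Gy q) p.
Proof.
  intros (A1 & A2 & A3 & A4 & A5) (B1 & B2 & B3 & B4 & B5).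
  split; [|split; [|split; [|split]]];
    [| |apply cont_mult; assumption|apply cont_plus; apply cont_mult; assumption..].
  - pose proof (is_derive_mult (K := R_AbsRing) (fun t => F (t, snd p)) (fun t => G (t, snd p)) _ _ _ A1 B1 Rmult_comm) as H.
    simpl in H. rewrite pt_eta in H. exact H.
  - pose proof (is_derive_mult (K := R_AbsRing) (fun t => F (fst p, t)) (fun t => G (fst p, t)) _ _ _ A2 B2 Rmult_comm) as H.
    simpl in H. rewrite pt_eta in H. exact H.
Qed.

Lemma C1p_comp (h h' : R -> R) (F Fx Fy : pt -> R) (p : pt) :
  is_derive h (F p) (h' (F p)) -> continuous h' (F p) -> C1p F Fx Fy p ->
  C1p (fun q => h (F q)) (fun q => h' (F q) * Fx q) (fun q => h' (F q) * Fy q) p.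
Proof.
  intros Hh Hc (A1 & A2 & A3 & A4 & A5).
  split; [|split; [|split; [|split]]].
  - rewrite Rmult_comm. apply (is_derive_comp (V := R_NormedModule) h (fun t => F (t, snd p))); [|exact A1].
    simpl. rewrite pt_eta. exact Hh.
  - rewrite Rmult_comm. apply (is_derive_comp (V := R_NormedModule) h (fun t => F (fst p, t))); [|exact A2].
    simpl. rewrite pt_eta. exact Hh.
  - apply cont_comp; [|assumption].
    apply (ex_derive_continuous (V := R_NormedModule)). eexists; exact Hh.
  - apply cont_mult; [apply cont_comp|]; assumption.
  - apply cont_mult; [apply cont_comp|]; assumption.
Qed.

Lemma locally_lines (p : pt) (Q : pt -> Prop) : locally p Q ->
  locally (fst p) (fun t => Q (t, snd p)) /\ locally (snd p) (fun t => Q (fst p, t)).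
Proof.
  intros [e He]. split; exists e; intros t Ht; apply He; split; simpl; try exact Ht; apply ball_center.
Qed.

Lemma C1p_ext_loc (F Fx Fy G Gx Gy : pt -> R) (p : pt) :
  locally p (fun q => F q = G q /\ Fx q = Gx q /\ Fy q = Gy q) -> C1p F Fx Fy p -> C1p G Gx Gy p.
Proof.
  intros HQ (A1 & A2 & A3 & A4 & A5).
  pose proof (locally_singleton _ _ HQ) as (E1 & E2 & E3).
  destruct (locally_lines p _ HQ) as [L1 L2].
  split; [|split; [|split; [|split]]].
  - rewrite <- E2. apply (is_derive_ext_loc (fun t => F (t, snd p))); [|assumption].
    revert L1. apply filter_imp. intros t Ht. apply Ht.
  - rewrite <- E3. apply (is_derive_ext_loc (fun t => F (fst p, t))); [|assumption].
    revert L2. apply filter_imp. intros t Ht. apply Ht.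
  - apply (continuous_ext_loc _ F); [|assumption]. revert HQ. apply filter_imp. intros t Ht. apply Ht.
  - apply (continuous_ext_loc _ Fx); [|assumption]. revert HQ. apply filter_imp. intros t Ht. apply Ht.
  - apply (continuous_ext_loc _ Fy); [|assumption]. revert HQ. apply filter_imp. intros t Ht. apply Ht.
Qed.

Lemma C1p_ext (F Fx Fy G Gx Gy : pt -> R) (p : pt) :
  (forall q, F q = G q) -> (forall q, Fx q = Gx q) -> (forall q, Fy q = Gy q) ->
  C1p F Fx Fy p -> C1p G Gx Gy p.
Proof.
  intros H1 H2 H3. apply C1p_ext_loc. apply filter_forall. intros q; auto.
Qed.

Lemma C1p_zero (F Fx Fy : pt -> R) (p : pt) :
  locally p (fun q => F q = 0 /\ Fx q = 0 /\ Fy q = 0) -> C1p F Fx Fy p.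
Proof.
  intros H. apply (C1p_ext_loc (fun _ => 0) (fun _ => 0) (fun _ => 0)).
  - revert H. apply filter_imp. intros q (-> & -> & ->). auto.
  - apply C1p_const.
Qed.

Lemma C1p_scal (k : R) (F Fx Fy : pt -> R) (p : pt) : C1p F Fx Fy p ->
  C1p (fun q => k * F q) (fun q => k * Fx q) (fun q => k * Fy q) p.
Proof.
  intros H. eapply C1p_ext; [| | |apply (C1p_mult _ _ _ _ _ _ p (C1p_const k p) H)];
    intros q; simpl; ring.
Qed.

Lemma C1p_inv (F Fx Fy : pt -> R) (p : pt) : F p <> 0 -> C1p F Fx Fy p ->
  C1p (fun q => / F q) (fun q => - Fx q / F q ^ 2) (fun q => - Fy q / F q ^ 2) p.
Proof.
  intros Hp H. eapply C1p_ext; [| | |apply (C1p_comp Rinv (fun t => - 1 / t ^ 2) F Fx Fy p)].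
  - reflexivity.
  - intros q; simpl; unfold Rdiv; ring.
  - intros q; simpl; unfold Rdiv; ring.
  - auto_derive; [assumption|]. field; assumption.
  - apply (ex_derive_continuous (V := R_NormedModule)). auto_derive. 
    apply Rmult_integral_contrapositive_currified; [assumption|].
    apply Rmult_integral_contrapositive_currified; [assumption|lra].
  - assumption.
Qed.

Lemma C1p_div (F Fx Fy G Gx Gy : pt -> R) (p : pt) : G p <> 0 -> C1p F Fx Fy p -> C1p G Gx Gy p ->
  C1p (fun q => F q / G q) (fun q => Fx q / G q - F q * Gx q / G q ^ 2)
      (fun q => Fy q / G q - F q * Gy q / G q ^ 2) p.
Proof.
  intros Hp HF HG. eapply C1p_ext; [| | |apply (C1p_mult _ _ _ _ _ _ p HF (C1p_inv _ _ _ p Hp HG))];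
    intros q; simpl; unfold Rdiv; ring.
Qed.

Lemma C1p_cts (F Fx Fy : pt -> R) : (forall p, C1p F Fx Fy p) -> cts F /\ cts Fx /\ cts Fy.
Proof. intros H. repeat split; intros p; apply (H p). Qed.

Lemma C1p_I2x (L : R) (F Fx Fy : pt -> R) : 0 <= L -> (forall p, C1p F Fx Fy p) -> outside0 L F ->
  I2 L Fx = 0 /\ I2 L Fy = 0.
Proof.
  intros HL H H0. destruct (C1p_cts _ _ _ H) as (A & B & C). split.
  - apply (I2_dx L F); try assumption. intros x y. apply (H (x, y)).
  - apply (I2_dy L F); try assumption. intros x y. apply (H (x, y)).
Qed.

Lemma smooth_C1p (u ux uy : pt -> R) : smooth u -> partial_x u ux -> partial_y u uy ->
  forall p, C1p u ux uy p.
Proof.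
  intros [fx fy Hc Hx Hy [? ? Hcx _ _ _ _] [? ? Hcy _ _ _ _]] Hux Huy.
  assert (E1 : fx = ux).
  { apply functional_extensionality. intros [x y].
    apply (uniqueness_limite (fun t => u (t, y)) x); [apply Hx|apply Hux]. }
  assert (E2 : fy = uy).
  { apply functional_extensionality. intros [x y].
    apply (uniqueness_limite (fun t => u (x, t)) y); [apply Hy|apply Huy]. }
  subst. intros [x y]. split; [|split; [|split; [|split]]].
  - apply is_derive_Reals, Hux.
  - apply is_derive_Reals, Huy.
  - apply cont2_cts, Hc.
  - apply cont2_cts, Hcx.
  - apply cont2_cts, Hcy.
Qed.

Lemma C1p_partial (u ux uy : pt -> R) : (forall p, C1p u ux uy p) -> partial_x u ux /\ partial_y u uy.
Proof.
  intros H. split; intros x y; apply is_derive_Reals; apply (H (x, y)).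
Qed.

(* Barta's method. *)
Lemma barta (Om : pt -> Prop) (u ux uy : pt -> R) (A B c L0 : R) :
  integral2 (fun p => ux p ^ 2 + uy p ^ 2) A ->
  integral2 (fun p => u p ^ 2 / bdist Om p ^ 2) B ->
  cts ux -> cts uy ->
  (forall eta, 0 < eta -> exists X Xx Xy Y Yx Yy,
     (forall p, C1p X Xx Xy p) /\ (forall p, C1p Y Yx Yy p) /\
     outside0 L0 X /\ outside0 L0 Y /\
     forall p, c * (u p ^ 2 / bdist Om p ^ 2) - eta <= ux p ^ 2 + uy p ^ 2 + Xx p + Yy p) ->
  c * B <= A.
Proof.
  intros HA HB Hcx Hcy H.
  apply integral2_I2 in HA. destruct HA as [L1 HA].
  apply integral2_I2 in HB. destruct HB as [L2 HB].
  set (L := Rmax (Rmax L1 L2) (Rmax L0 1)).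
  assert (HL : L1 <= L /\ L2 <= L /\ L0 <= L /\ 1 <= L).
  { unfold L. pose proof (Rmax_l (Rmax L1 L2) (Rmax L0 1)). pose proof (Rmax_r (Rmax L1 L2) (Rmax L0 1)).
    pose proof (Rmax_l L1 L2). pose proof (Rmax_r L1 L2). pose proof (Rmax_l L0 1). pose proof (Rmax_r L0 1). lra. }
  destruct HL as (HL1 & HL2 & HL0 & HL3).
  destruct (HA L HL1) as [EA <-]. destruct (HB L HL2) as [EB <-].
  apply le_epsilon. intros eps Heps.
  (* The pointwise error is integrated over a square of area [(2 * L) ^ 2]. *)
  assert (He : 0 < eps / (2 * L) ^ 2) by (apply Rdiv_lt_0_compat; [assumption|nra]).
  destruct (H _ He) as (X & Xx & Xy & Y & Yx & Yy & HX & HY & X0 & Y0 & Hp).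
  destruct (C1p_cts _ _ _ HX) as (_ & cX & _). destruct (C1p_cts _ _ _ HY) as (_ & _ & cY).
  assert (IX : I2 L Xx = 0).
  { apply (C1p_I2x L X Xx Xy); [lra|assumption|]. intros x y Hxy. apply X0. destruct Hxy; [left|right]; lra. }
  assert (IY : I2 L Yy = 0).
  { apply (C1p_I2x L Y Yx Yy); [lra|assumption|]. intros x y Hxy. apply Y0. destruct Hxy; [left|right]; lra. }
  assert (eX : ex_I2 L Xx) by (apply cts_ex_I2; [lra|assumption]).
  assert (eY : ex_I2 L Yy) by (apply cts_ex_I2; [lra|assumption]).
  destruct (ex_I2_plus L _ _ EA eX) as [e1 i1].
  destruct (ex_I2_plus L _ _ e1 eY) as [e2 i2].
  destruct (ex_I2_scal L c _ EB) as [e3 i3].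
  assert (e4 : ex_I2 L (fun _ => - (eps / (2 * L) ^ 2))) by (apply ex_I2_const; lra).
  destruct (ex_I2_plus L _ _ e3 e4) as [e5 i5].
  pose proof (I2_le L _ _ ltac:(lra) e5 e2) as Hle.
  rewrite i5, i3, i2, i1, I2_const, IX, IY in Hle.
  replace (- (eps / (2 * L) ^ 2) * (2 * L) ^ 2) with (- eps) in Hle by (field; lra).
  assert (forall a b, a + - eps <= b + 0 + 0 -> a <= b + eps) by (intros; lra).
  apply H0. apply Hle. intros x y _ _. specialize (Hp (x, y)). lra.
Qed.

(** * Polar coordinates and the distance in a sector *)

Lemma cos_2atan (t : R) : cos (2 * atan t) = (1 - t ^ 2) / (1 + t ^ 2).
Proof.
  rewrite cos_2a, cos_atan, sin_atan. unfold Rsqr.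
  assert (H : 0 < 1 + t * t) by nra.
  pose proof (sqrt_lt_R0 _ H). pose proof (sqrt_sqrt (1 + t * t) ltac:(lra)) as E.
  set (s := sqrt (1 + t * t)) in *.
  replace (t / s * (t / s)) with (t ^ 2 / (s * s)) by (field; lra).
  replace (1 / s * (1 / s)) with (1 / (s * s)) by (field; lra).
  rewrite E. field. nra.
Qed.

Lemma sin_2atan (t : R) : sin (2 * atan t) = 2 * t / (1 + t ^ 2).
Proof.
  rewrite sin_2a, cos_atan, sin_atan. unfold Rsqr.
  assert (H : 0 < 1 + t * t) by nra.
  pose proof (sqrt_lt_R0 _ H). pose proof (sqrt_sqrt (1 + t * t) ltac:(lra)) as E.
  set (s := sqrt (1 + t * t)) in *.
  replace (2 * (t / s) * (1 / s)) with (2 * t / (s * s)) by (field; lra).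
  rewrite E. field. nra.
Qed.

Lemma cont_gt (F : pt -> R) (p : pt) (a : R) : continuous F p -> a < F p -> locally p (fun q => a < F q).
Proof.
  intros HF Ha. apply (HF (fun y => a < y)). apply open_gt. exact Ha.
Qed.

Lemma cont_lt (F : pt -> R) (p : pt) (a : R) : continuous F p -> F p < a -> locally p (fun q => F q < a).
Proof.
  intros HF Ha. apply (HF (fun y => y < a)). apply open_lt. exact Ha.
Qed.

Section Polar.
Context (v : pt) (g : R).

Definition cX (p : pt) : R := (fst p - fst v) * cos g + (snd p - snd v) * sin g.
Definition cY (p : pt) : R := - (fst p - fst v) * sin g + (snd p - snd v) * cos g.
Definition rad (p : pt) : R := sqrt (cX p ^ 2 + cY p ^ 2).
(** Half-angle formula for the angle from the axis direction [g], smooth off the closed half line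
    opposite to [g]. On that half line the value is [PI]; this includes the vertex, which therefore
    counts as lying outside every sector [|ang| < b + PI / 2] with [b <= PI / 2]. *)
Definition ang (p : pt) : R :=
  if Rle_dec (rad p + cX p) 0 then PI else 2 * atan (cY p / (rad p + cX p)).

Definition ray (r x : R) : pt := (fst v + r * cos (g + x), snd v + r * sin (g + x)).

Lemma sc1 (x : R) : sin x ^ 2 + cos x ^ 2 = 1.
Proof. rewrite <- (sin2_cos2 x). unfold Rsqr. ring. Qed.

Lemma rad_pos (p : pt) : 0 <= rad p.
Proof. apply sqrt_pos. Qed.

Lemma rad_sq (p : pt) : rad p ^ 2 = cX p ^ 2 + cY p ^ 2.
Proof. unfold rad. apply pow2_sqrt. apply Rplus_le_le_0_compat; apply pow2_ge_0. Qed.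

Lemma rad_dist (p : pt) : rad p = pdist p v.
Proof.
  unfold rad, pdist, cX, cY. f_equal.
  set (dx := fst p - fst v). set (dy := snd p - snd v).
  transitivity ((dx ^ 2 + dy ^ 2) * (sin g ^ 2 + cos g ^ 2)); [ring|rewrite sc1; ring].
Qed.

Lemma rad_cX (p : pt) : 0 <= rad p + cX p.
Proof. pose proof (rad_pos p). pose proof (rad_sq p). pose proof (pow2_ge_0 (cY p)). nra. Qed.

Lemma cX_polar (p : pt) : cX p = rad p * cos (ang p) /\ cY p = rad p * sin (ang p).
Proof.
  pose proof (rad_pos p) as H0. pose proof (rad_sq p) as H1. pose proof (rad_cX p) as H2.
  unfold ang. destruct (Rle_dec (rad p + cX p) 0) as [H|H].
  - rewrite cos_PI, sin_PI. split; [lra|]. assert (cX p = - rad p) as E by lra. rewrite E in H1. nra.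
  - rewrite cos_2atan, sin_2atan.
    set (r := rad p) in *; set (x := cX p) in *; set (y := cY p) in *.
    assert (Hp : 0 < r + x) by lra.
    assert (Hy : y ^ 2 = (r - x) * (r + x)) by nra.
    assert (Hr : 0 < r) by nra.
    assert (E : (y / (r + x)) ^ 2 = (r - x) / (r + x)).
    { replace ((y / (r + x)) ^ 2) with (y ^ 2 / (r + x) ^ 2) by (field; lra). rewrite Hy. field. lra. }
    rewrite E. split; field; lra.
Qed.

Lemma ang_range (p : pt) : - PI < ang p <= PI.
Proof.
  pose proof PI_RGT_0. unfold ang. destruct (Rle_dec _ 0); [lra|].
  pose proof (atan_bound (cY p / (rad p + cX p))). lra.
Qed.

Lemma polar (p : pt) : fst p - fst v = rad p * cos (g + ang p) /\ snd p - snd v = rad p * sin (g + ang p).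
Proof.
  destruct (cX_polar p) as [E1 E2]. rewrite cos_plus, sin_plus.
  replace (rad p * (cos g * cos (ang p) - sin g * sin (ang p)))
    with (cos g * (rad p * cos (ang p)) - sin g * (rad p * sin (ang p))) by ring.
  replace (rad p * (sin g * cos (ang p) + cos g * sin (ang p)))
    with (sin g * (rad p * cos (ang p)) + cos g * (rad p * sin (ang p))) by ring.
  rewrite <- E1, <- E2. unfold cX, cY. pose proof (sc1 g) as H.
  set (dx := fst p - fst v). set (dy := snd p - snd v). split.
  - transitivity (dx * (sin g ^ 2 + cos g ^ 2)); [rewrite H; ring|ring].
  - transitivity (dy * (sin g ^ 2 + cos g ^ 2)); [rewrite H; ring|ring].
Qed.

Lemma polar_ray (p : pt) : p = ray (rad p) (ang p).
Proof.
  destruct (polar p) as [E1 E2]. unfold ray. rewrite <- E1, <- E2. destruct p; simpl. f_equal; ring.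
Qed.

Lemma cX_ray (r x : R) : cX (ray r x) = r * cos x /\ cY (ray r x) = r * sin x.
Proof.
  unfold cX, cY, ray; simpl. rewrite cos_plus, sin_plus. pose proof (sc1 g) as H. split.
  - transitivity (r * cos x * (sin g ^ 2 + cos g ^ 2)); [ring|rewrite H; ring].
  - transitivity (r * sin x * (sin g ^ 2 + cos g ^ 2)); [ring|rewrite H; ring].
Qed.

Lemma rad_ray (r x : R) : 0 <= r -> rad (ray r x) = r.
Proof.
  intros Hr. unfold rad. destruct (cX_ray r x) as [-> ->].
  replace (_ + _) with (r ^ 2 * (sin x ^ 2 + cos x ^ 2)) by ring. rewrite sc1, Rmult_1_r.
  apply sqrt_pow2, Hr.
Qed.

Lemma ang_ray (r x : R) : 0 < r -> - PI < x < PI -> ang (ray r x) = x.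
Proof.
  intros Hr Hx. unfold ang. rewrite rad_ray by lra. destruct (cX_ray r x) as [-> ->].
  assert (Hc : 0 < cos (x / 2)) by (apply cos_gt_0; lra).
  assert (E : cos x = 2 * cos (x / 2) ^ 2 - 1).
  { replace x with (2 * (x / 2)) at 1 by field. rewrite cos_2a_cos. ring. }
  assert (E' : sin x = 2 * sin (x / 2) * cos (x / 2)).
  { replace x with (2 * (x / 2)) at 1 by field. rewrite sin_2a. ring. }
  destruct (Rle_dec (r + r * cos x) 0) as [H|H].
  - exfalso. rewrite E in H. assert (0 < cos (x / 2) ^ 2) by (apply pow_lt, Hc). nra.
  - replace (r * sin x / (r + r * cos x)) with (tan (x / 2)).
    + rewrite atan_tan; lra.
    + unfold tan. rewrite E, E'.
      replace (r + r * (2 * cos (x / 2) ^ 2 - 1)) with (2 * r * cos (x / 2) ^ 2) by ring.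
      field. split; lra.
Qed.

Lemma ray0 (x : R) : ray 0 x = v.
Proof. unfold ray. destruct v; simpl. f_equal; ring. Qed.

Lemma C1p_cX (p : pt) : C1p cX (fun _ => cos g) (fun _ => sin g) p.
Proof.
  eapply C1p_ext; [| | |apply (C1p_plus _ _ _ _ _ _ p
    (C1p_scal (cos g) _ _ _ p (C1p_plus _ _ _ _ _ _ p (C1p_fst p) (C1p_const (- fst v) p)))
    (C1p_scal (sin g) _ _ _ p (C1p_plus _ _ _ _ _ _ p (C1p_snd p) (C1p_const (- snd v) p))))];
  intros q; unfold cX; simpl; ring.
Qed.

Lemma C1p_cY (p : pt) : C1p cY (fun _ => - sin g) (fun _ => cos g) p.
Proof.
  eapply C1p_ext; [| | |apply (C1p_plus _ _ _ _ _ _ p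
    (C1p_scal (- sin g) _ _ _ p (C1p_plus _ _ _ _ _ _ p (C1p_fst p) (C1p_const (- fst v) p)))
    (C1p_scal (cos g) _ _ _ p (C1p_plus _ _ _ _ _ _ p (C1p_snd p) (C1p_const (- snd v) p))))];
  intros q; unfold cY; simpl; ring.
Qed.

Lemma C1p_rad (p : pt) : 0 < rad p ->
  C1p rad (fun q => (fst q - fst v) / rad q) (fun q => (snd q - snd v) / rad q) p.
Proof.
  intros Hr.
  assert (Hs : 0 < cX p ^ 2 + cY p ^ 2) by (rewrite <- rad_sq; nra).
  assert (HS := C1p_plus _ _ _ _ _ _ p (C1p_mult _ _ _ _ _ _ p (C1p_cX p) (C1p_cX p))
                                       (C1p_mult _ _ _ _ _ _ p (C1p_cY p) (C1p_cY p))).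
  refine (C1p_ext _ _ _ _ _ _ p _ _ _ (C1p_comp sqrt (fun t => / (2 * sqrt t)) _ _ _ p _ _ HS)).
  - intros q. unfold rad. f_equal. ring.
  - intros q. cbv beta. replace (cX q * cX q + cY q * cY q) with (cX q ^ 2 + cY q ^ 2) by ring. fold (rad q).
    replace (cos g * cX q + cX q * cos g + (- sin g * cY q + cY q * - sin g))
      with (2 * ((fst q - fst v) * (sin g ^ 2 + cos g ^ 2))) by (unfold cX, cY; ring).
    rewrite sc1, Rinv_mult. unfold Rdiv. generalize (/ rad q). intros i. field.
  - intros q. cbv beta. replace (cX q * cX q + cY q * cY q) with (cX q ^ 2 + cY q ^ 2) by ring. fold (rad q).
    replace (sin g * cX q + cX q * sin g + (cos g * cY q + cY q * cos g))
      with (2 * ((snd q - snd v) * (sin g ^ 2 + cos g ^ 2))) by (unfold cX, cY; ring).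
    rewrite sc1, Rinv_mult. unfold Rdiv. generalize (/ rad q). intros i. field.
  - auto_derive; [nra|]. ring_simplify. unfold Rdiv. ring.
  - apply (ex_derive_continuous (V := R_NormedModule)). auto_derive. 
    assert (H : cX p * cX p + cY p * cY p = cX p ^ 2 + cY p ^ 2) by ring. rewrite H. fold (rad p).
    split; [lra|]. split; [|exact I]. lra.
Qed.

Lemma C1p_ang (p : pt) : 0 < rad p + cX p ->
  C1p ang (fun q => - (snd q - snd v) / rad q ^ 2) (fun q => (fst q - fst v) / rad q ^ 2) p.
Proof.
  intros Hp.
  assert (Hr : 0 < rad p).
  { pose proof (rad_pos p). destruct (Req_dec (rad p) 0) as [E|E]; [|lra]. exfalso.
    pose proof (rad_sq p). pose proof (pow2_ge_0 (cY p)). rewrite E in *. nra. }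
  pose proof (C1p_plus _ _ _ _ _ _ p (C1p_rad p Hr) (C1p_cX p)) as HD.
  assert (Hne : rad p + cX p <> 0) by lra.
  pose proof (C1p_div _ _ _ _ _ _ p Hne (C1p_cY p) HD) as HT.
  refine (C1p_ext_loc _ _ _ _ _ _ p _ (C1p_scal 2 _ _ _ p (C1p_comp atan (fun t => / (1 + t ^ 2)) _ _ _ p _ _ HT))).
  - pose proof (cont_gt _ p 0 (proj1 (proj2 (proj2 HD))) Hp) as L1.
    pose proof (cont_gt _ p 0 (proj1 (proj2 (proj2 (C1p_rad p Hr)))) Hr) as L2.
    generalize (filter_and _ _ L1 L2). apply filter_imp. intros q' [H1 H2]. clear - H1 H2.
    revert q' H1 H2.
    change (forall q : pt, 0 < rad q + cX q -> 0 < rad q ->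
      2 * atan (cY q / (rad q + cX q)) = ang q /\
      2 * (/ (1 + (cY q / (rad q + cX q)) ^ 2) * (- sin g / (rad q + cX q) - cY q * ((fst q - fst v) / rad q + cos g) / (rad q + cX q) ^ 2)) = - (snd q - snd v) / rad q ^ 2 /\
      2 * (/ (1 + (cY q / (rad q + cX q)) ^ 2) * (cos g / (rad q + cX q) - cY q * ((snd q - snd v) / rad q + sin g) / (rad q + cX q) ^ 2)) = (fst q - fst v) / rad q ^ 2).
    intros q H1 H2.
    split.
    { unfold ang. destruct (Rle_dec _ 0); [lra|reflexivity]. }
    pose proof (rad_sq q) as Hs.
    assert (Ex : fst q - fst v = cX q * cos g - cY q * sin g).
    { unfold cX, cY. transitivity ((fst q - fst v) * (sin g ^ 2 + cos g ^ 2)); [rewrite sc1; ring|ring]. }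
    assert (Ey : snd q - snd v = cX q * sin g + cY q * cos g).
    { unfold cX, cY. transitivity ((snd q - snd v) * (sin g ^ 2 + cos g ^ 2)); [rewrite sc1; ring|ring]. }
    rewrite Ex, Ey. set (r := rad q) in *; set (x := cX q) in *; set (y := cY q) in *.
    assert (Hy : y ^ 2 = (r - x) * (r + x)) by nra.
    assert (E : / (1 + (y / (r + x)) ^ 2) = (r + x) / (2 * r)).
    { replace ((y / (r + x)) ^ 2) with (y ^ 2 / (r + x) ^ 2) by (field; lra). rewrite Hy. field. repeat split; lra. }
    rewrite E. split.
    + transitivity ((- sin g * (r * (r + x) - y ^ 2) - y * cos g * (x + r)) / (r ^ 2 * (r + x))).
      * field. lra.
      * rewrite Hy. field. lra.
    + transitivity ((cos g * (r * (r + x) - y ^ 2) - y * sin g * (x + r)) / (r ^ 2 * (r + x))).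
      * field. lra.
      * rewrite Hy. field. lra.
  - cbv beta. apply is_derive_Reals.
    replace (/ _) with (/ (1 + (cY p / (rad p + cX p)) ^ 2)) by reflexivity.
    pose proof (derivable_pt_lim_atan (cY p / (rad p + cX p))) as H. unfold Rsqr in H.
    replace (cY p / (rad p + cX p) * (cY p / (rad p + cX p))) with ((cY p / (rad p + cX p)) ^ 2) in H by ring. exact H.
  - apply (ex_derive_continuous (V := R_NormedModule)). auto_derive. nra.
Qed.

(** [(kx, ky)] is the gradient of [ln rad], and its rotation [(- ky, kx)] is the gradient of the
    angle. Away from the vertex both are divergence-free, since the two functions are conjugate
    harmonic. *)
Definition kx (q : pt) : R := (fst q - fst v) / rad q ^ 2.
Definition ky (q : pt) : R := (snd q - snd v) / rad q ^ 2.

Lemma C1p_shift (p : pt) :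
  C1p (fun q => fst q - fst v) (fun _ => 1) (fun _ => 0) p /\
  C1p (fun q => snd q - snd v) (fun _ => 0) (fun _ => 1) p.
Proof.
  split.
  - eapply C1p_ext; [| | |apply (C1p_plus _ _ _ _ _ _ p (C1p_fst p) (C1p_const (- fst v) p))];
      intros q; simpl; ring.
  - eapply C1p_ext; [| | |apply (C1p_plus _ _ _ _ _ _ p (C1p_snd p) (C1p_const (- snd v) p))];
      intros q; simpl; ring.
Qed.

Lemma C1p_kxy (p : pt) : 0 < rad p ->
  C1p kx (fun q => 1 / rad q ^ 2 - 2 * (fst q - fst v) ^ 2 / (rad q ^ 2) ^ 2)
         (fun q => - (2 * (fst q - fst v) * (snd q - snd v)) / (rad q ^ 2) ^ 2) p /\
  C1p ky (fun q => - (2 * (fst q - fst v) * (snd q - snd v)) / (rad q ^ 2) ^ 2)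
         (fun q => 1 / rad q ^ 2 - 2 * (snd q - snd v) ^ 2 / (rad q ^ 2) ^ 2) p.
Proof.
  intros Hr. destruct (C1p_shift p) as [Dx Dy].
  assert (Hr2 : rad p ^ 2 <> 0) by (apply pow_nonzero; lra).
  assert (HR : C1p (fun q => rad q ^ 2) (fun q => 2 * (fst q - fst v)) (fun q => 2 * (snd q - snd v)) p).
  { eapply C1p_ext; [| | |apply (C1p_plus _ _ _ _ _ _ p (C1p_mult _ _ _ _ _ _ p Dx Dx) (C1p_mult _ _ _ _ _ _ p Dy Dy))];
      intros q; cbv beta; [rewrite rad_dist, pdist_sq; ring|ring|ring]. }
  split.
  - eapply C1p_ext; [| | |apply (C1p_div _ _ _ _ _ _ p Hr2 Dx HR)]; intros q; unfold kx, Rdiv; ring.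
  - eapply C1p_ext; [| | |apply (C1p_div _ _ _ _ _ _ p Hr2 Dy HR)]; intros q; unfold ky, Rdiv; ring.
Qed.

Lemma C1p_ln_rad (p : pt) : 0 < rad p -> C1p (fun q => ln (rad q)) kx ky p.
Proof.
  intros Hr.
  refine (C1p_ext _ _ _ _ _ _ p _ _ _ (C1p_comp ln Rinv _ _ _ p _ _ (C1p_rad p Hr))).
  - reflexivity.
  - intros q. unfold kx. cbv beta. unfold Rdiv. rewrite <- pow_inv. ring.
  - intros q. unfold ky. cbv beta. unfold Rdiv. rewrite <- pow_inv. ring.
  - apply is_derive_Reals, derivable_pt_lim_ln, Hr.
  - apply (ex_derive_continuous (V := R_NormedModule)). auto_derive. lra.
Qed.

Lemma C1p_ang_kelvin (p : pt) : 0 < rad p + cX p -> C1p ang (fun q => - ky q) kx p.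
Proof.
  intros Hp. refine (C1p_ext _ _ _ _ _ _ p _ _ _ (C1p_ang p Hp)); intros q; unfold ky, kx, Rdiv; ring.
Qed.

Lemma Rpos_rad (p : pt) : ang p < PI -> 0 < rad p + cX p.
Proof. unfold ang. destruct (Rle_dec (rad p + cX p) 0); lra. Qed.

Lemma rad_gt0 (p : pt) : ang p < PI -> 0 < rad p.
Proof.
  intros H. apply Rpos_rad in H. pose proof (rad_pos p).
  destruct (Req_dec (rad p) 0) as [E|E]; [|lra]. exfalso.
  pose proof (rad_sq p). pose proof (pow2_ge_0 (cY p)). rewrite E in *. nra.
Qed.
End Polar.

(** * The angular profile of the distance in a sector *)

Definition clamp (b x : R) : R := Rmax (- b) (Rmin b x).

Lemma clamp_mid (b x : R) : - b <= x <= b -> clamp b x = x.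
Proof. intros H. unfold clamp. rewrite Rmin_right, Rmax_right; lra. Qed.

Lemma clamp_hi (b x : R) : 0 <= b -> b <= x -> clamp b x = b.
Proof. intros Hb H. unfold clamp. rewrite Rmin_left, Rmax_right; lra. Qed.

Lemma clamp_lo (b x : R) : 0 <= b -> x <= - b -> clamp b x = - b.
Proof. intros Hb H. unfold clamp. rewrite Rmin_right, Rmax_left; lra. Qed.

Lemma clamp_range (b x : R) : 0 <= b -> - b <= clamp b x <= b.
Proof.
  intros Hb. destruct (Rle_or_lt x (- b)); [rewrite clamp_lo; lra|].
  destruct (Rle_or_lt b x); [rewrite clamp_hi; lra|]. rewrite clamp_mid; lra.
Qed.

Lemma clamp_opp (b x : R) : 0 <= b -> clamp b (- x) = - clamp b x.
Proof.
  intros Hb. destruct (Rle_or_lt x (- b)).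
  - rewrite (clamp_lo b x), clamp_hi; lra.
  - destruct (Rle_or_lt b x).
    + rewrite (clamp_hi b x), clamp_lo; lra.
    + rewrite !clamp_mid; lra.
Qed.

Lemma clamp_lip (b x y : R) : 0 <= b -> Rabs (clamp b x - clamp b y) <= Rabs (x - y).
Proof.
  intros Hb.
  destruct (Rle_or_lt x (- b)); [rewrite (clamp_lo b x) by lra|
    destruct (Rle_or_lt b x); [rewrite (clamp_hi b x) by lra|rewrite (clamp_mid b x) by lra]];
  (destruct (Rle_or_lt y (- b)); [rewrite (clamp_lo b y) by lra|
    destruct (Rle_or_lt b y); [rewrite (clamp_hi b y) by lra|rewrite (clamp_mid b y) by lra]]);
  unfold Rabs; repeat destruct Rcase_abs; lra.
Qed.

Lemma continuous_lip (f : R -> R) (x : R) : (forall y, Rabs (f y - f x) <= Rabs (y - x)) -> continuous f x.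
Proof.
  intros H P [e HP]. exists e. intros y Hy. apply HP.
  eapply Rle_lt_trans; [apply H|exact Hy].
Qed.

Lemma continuous_clamp (b x : R) : 0 <= b -> continuous (clamp b) x.
Proof. intros Hb. apply continuous_lip. intros y. apply clamp_lip, Hb. Qed.

(** For [|x| <= b] the vertex is the nearest boundary point and the profile is 1; beyond [b] it is
    [cos (|x| - b)], the sine of the angle to the nearer boundary ray. Writing both cases with
    [clamp] gives one formula for the distance and its gradient. *)
Definition kk (b x : R) : R := cos (x - clamp b x).

Lemma sin_sq_le (s : R) : sin s ^ 2 <= s ^ 2.
Proof.
  assert (H : forall s, 0 < s -> sin s ^ 2 <= s ^ 2).
  { intros t Ht. pose proof (sin_lt_x t Ht). pose proof (SIN_bound t).
    destruct (Rle_or_lt t 1) as [H1|H1].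
    - pose proof PI2_1. assert (0 < sin t) by (apply sin_gt_0; lra). nra.
    - nra. }
  destruct (Rtotal_order s 0) as [Hs|[->|Hs]].
  - replace (sin s ^ 2) with (sin (- s) ^ 2) by (rewrite sin_neg; ring).
    replace (s ^ 2) with ((- s) ^ 2) by ring. apply H. lra.
  - rewrite sin_0. lra.
  - apply H, Hs.
Qed.

Lemma cos_quad (z : R) : Rabs (cos z - 1) <= z ^ 2.
Proof.
  replace (cos z) with (1 - 2 * sin (z / 2) ^ 2).
  - pose proof (sin_sq_le (z / 2)). pose proof (pow2_ge_0 (sin (z / 2))).
    rewrite Rabs_left1; [|lra]. nra.
  - replace z with (2 * (z / 2)) at 2 by field. rewrite cos_2a_sin. ring.
Qed.

Lemma derive_quad (f : R -> R) (x : R) : (forall y, Rabs (f y - f x) <= (y - x) ^ 2) -> is_derive f x 0.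
Proof.
  intros H. apply is_derive_Reals. intros eps Heps.
  exists (mkposreal eps Heps). intros h Hh Hhe. simpl in Hhe.
  rewrite Rminus_0_r. unfold Rdiv. rewrite Rabs_mult, Rabs_inv.
  specialize (H (x + h)). replace (x + h - x) with h in H by ring.
  assert (Hp : 0 < Rabs h) by (apply Rabs_pos_lt, Hh).
  rewrite <- pow2_abs in H.
  apply Rle_lt_trans with (Rabs h); [|assumption].
  apply Rle_div_l; [assumption|]. nra.
Qed.

(** The two branches meet at [|x| = b], where the cosine has its maximum: the profile differs from 1
    by at most a square there, so the derivative is 0 from both sides. *)
Lemma kk_derive (b x : R) : 0 < b -> is_derive (kk b) x (- sin (x - clamp b x)).
Proof.
  intros Hb.
  assert (edge : forall e, e = b \/ e = - b -> is_derive (kk b) e (- sin (e - clamp b e))).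
  { intros e He. assert (Ee : clamp b e = e) by (apply clamp_mid; lra).
    rewrite Ee. replace (- sin (e - e)) with 0 by (rewrite Rminus_diag, sin_0; ring).
    apply derive_quad. intros y. unfold kk. rewrite Ee, Rminus_diag, cos_0.
    eapply Rle_trans; [apply cos_quad|].
    destruct (Rle_or_lt y (- b)); [rewrite clamp_lo by lra|
      destruct (Rle_or_lt b y); [rewrite clamp_hi by lra|rewrite clamp_mid by lra]]; destruct He; subst e; nra. }
  destruct (Rtotal_order x (- b)) as [H|[H|H]]; [|apply edge; right; assumption|].
  - rewrite clamp_lo by lra. apply (is_derive_ext_loc (fun t => cos (t - - b))).
    + generalize (open_lt (- b) x H). apply filter_imp. intros t Ht. unfold kk. rewrite clamp_lo; [reflexivity|lra|lra].
    + auto_derive; [exact I|]. unfold Rminus. ring.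
  - destruct (Rtotal_order x b) as [H'|[H'|H']]; [|apply edge; left; assumption|].
    + rewrite clamp_mid by lra. apply (is_derive_ext_loc (fun t => 1)).
      * generalize (filter_and _ _ (open_gt (- b) x H) (open_lt b x H')). apply filter_imp.
        intros t [Ht1 Ht2]. unfold kk. rewrite clamp_mid, Rminus_diag, cos_0; [reflexivity|lra].
      * replace (- sin (x - x)) with 0 by (rewrite Rminus_diag, sin_0; ring). apply (is_derive_const 1).
    + rewrite clamp_hi by lra. apply (is_derive_ext_loc (fun t => cos (t - b))).
      * generalize (open_gt b x H'). apply filter_imp. intros t Ht. unfold kk. rewrite clamp_hi; [reflexivity|lra|lra].
      * auto_derive; [exact I|]. unfold Rminus. ring.
Qed.

Lemma continuous_zz (b x : R) : 0 <= b -> continuous (fun x => x - clamp b x) x.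
Proof.
  intros Hb. apply (continuous_minus (V := R_NormedModule)); [apply continuous_id|apply continuous_clamp, Hb].
Qed.

Lemma continuous_kk (b x : R) : 0 <= b -> continuous (kk b) x.
Proof.
  intros Hb. apply (continuous_comp (fun x => x - clamp b x) cos); [apply continuous_zz, Hb|].
  apply (ex_derive_continuous (V := R_NormedModule)). auto_derive. exact I.
Qed.

Lemma kk_range (b x : R) : 0 <= b -> Rabs x < b + PI / 2 -> 0 < kk b x <= 1.
Proof.
  intros Hb Hx. apply Rabs_def2 in Hx. pose proof PI_RGT_0. split; [|apply COS_bound].
  unfold kk. apply cos_gt_0;
  (destruct (Rle_or_lt x (- b)); [rewrite clamp_lo by lra|
      destruct (Rle_or_lt b x); [rewrite clamp_hi by lra|rewrite clamp_mid by lra]]); lra.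
Qed.

Lemma kk_opp (b x : R) : 0 <= b -> kk b (- x) = kk b x.
Proof.
  intros Hb. unfold kk. rewrite clamp_opp by assumption.
  replace (- x - - clamp b x) with (- (x - clamp b x)) by ring. apply cos_neg.
Qed.

(** * The distance to the boundary of a sector *)

Section Sector.
Context (v : pt) (g b : R).

Definition d0 (p : pt) : R := rad v g p * kk b (ang v g p).

(** The angles [g + nu] with [|nu| <= b] form the normal cone of the complement of the sector; the
    clamped angle is the one nearest to the direction of [p]. Pairing with it yields the lower bound
    [d0_le], and it is also the direction of the gradient. *)
Lemma d0_lin (p : pt) : d0 p = (fst p - fst v) * cos (g + clamp b (ang v g p)) + (snd p - snd v) * sin (g + clamp b (ang v g p)).
Proof.
  destruct (polar v g p) as [-> ->]. unfold d0, kk.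
  replace (ang v g p - clamp b (ang v g p)) with ((g + ang v g p) - (g + clamp b (ang v g p))) by ring.
  rewrite cos_minus. ring.
Qed.

Definition nx (p : pt) : R := cos (g + clamp b (ang v g p)).
Definition ny (p : pt) : R := sin (g + clamp b (ang v g p)).

Lemma C1p_d0 (p : pt) : 0 < b -> ang v g p < PI -> C1p d0 nx ny p.
Proof.
  intros Hb Ha.
  pose proof (rad_gt0 v g p Ha) as Hr. pose proof (C1p_ang v g p (Rpos_rad v g p Ha)) as HA.
  refine (C1p_ext_loc _ _ _ _ _ _ p _ (C1p_mult _ _ _ _ _ _ p (C1p_rad v g p Hr)
     (C1p_comp (kk b) (fun x => - sin (x - clamp b x)) _ _ _ p (kk_derive b _ Hb) _ HA))).
  - generalize (cont_gt _ p 0 (proj1 (proj2 (proj2 (C1p_rad v g p Hr)))) Hr).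
    apply filter_imp.
    change (forall q : pt, 0 < rad v g q -> rad v g q * kk b (ang v g q) = d0 q /\
      (fst q - fst v) / rad v g q * kk b (ang v g q) + rad v g q * (- sin (ang v g q - clamp b (ang v g q)) * (- (snd q - snd v) / rad v g q ^ 2)) = nx q /\
      (snd q - snd v) / rad v g q * kk b (ang v g q) + rad v g q * (- sin (ang v g q - clamp b (ang v g q)) * ((fst q - fst v) / rad v g q ^ 2)) = ny q).
    intros q Hq. split; [reflexivity|]. destruct (polar v g q) as [-> ->]. unfold kk, nx, ny.
    set (x := ang v g q). set (y := clamp b x).
    replace (g + y) with ((g + x) - (x - y)) by ring. rewrite (cos_minus (g + x)), (sin_minus (g + x)).
    split; field; lra.
  - apply (continuous_opp (V := R_NormedModule) (fun x => sin (x - clamp b x))).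
    apply (continuous_comp (fun x => x - clamp b x) sin); [apply continuous_zz; lra|].
    apply (ex_derive_continuous (V := R_NormedModule)). auto_derive. exact I.
Qed.

Lemma pdist_dir (p q : pt) (a : R) : (fst p - fst q) * cos a + (snd p - snd q) * sin a <= pdist p q.
Proof.
  pose proof (pdist_pos p q). pose proof (pdist_sq p q) as E.
  set (x := fst p - fst q) in *. set (y := snd p - snd q) in *.
  destruct (Rle_or_lt (x * cos a + y * sin a) 0); [lra|].
  apply Rsqr_incr_0_var; [|assumption]. unfold Rsqr.
  replace (pdist p q * pdist p q) with ((x ^ 2 + y ^ 2) * (sin a ^ 2 + cos a ^ 2)) by (rewrite sc1, <- E; ring).
  pose proof (pow2_ge_0 (x * sin a - y * cos a)). nra.
Qed.

(** Directions of the complement make an angle of at least [PI / 2] with every direction of its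
    normal cone. Hence [q] lies on the nonpositive side of the line through [v] whose normal is the
    clamped direction of [p]. *)
Lemma d0_le (p q : pt) : 0 <= b <= PI / 2 -> b + PI / 2 <= Rabs (ang v g q) -> d0 p <= pdist p q.
Proof.
  intros Hb Hq. rewrite d0_lin. set (y := clamp b (ang v g p)).
  pose proof (clamp_range b (ang v g p) ltac:(lra)) as Hy. fold y in Hy.
  eapply Rle_trans; [|apply (pdist_dir p q (g + y))].
  destruct (polar v g q) as [E1 E2]. set (x := ang v g q) in *.
  assert (H : (fst q - fst v) * cos (g + y) + (snd q - snd v) * sin (g + y) <= 0).
  { rewrite E1, E2.
    replace (_ + _) with (rad v g q * cos ((g + x) - (g + y))) by (rewrite (cos_minus (g + x)); ring).
    pose proof (rad_pos v g q). assert (cos (g + x - (g + y)) <= 0); [|nra].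
    pose proof (ang_range v g q) as Hx. fold x in Hx. pose proof PI_RGT_0.
    replace (g + x - (g + y)) with (x - y) by ring.
    unfold Rabs in Hq. destruct (Rcase_abs x).
    - rewrite <- cos_neg. apply cos_le_0; lra.
    - apply cos_le_0; lra. }
  lra.
Qed.

Lemma ray_pdist (r x t y : R) : pdist (ray v g r x) (ray v g t y) ^ 2 = r ^ 2 + t ^ 2 - 2 * r * t * cos (x - y).
Proof.
  rewrite pdist_sq. unfold ray; cbn [fst snd].
  replace (x - y) with ((g + x) - (g + y)) by ring. rewrite cos_minus.
  replace (r ^ 2 + t ^ 2) with (r ^ 2 * (sin (g + x) ^ 2 + cos (g + x) ^ 2) + t ^ 2 * (sin (g + y) ^ 2 + cos (g + y) ^ 2)).
  - ring.
  - rewrite !sc1. ring.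
Qed.

Lemma d0_attained (p : pt) : 0 < b <= PI / 2 -> Rabs (ang v g p) < b + PI / 2 ->
  exists t s, 0 <= t /\ (s = 1 \/ s = - 1) /\ pdist p (ray v g t (s * (b + PI / 2))) = d0 p.
Proof.
  intros Hb Ha. pose proof (rad_pos v g p) as Hr. pose proof PI_RGT_0.
  destruct (Rle_or_lt (Rabs (ang v g p)) b) as [H1|H1].
  - exists 0, 1. split; [lra|]. split; [left; reflexivity|]. rewrite ray0, <- (rad_dist v g).
    unfold d0, kk. apply Rabs_le_between in H1. rewrite clamp_mid, Rminus_diag, cos_0 by lra. ring.
  - assert (Hs : exists s, (s = 1 \/ s = - 1) /\ ang v g p = s * Rabs (ang v g p)).
    { unfold Rabs. destruct (Rcase_abs (ang v g p)); [exists (-1)|exists 1]; split; lra. }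
    destruct Hs as [s [Hs Es]]. set (x := Rabs (ang v g p)) in *.
    assert (Hsin : 0 < sin (x - b)) by (apply sin_gt_0; lra).
    (* The foot of the perpendicular on the nearer boundary ray, as the angle between [p] and that
       ray is [b + PI / 2 - x]. *)
    exists (rad v g p * sin (x - b)), s. split; [nra|]. split; [assumption|].
    assert (Ek : d0 p = rad v g p * cos (x - b)).
    { unfold d0. rewrite Es. f_equal. destruct Hs as [-> | ->].
      - rewrite Rmult_1_l. unfold kk. rewrite clamp_hi by lra. reflexivity.
      - replace (-1 * x) with (- x) by ring. rewrite kk_opp by lra. unfold kk. rewrite clamp_hi by lra. reflexivity. }
    assert (Hc : 0 < cos (x - b)) by (apply cos_gt_0; lra).
    rewrite Ek. apply Rsqr_inj; [apply pdist_pos|nra|]. rewrite !Rsqr_pow2.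
    rewrite (polar_ray v g p) at 1. rewrite ray_pdist.
    assert (Ec : cos (ang v g p - s * (b + PI / 2)) = sin (x - b)).
    { rewrite Es. replace (s * x - s * (b + PI / 2)) with (s * ((x - b) - PI / 2)) by ring.
      destruct Hs as [-> | ->].
      - rewrite Rmult_1_l. rewrite cos_minus, cos_PI2, sin_PI2. ring.
      - replace (-1 * (x - b - PI / 2)) with (- (x - b - PI / 2)) by ring. rewrite cos_neg, cos_minus, cos_PI2, sin_PI2. ring. }
    rewrite Ec.
    replace ((rad v g p * cos (x - b)) ^ 2) with (rad v g p ^ 2 * (1 - sin (x - b) ^ 2)).
    + ring.
    + rewrite <- (sc1 (x - b)). ring.
Qed.

(** Equality can fail only in the safe direction: at [t = 0] the angle defaults to [PI], and the
    direction [- PI] is recorded as [PI]. *)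
Lemma ang_ray_abs (t x : R) : 0 <= t -> Rabs x <= PI -> Rabs x <= Rabs (ang v g (ray v g t x)).
Proof.
  intros Ht Hx. pose proof PI_RGT_0.
  destruct (Rle_lt_or_eq_dec 0 t Ht) as [H1| <-].
  - pose proof (cX_polar v g (ray v g t x)) as [E _]. rewrite (proj1 (cX_ray v g t x)), rad_ray in E by assumption.
    apply Rmult_eq_reg_l in E; [|lra].
    pose proof (ang_range v g (ray v g t x)) as Hr. set (z := ang v g (ray v g t x)) in *.
    assert (Ea : forall w, cos w = cos (Rabs w)).
    { intros w. unfold Rabs. destruct (Rcase_abs w); [rewrite cos_neg|]; reflexivity. }
    rewrite (Ea x), (Ea z) in E.
    right. rewrite <- (acos_cos (Rabs x)), <- (acos_cos (Rabs z)); [rewrite E; reflexivity| |].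
    + split; [apply Rabs_pos|]. unfold Rabs; destruct (Rcase_abs z); lra.
    + split; [apply Rabs_pos|assumption].
  - rewrite ray0. replace (ang v g v) with PI.
    + rewrite (Rabs_pos_eq PI); lra.
    + unfold ang. rewrite rad_dist, pdist_refl. unfold cX. destruct (Rle_dec _ 0); [reflexivity|]. exfalso. lra.
Qed.

Lemma closure_ray (t s : R) : 0 < b <= PI / 2 -> 0 <= t -> s = 1 \/ s = - 1 ->
  closure2 (fun p => Rabs (ang v g p) < b + PI / 2) (ray v g t (s * (b + PI / 2))).
Proof.
  intros Hb Ht Hs eps Heps. pose proof PI_RGT_0.
  set (x := s * (b + PI / 2)).
  assert (H1 : continuous (fun d => (t + d) * cos (g + (x - s * d))) 0)
    by (apply (ex_derive_continuous (V := R_NormedModule)); auto_derive; exact I).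
  assert (H2 : continuous (fun d => (t + d) * sin (g + (x - s * d))) 0)
    by (apply (ex_derive_continuous (V := R_NormedModule)); auto_derive; exact I).
  assert (He : 0 < eps / 2) by lra.
  destruct (H1 (fun y => Rabs (y - (t + 0) * cos (g + (x - s * 0))) < eps / 2)) as [d1 D1].
  { exists (mkposreal _ He). intros y Hy. exact Hy. }
  destruct (H2 (fun y => Rabs (y - (t + 0) * sin (g + (x - s * 0))) < eps / 2)) as [d2 D2].
  { exists (mkposreal _ He). intros y Hy. exact Hy. }
  set (d := Rmin (Rmin (d1 / 2) (d2 / 2)) b).
  assert (Hd : 0 < d /\ d <= d1 / 2 /\ d <= d2 / 2 /\ d <= b).
  { pose proof (cond_pos d1). pose proof (cond_pos d2). unfold d.
    split; [repeat apply Rmin_pos; lra|].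
    pose proof (Rmin_l (Rmin (d1 / 2) (d2 / 2)) b). pose proof (Rmin_r (Rmin (d1 / 2) (d2 / 2)) b).
    pose proof (Rmin_l (d1 / 2) (d2 / 2)). pose proof (Rmin_r (d1 / 2) (d2 / 2)). lra. }
  (* Moving outwards by [d] while turning inwards by [d] keeps the radius positive even for [t = 0],
     so the new point really has angle [x - s * d]. *)
  exists (ray v g (t + d) (x - s * d)). split.
  - assert (Ha : Rabs (x - s * d) < b + PI / 2).
    { unfold x. replace (s * (b + PI / 2) - s * d) with (s * (b + PI / 2 - d)) by ring.
      rewrite Rabs_mult. replace (Rabs s) with 1 by (destruct Hs; subst s; unfold Rabs; destruct Rcase_abs; lra).
      rewrite Rabs_pos_eq; lra. }
    rewrite ang_ray; [assumption|lra|]. apply Rabs_def2 in Ha. lra.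
  - destruct (pdist_bounds (ray v g t x) (ray v g (t + d) (x - s * d))) as (_ & _ & H3).
    eapply Rle_lt_trans; [apply H3|]. unfold ray; simpl.
    assert (B : ball 0 d1 d /\ ball 0 d2 d).
    { unfold ball; simpl; unfold AbsRing_ball, abs, minus, plus, opp; simpl.
      pose proof (cond_pos d1). pose proof (cond_pos d2). rewrite Rabs_pos_eq by lra. lra. }
    specialize (D1 d (proj1 B)). specialize (D2 d (proj2 B)). cbv beta in D1, D2.
    replace (t + 0) with t in D1, D2 by ring. replace (x - s * 0) with x in D1, D2 by ring.
    replace (fst v + (t + d) * cos (g + (x - s * d)) - (fst v + t * cos (g + x)))
      with ((t + d) * cos (g + (x - s * d)) - t * cos (g + x)) by ring.
    replace (snd v + (t + d) * sin (g + (x - s * d)) - (snd v + t * sin (g + x)))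
      with ((t + d) * sin (g + (x - s * d)) - t * sin (g + x)) by ring.
    lra.
Qed.
End Sector.

Lemma sector_ang (beta phi : R) (v p : pt) : PI < beta <= 2 * PI ->
  sector beta phi v p <-> Rabs (ang v (phi + beta / 2) p) < (beta - PI) / 2 + PI / 2.
Proof.
  intros Hb. replace ((beta - PI) / 2 + PI / 2) with (beta / 2) by field. split.
  - intros [q [[r [th [Hr [Hth ->]]]] ->]]. simpl.
    assert (Ha : Rabs (th - beta / 2) < beta / 2) by (apply Rabs_def1; lra).
    replace (fst v + cos phi * (r * cos th) - sin phi * (r * sin th)) with (fst v + r * cos (phi + beta / 2 + (th - beta / 2))).
    + replace (snd v + sin phi * (r * cos th) + cos phi * (r * sin th)) with (snd v + r * sin (phi + beta / 2 + (th - beta / 2))).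
      * fold (ray v (phi + beta / 2) r (th - beta / 2)). rewrite ang_ray; lra.
      * replace (phi + beta / 2 + (th - beta / 2)) with (phi + th) by ring. rewrite sin_plus. ring.
    + replace (phi + beta / 2 + (th - beta / 2)) with (phi + th) by ring. rewrite cos_plus. ring.
  - intros Ha. apply Rabs_def2 in Ha. set (gg := phi + beta / 2) in *.
    pose proof (rad_gt0 v gg p ltac:(lra)) as Hr.
    exists (rad v gg p * cos (ang v gg p + beta / 2), rad v gg p * sin (ang v gg p + beta / 2)). split.
    + exists (rad v gg p), (ang v gg p + beta / 2). repeat split; lra.
    + simpl. rewrite (polar_ray v gg p) at 1. unfold ray.
      replace (gg + ang v gg p) with (phi + (ang v gg p + beta / 2)) by (unfold gg; ring).
      rewrite (cos_plus phi), (sin_plus phi). f_equal; ring.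
Qed.

(** * Compactness, separation and the distance to the boundary *)

Lemma pnorm_bounds (p : pt) : Rabs (fst p) <= pnorm p /\ Rabs (snd p) <= pnorm p.
Proof.
  destruct (pdist_bounds (0, 0) p) as (H1 & H2 & _). simpl in H1, H2. rewrite Rminus_0_r in H1, H2.
  replace (pnorm p) with (pdist (0, 0) p); [split; assumption|].
  unfold pnorm, pdist; simpl. f_equal. ring.
Qed.

(** Heine-Borel as an induction principle: a property of sets that passes to subsets and finite
    unions and holds near each point of a compact set holds for that set. *)
Lemma compact_ind (C : pt -> Prop) (P : (pt -> Prop) -> Prop) :
  bounded2 C -> (forall p, closure2 C p -> C p) ->
  P (fun _ => False) ->
  (forall S S' : pt -> Prop, (forall p, S p -> S' p) -> P S' -> P S) ->
  (forall S S' : pt -> Prop, P S -> P S' -> P (fun p => S p \/ S' p)) ->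
  (forall z, C z -> exists d, 0 < d /\ P (fun p => C p /\ pdist z p < d)) ->
  P C.
Proof.
  intros [M HM] Hcl H0 Hsub Hun Hloc.
  (* The gauge has to be defined on a whole box; off [C], closedness gives a ball that misses [C].
     The factor 2 lets a Euclidean disc contain the square of half side [d] that the covering
     theorem provides. *)
  assert (Hall : forall z, exists d : posreal, P (fun p => C p /\ pdist z p < 2 * d)).
  { intros z. destruct (classic (C z)) as [Hz|Hz].
    - destruct (Hloc z Hz) as [d [Hd HP]]. assert (Hd2 : 0 < d / 2) by lra.
      exists (mkposreal _ Hd2). simpl. replace (2 * (d / 2)) with d by field. assumption.
    - assert (exists d, 0 < d /\ forall p, C p -> ~ pdist z p < d) as [d [Hd HC]].
      { apply NNPP. intros Hn. apply Hz, Hcl. intros eps Heps. apply NNPP. intros Hn'. apply Hn.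
        exists eps. split; [lra|]. intros p Hp Hlt. apply Hn'. exists p. rewrite pdist_sym in Hlt.
        split; [assumption|]. rewrite pdist_sym. assumption. }
      assert (Hd2 : 0 < d / 2) by lra. exists (mkposreal _ Hd2). simpl.
      apply (Hsub _ (fun _ => False)); [|assumption]. intros p [Hp Hlt].
      apply (HC p Hp). lra. }
  set (dl := fun z => proj1_sig (constructive_indefinite_description _ (Hall z))).
  assert (Hdl : forall z, P (fun p => C p /\ pdist z p < 2 * dl z))
    by (intros z; exact (proj2_sig (constructive_indefinite_description _ (Hall z)))).
  apply NNPP. intros Hn.
  apply (compactness_list 2 (- M, (- M, tt)) (M, (M, tt)) (fun t => dl (fst t, fst (snd t)))).
  intros [l Hl]. apply Hn. clear Hn.
  assert (Hind : forall l : list (Compactness.Tn 2 R),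
    P (fun p => C p /\ exists t, In t l /\ pdist (fst t, fst (snd t)) p < 2 * dl (fst t, fst (snd t)))).
  { clear l Hl. induction l as [|t l IH].
    - apply (Hsub _ (fun _ => False)); [|assumption]. intros p [_ [t [Ht _]]]. destruct Ht.
    - apply (Hsub _ (fun p => (C p /\ pdist (fst t, fst (snd t)) p < 2 * dl (fst t, fst (snd t))) \/
        (C p /\ exists t, In t l /\ pdist (fst t, fst (snd t)) p < 2 * dl (fst t, fst (snd t))))).
      + intros p [Hp [t' [[<-|Ht] Hlt]]]; [left|right]; split; try assumption. exists t'. split; assumption.
      + apply Hun; [apply Hdl|assumption]. }
  apply (Hsub _ _ ) with (2 := Hind l). intros p Hp. split; [assumption|].
  specialize (HM p Hp). destruct (pnorm_bounds p) as [B1 B2].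
  assert (B1' := Rle_trans _ _ _ B1 HM). assert (B2' := Rle_trans _ _ _ B2 HM).
  apply Rabs_le_between in B1'. apply Rabs_le_between in B2'.
  destruct (Hl (fst p, (snd p, tt))) as [t [Ht [_ Hc]]].
  { simpl. split; [lra|]. split; [lra|exact I]. }
  exists t. split; [assumption|]. destruct t as [t1 [t2 []]]. simpl in Hc |- *.
  destruct Hc as [Hc1 [Hc2 _]].
  destruct (pdist_bounds (t1, t2) p) as (_ & _ & H3). simpl in H3. lra.
Qed.

(* With abscissa X along x0 and ordinate Y across, a convex set missing the origin has
   X/Y on its lower half below X/Y on its upper half; a slope in between separates. *)
Lemma separation (K : pt -> Prop) (x0 z : pt) : convex_set K -> interior2 K x0 -> ~ K z ->
  exists m1 m2, m1 ^ 2 + m2 ^ 2 = 1 /\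
    forall y, K y -> 0 <= m1 * (fst y - fst z) + m2 * (snd y - snd z).
Proof.
  intros Hc [e [He Hi]] Hz.
  set (a := fst x0 - fst z). set (b := snd x0 - snd z).
  set (X := fun y : pt => (fst y - fst z) * a + (snd y - snd z) * b).
  set (Y := fun y : pt => (snd y - snd z) * a - (fst y - fst z) * b).
  assert (K0 : K x0) by (apply Hi; rewrite pdist_refl; lra).
  set (D := a ^ 2 + b ^ 2).
  assert (HD : 0 < D).
  { destruct (Rle_or_lt D 0) as [H|H]; [|assumption]. exfalso. apply Hz.
    replace z with x0; [assumption|]. assert (a = 0) by (unfold D in H; nra). assert (b = 0) by (unfold D in H; nra).
    unfold a, b in *. destruct x0, z; simpl in *. f_equal; lra. }
  assert (Hback : forall y, fst y - fst z = (X y * a - Y y * b) / D /\ snd y - snd z = (X y * b + Y y * a) / D).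
  { intros y. unfold X, Y, D in *. split; field; lra. }
  assert (Hlin : forall p q t, K p -> K q -> 0 <= t <= 1 -> exists w, K w /\
     X w = (1 - t) * X p + t * X q /\ Y w = (1 - t) * Y p + t * Y q).
  { intros p q t Hp Hq Ht. exists ((1 - t) * fst p + t * fst q, (1 - t) * snd p + t * snd q).
    split; [apply Hc; assumption|]. unfold X, Y; simpl. split; ring. }
  assert (Hx0 : X x0 = D /\ Y x0 = 0) by (unfold X, Y, D, a, b; split; ring).
  (* A point of [K] on the axis at or behind the origin would place [z] on a segment from that point
     to [x0]. *)
  assert (Haxis : forall w, K w -> Y w = 0 -> 0 < X w).
  { intros w Hw HY. destruct (Rlt_or_le 0 (X w)) as [H|H]; [assumption|]. exfalso.
    destruct (Hlin w x0 (- X w / (D - X w)) Hw K0) as [w' [Hw' [EX EY]]].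
    - split; [apply Rdiv_le_0_compat; lra|apply Rle_div_l; lra].
    - destruct Hx0 as [Ex Ey]. rewrite Ex in EX. rewrite Ey, HY in EY.
      assert (EX0 : X w' = 0) by (rewrite EX; field; lra).
      assert (EY0 : Y w' = 0) by (rewrite EY; ring).
      destruct (Hback w') as [H1 H2]. rewrite EX0, EY0 in H1, H2.
      apply Hz. replace z with w'; [assumption|]. unfold Rdiv in H1, H2. destruct w', z; simpl in *. f_equal; lra. }
  assert (Hsep : forall p q, K p -> K q -> 0 < Y p -> Y q < 0 -> X q / Y q <= X p / Y p).
  { intros p q Hp Hq HYp HYq.
    destruct (Hlin p q (Y p / (Y p - Y q)) Hp Hq) as [w [Hw [EX EY]]].
    - split; [apply Rdiv_le_0_compat; lra|apply Rle_div_l; lra].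
    - assert (HwX : 0 < X w) by (apply Haxis; [assumption|rewrite EY; field; lra]).
      rewrite EX in HwX.
      replace ((1 - Y p / (Y p - Y q)) * X p + Y p / (Y p - Y q) * X q)
        with ((Y p * (- Y q)) / (Y p - Y q) * (X p / Y p - X q / Y q)) in HwX by (field; lra).
      assert (0 < (Y p * - Y q) / (Y p - Y q)) by (apply Rdiv_lt_0_compat; nra). nra. }
  (* The ball around [x0] supplies points of [K] strictly on both sides of the axis, so the set of
     lower slopes is nonempty and bounded above. *)
  assert (Hy : forall h, exists w, Y w = Y x0 + h * D /\ pdist x0 w <= Rabs h * (Rabs a + Rabs b)).
  { intros h. exists (fst x0 - h * b, snd x0 + h * a). split; [unfold Y, D; simpl; ring|].
    destruct (pdist_bounds x0 (fst x0 - h * b, snd x0 + h * a)) as (_ & _ & H). simpl in H.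
    eapply Rle_trans; [apply H|].
    replace (fst x0 - h * b - fst x0) with (- (h * b)) by ring.
    replace (snd x0 + h * a - snd x0) with (h * a) by ring.
    rewrite Rabs_Ropp, !Rabs_mult. lra. }
  assert (HS : 0 <= Rabs a + Rabs b) by (pose proof (Rabs_pos a); pose proof (Rabs_pos b); lra).
  set (h := e / (Rabs a + Rabs b + 1)).
  assert (Hh : 0 < h) by (apply Rdiv_lt_0_compat; lra).
  assert (Hhe : h * (Rabs a + Rabs b) < e).
  { assert (h * (Rabs a + Rabs b + 1) = e) by (unfold h; field; lra). nra. }
  destruct Hx0 as [_ Ey].
  destruct (Hy h) as [w1 [E1 D1]]. rewrite Rabs_pos_eq in D1 by lra.
  assert (K1 : K w1) by (apply Hi; lra).
  destruct (Hy (- h)) as [w2 [E2 D2]]. rewrite Rabs_Ropp, Rabs_pos_eq in D2 by lra.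
  assert (K2 : K w2) by (apply Hi; lra).
  assert (Y1 : 0 < Y w1) by (rewrite E1, Ey; nra).
  assert (Y2 : Y w2 < 0) by (rewrite E2, Ey; nra).
  destruct (completeness (fun s => exists q, K q /\ Y q < 0 /\ s = X q / Y q)) as [s [Hs1 Hs2]].
  { exists (X w1 / Y w1). intros s [q [Hq [HYq ->]]]. apply Hsep; assumption. }
  { exists (X w2 / Y w2), w2. auto. }
  assert (Hm : forall y, K y -> 0 <= X y - s * Y y).
  { intros y Hyk. destruct (Rtotal_order (Y y) 0) as [H|[H|H]].
    - assert (H1 : X y / Y y <= s) by (apply Hs1; exists y; auto).
      replace (X y - s * Y y) with ((- Y y) * (s - X y / Y y)) by (field; lra). nra.
    - rewrite H. pose proof (Haxis y Hyk H). lra.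
    - assert (H1 : s <= X y / Y y) by (apply Hs2; intros t [q [Hq [HYq ->]]]; apply Hsep; assumption).
      replace (X y - s * Y y) with (Y y * (X y / Y y - s)) by (field; lra). nra. }
  set (n1 := a + s * b). set (n2 := b - s * a).
  assert (Hn : n1 ^ 2 + n2 ^ 2 = (1 + s ^ 2) * D) by (unfold n1, n2, D; ring).
  assert (Hpos : 0 < n1 ^ 2 + n2 ^ 2) by (rewrite Hn; pose proof (pow2_ge_0 s); nra).
  set (N := sqrt (n1 ^ 2 + n2 ^ 2)).
  assert (HN : 0 < N) by (apply sqrt_lt_R0, Hpos).
  assert (HN2 : N ^ 2 = n1 ^ 2 + n2 ^ 2) by (apply pow2_sqrt; lra).
  exists (n1 / N), (n2 / N). split.
  - transitivity ((n1 ^ 2 + n2 ^ 2) / N ^ 2); [field; lra|]. rewrite HN2. field. lra.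
  - intros y Hyk. specialize (Hm y Hyk).
    replace (n1 / N * (fst y - fst z) + n2 / N * (snd y - snd z)) with ((X y - s * Y y) / N).
    + apply Rdiv_le_0_compat; assumption.
    + unfold X, Y, n1, n2. field. lra.
Qed.

(** [Rinf] is a choice operator, so [bdist] has a meaning only once the set of distances is known to
    be nonempty and bounded below; this is why the lemmas on [bdist] assume a boundary point. *)
Lemma Rinf_spec (E : R -> Prop) (lb : R) : (exists x, E x) -> (forall x, E x -> lb <= x) -> is_inf E (Rinf E).
Proof.
  intros [x Hx] Hlb. unfold Rinf. apply epsilon_spec.
  destruct (completeness (fun y => E (- y))) as [s [Hs1 Hs2]].
  - exists (- lb). intros y Hy. specialize (Hlb _ Hy). lra.
  - exists (- x). rewrite Ropp_involutive. assumption.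
  - exists (- s). split.
    + intros y Hy. assert (- y <= s); [|lra]. apply Hs1. rewrite Ropp_involutive. assumption.
    + intros m Hm. assert (s <= - m); [|lra]. apply Hs2. intros y Hy. specialize (Hm _ Hy). lra.
Qed.

Section BoundaryDistance.
Context (Om : pt -> Prop) (Hne : exists q, boundary2 Om q).

Lemma bdist_inf (p : pt) : is_inf (fun r => exists q, boundary2 Om q /\ r = pdist p q) (bdist Om p).
Proof.
  apply (Rinf_spec _ 0).
  - destruct Hne as [q Hq]. exists (pdist p q), q. auto.
  - intros x [q [_ ->]]. apply pdist_pos.
Qed.

Lemma bdist_le (p q : pt) : boundary2 Om q -> bdist Om p <= pdist p q.
Proof. intros Hq. apply (bdist_inf p). exists q. auto. Qed.

Lemma bdist_nonneg (p : pt) : 0 <= bdist Om p.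
Proof. apply (bdist_inf p). intros x [q [_ ->]]. apply pdist_pos. Qed.

Lemma bdist_lt (p : pt) (r : R) : bdist Om p < r -> exists q, boundary2 Om q /\ pdist p q < r.
Proof.
  intros H. apply NNPP. intros Hn. apply (Rlt_not_le _ _ H). apply (bdist_inf p).
  intros x [q [Hq ->]]. apply Rnot_lt_le. intros Hlt. apply Hn. exists q. auto.
Qed.

Lemma bdist_lip (p q : pt) : bdist Om p <= bdist Om q + pdist p q.
Proof.
  apply le_epsilon. intros e He. destruct (bdist_lt q (bdist Om q + e)) as [z [Hz Hlt]]; [lra|].
  pose proof (bdist_le p z Hz). pose proof (pdist_tri p q z). lra.
Qed.

Lemma bdist_cts : cts (bdist Om).
Proof.
  intros p. apply cts_pdist. intros e He. exists e. split; [assumption|]. intros q Hq.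
  pose proof (bdist_lip p q). pose proof (bdist_lip q p). rewrite (pdist_sym q p) in *.
  apply Rabs_def1; lra.
Qed.

(** Arbitrarily near a boundary point there are points outside the set. This trades boundary points,
    which may belong to the set, for outside points, to which [separation] applies. *)
Lemma bdist_out (p : pt) (r : R) : bdist Om p < r -> exists z, ~ Om z /\ pdist p z < r.
Proof.
  intros H. destruct (bdist_lt p r H) as [q [[_ Hq] Hlt]].
  apply NNPP. intros Hn. apply Hq. exists (r - pdist p q). split; [lra|].
  intros z Hz. apply NNPP. intros Hz'. apply Hn. exists z. split; [assumption|].
  pose proof (pdist_tri p q z). lra.
Qed.

Lemma bdist_ball (p : pt) (r : R) : (forall q, pdist p q < r -> Om q) -> r <= bdist Om p.
Proof.
  intros H. apply Rnot_lt_le. intros Hlt. destruct (bdist_out p r Hlt) as [z [Hz Hpz]]. apply Hz, H, Hpz.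
Qed.
End BoundaryDistance.

(** At the last parameter up to which the path is interior, the path would be in the closure but not
    in the interior. Applied to the boundary rays of the sector, this is how disjointness of the two
    boundaries enters. *)
Lemma path_in_interior (K : pt -> Prop) (f : R -> pt) :
  (forall t t', pdist (f t) (f t') <= Rabs (t - t')) ->
  interior2 K (f 0) -> (forall t, 0 <= t -> ~ boundary2 K (f t)) -> forall t, 0 <= t -> interior2 K (f t).
Proof.
  intros Hlip H0 Hb t1 Ht1. apply NNPP. intros Hn.
  assert (Hopen : forall t, interior2 K (f t) -> exists d, 0 < d /\ forall t', Rabs (t - t') < d -> interior2 K (f t')).
  { intros t [e [He HK]]. exists (e / 2). split; [lra|]. intros t' Ht'. exists (e / 2). split; [lra|].
    intros q Hq. apply HK. pose proof (pdist_tri (f t) (f t') q). pose proof (Hlip t t'). lra. }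
  destruct (completeness (fun t => 0 <= t <= t1 /\ forall s, 0 <= s <= t -> interior2 K (f s))) as [s [Hs1 Hs2]].
  { exists t1. intros t [Ht _]. lra. }
  { exists 0. split; [lra|]. intros s Hs. replace s with 0 by lra. assumption. }
  assert (Hs0 : 0 <= s).
  { apply Hs1. split; [lra|]. intros s' Hs'. replace s' with 0 by lra. assumption. }
  assert (Hst : s <= t1) by (apply Hs2; intros t [Ht _]; lra).
  assert (Hbelow : forall t, 0 <= t < s -> interior2 K (f t)).
  { intros t Ht. apply NNPP. intros Hn'. assert (s <= t); [|lra]. apply Hs2. intros t' [Ht' HK].
    apply Rnot_lt_le. intros Hlt. apply Hn', HK. lra. }
  assert (HsI : interior2 K (f s)).
  { apply NNPP. intros Hn'. apply (Hb s Hs0). split; [|assumption]. intros e He.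
    destruct (Rle_lt_or_eq_dec 0 s Hs0) as [Hlt| <-]; [|contradiction].
    set (d := Rmin (e / 2) s). assert (Hd : 0 < d /\ d <= e / 2 /\ d <= s).
    { unfold d. split; [apply Rmin_pos; lra|]. split; [apply Rmin_l|apply Rmin_r]. }
    exists (f (s - d)). destruct (Hbelow (s - d)) as [e' [He' HK]]; [lra|]. split.
    - apply HK. rewrite pdist_refl. lra.
    - eapply Rle_lt_trans; [apply Hlip|]. replace (s - (s - d)) with d by ring. rewrite Rabs_pos_eq; lra. }
  destruct (Hopen s HsI) as [d [Hd HK]].
  destruct (Req_dec s t1) as [->|Hne]; [contradiction|].
  set (s' := Rmin (s + d / 2) t1).
  assert (Hs' : s < s' /\ s' <= s + d / 2 /\ s' <= t1).
  { unfold s'. split; [apply Rmin_glb_lt; lra|]. split; [apply Rmin_l|apply Rmin_r]. }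
  assert (s' <= s); [|lra]. apply Hs1. split; [lra|]. intros r Hr.
  destruct (Rlt_or_le r s); [apply Hbelow; lra|]. apply HK. rewrite Rabs_left1; lra.
Qed.

(** * Supporting half planes and the geometry of the domain *)

Definition hp : Type := (R * R * R)%type.
Definition m1 (h : hp) : R := fst (fst h).
Definition m2 (h : hp) : R := snd (fst h).
(** For a unit normal this is the signed distance to the edge of the half plane, positive inside. *)
Definition ell (h : hp) (p : pt) : R := m1 h * fst p + m2 h * snd p - snd h.
Definition supporting (K : pt -> Prop) (h : hp) : Prop :=
  m1 h ^ 2 + m2 h ^ 2 = 1 /\ forall p, K p -> 0 <= ell h p.

Lemma ell_lip (h : hp) (p q : pt) : m1 h ^ 2 + m2 h ^ 2 = 1 -> ell h p <= ell h q + pdist p q.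
Proof.
  intros Hm. unfold ell. pose proof (pdist_pos p q). pose proof (pdist_sq p q) as E.
  set (x := fst p - fst q) in *. set (y := snd p - snd q) in *.
  assert (m1 h * x + m2 h * y <= pdist p q).
  { destruct (Rle_or_lt (m1 h * x + m2 h * y) 0); [lra|].
    apply Rsqr_incr_0_var; [|assumption]. unfold Rsqr.
    replace (pdist p q * pdist p q) with ((x ^ 2 + y ^ 2) * (m1 h ^ 2 + m2 h ^ 2)) by (rewrite Hm, <- E; ring).
    pose proof (pow2_ge_0 (x * m2 h - y * m1 h)). nra. }
  unfold x, y in *. lra.
Qed.

Section Admissible.
Context (K : pt -> Prop) (v : pt) (g b : R).
Context (Hb : 0 < b <= PI / 2) (HK : convex_set K) (Hv : interior2 K v).
Context (Hray : forall t s, 0 <= t -> s = 1 \/ s = - 1 -> interior2 K (ray v g t (s * (b + PI / 2)))).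

Definition Om (p : pt) : Prop := K p /\ Rabs (ang v g p) < b + PI / 2.

(** [K] fills a ball around each point of the two rays, so the domain and the sector coincide
    there. *)
Lemma ray_boundary (t s : R) : 0 <= t -> s = 1 \/ s = - 1 -> boundary2 Om (ray v g t (s * (b + PI / 2))).
Proof.
  intros Ht Hs. pose proof PI_RGT_0. split.
  - intros e He. destruct (Hray t s Ht Hs) as [e' [He' HK']].
    destruct (closure_ray v g b t s Hb Ht Hs (Rmin e e')) as [q [Hq Hd]].
    { apply Rmin_pos; lra. }
    exists q. pose proof (Rmin_l e e'). pose proof (Rmin_r e e').
    split; [split|]; [apply HK'; lra|assumption|lra].
  - intros [e [He HO]]. destruct (HO (ray v g t (s * (b + PI / 2)))) as [_ Ha].
    { rewrite pdist_refl. lra. }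
    assert (Habs : Rabs (s * (b + PI / 2)) = b + PI / 2).
    { rewrite Rabs_mult, (Rabs_pos_eq (b + PI / 2)) by lra.
      replace (Rabs s) with 1; [ring|]. destruct Hs; subst s; unfold Rabs; destruct Rcase_abs; lra. }
    pose proof (ang_ray_abs v g t (s * (b + PI / 2)) Ht) as H'. rewrite Habs in H'.
    assert (b + PI / 2 <= PI) by lra. specialize (H' H0). lra.
Qed.

Lemma Om_boundary_ne : exists q, boundary2 Om q.
Proof. exists (ray v g 0 (1 * (b + PI / 2))). apply ray_boundary; [lra|left; reflexivity]. Qed.

Lemma bdist_le_d0 (p : pt) : Rabs (ang v g p) < b + PI / 2 -> bdist Om p <= d0 v g b p.
Proof.
  intros Ha. destruct (d0_attained v g b p Hb Ha) as (t & s & Ht & Hs & <-).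
  apply bdist_le; [apply Om_boundary_ne|]. apply ray_boundary; assumption.
Qed.

Lemma ang_lt_PI (p : pt) : Rabs (ang v g p) < b + PI / 2 -> ang v g p < PI.
Proof. intros H. apply Rabs_def2 in H. lra. Qed.

(** Near a point of [C] either the distance to the sector's boundary is nearly minimal, or an almost
    nearest outside point lies outside [K] and separating it from [K] gives a suitable half plane.
    In the latter case the [3 * e] consists of [e] for an almost nearest point, [e] for moving [ell]
    and [e] for moving [bdist]. Compactness leaves finitely many half planes. *)
Lemma halfplane_cover (C : pt -> Prop) (e : R) : bounded2 C -> (forall p, closure2 C p -> C p) ->
  (forall p, C p -> Om p) -> 0 < e ->
  exists hs, (forall h, In h hs -> supporting K h) /\
    forall p, C p -> d0 v g b p <= bdist Om p + 3 * e \/ exists h, In h hs /\ ell h p <= bdist Om p + 3 * e.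
Proof.
  intros HCb HCc HCO He.
  apply (compact_ind C (fun S => exists hs, (forall h, In h hs -> supporting K h) /\
    forall p, S p -> d0 v g b p <= bdist Om p + 3 * e \/ exists h, In h hs /\ ell h p <= bdist Om p + 3 * e) HCb HCc).
  - exists nil. split; [intros h []|intros p []].
  - intros S S' HS [hs [H1 H2]]. exists hs. split; [assumption|]. intros p Hp. apply H2, HS, Hp.
  - intros S S' [hs [H1 H2]] [hs' [H1' H2']]. exists (hs ++ hs'). split.
    + intros h Hh. apply in_app_or in Hh. destruct Hh; [apply H1|apply H1']; assumption.
    + intros p [Hp|Hp]; [destruct (H2 p Hp) as [|[h [Hh Hl]]]|destruct (H2' p Hp) as [|[h [Hh Hl]]]];
        try (left; assumption); right; exists h; (split; [apply in_or_app; tauto|assumption]).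
  - intros z Hz. pose proof (HCO z Hz) as [_ Hza].
    destruct (Rle_or_lt (bdist Om z + e) (d0 v g b z)) as [Hle|Hlt].
    + destruct (bdist_out Om Om_boundary_ne z (bdist Om z + e)) as [w [Hw Hzw]]; [lra|].
      (* [w] is closer to [z] than any point outside the sector can be, so it must fail to lie in
         [K]. *)
      assert (HwK : ~ K w).
      { intros HwK. apply (Rlt_not_le _ _ Hzw). eapply Rle_trans; [exact Hle|].
        apply d0_le; [lra|]. apply Rnot_lt_le. intros Ha. apply Hw. split; assumption. }
      destruct (separation K v w HK Hv HwK) as (n1 & n2 & Hn & Hs).
      set (h := ((n1, n2), n1 * fst w + n2 * snd w) : hp).
      exists e. split; [assumption|]. exists (h :: nil). split.
      * intros h' [<-|[]]. split; [exact Hn|]. intros p Hp. specialize (Hs p Hp).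
        unfold ell, m1, m2, h; simpl. lra.
      * intros p [Hp Hzp]. right. exists h. split; [left; reflexivity|].
        pose proof (ell_lip h p z Hn). pose proof (ell_lip h z w Hn).
        assert (ell h w = 0) by (unfold ell, m1, m2, h; simpl; ring).
        pose proof (bdist_lip Om Om_boundary_ne z p). rewrite (pdist_sym p z) in *. lra.
    + pose proof (C1p_d0 v g b z ltac:(lra) (ang_lt_PI z Hza)) as (_ & _ & Hc & _).
      destruct (proj1 (cts_pdist _ z) Hc e He) as [d [Hd Hdc]].
      exists (Rmin d e). split; [apply Rmin_pos; assumption|]. exists nil. split; [intros h []|].
      intros p [Hp Hzp]. left. pose proof (Rmin_l d e). pose proof (Rmin_r d e).
      specialize (Hdc p ltac:(lra)). apply Rabs_def2 in Hdc.
      pose proof (bdist_lip Om Om_boundary_ne z p). lra.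
Qed.

(** Supplies the angle [X < b + PI / 2] at which the potential may be frozen, and a lower bound for
    the radius that makes the interaction errors uniform. *)
Lemma compact_polar_bounds (C : pt -> Prop) : bounded2 C -> (forall p, closure2 C p -> C p) ->
  (forall p, C p -> Om p) ->
  exists r, 0 < r < PI / 2 /\ forall p, C p -> r <= rad v g p /\ Rabs (ang v g p) <= b + PI / 2 - r.
Proof.
  intros HCb HCc HCO. pose proof PI_RGT_0.
  apply (compact_ind C (fun S => exists r, 0 < r < PI / 2 /\ forall p, S p -> r <= rad v g p /\ Rabs (ang v g p) <= b + PI / 2 - r) HCb HCc).
  - exists (PI / 4). split; [lra|]. intros p [].
  - intros S S' HS [r [Hr H1]]. exists r. split; [assumption|]. intros p Hp. apply H1, HS, Hp.
  - intros S S' [r [Hr H1]] [r' [Hr' H1']]. exists (Rmin r r').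
    pose proof (Rmin_l r r'). pose proof (Rmin_r r r').
    split; [split; [apply Rmin_pos; lra|lra]|]. intros p [Hp|Hp]; [destruct (H1 p Hp)|destruct (H1' p Hp)]; split; lra.
  - intros z Hz. pose proof (HCO z Hz) as [_ Hza]. pose proof (ang_lt_PI z Hza) as Hpi.
    pose proof (rad_gt0 v g z Hpi) as Hr.
    destruct (C1p_rad v g z Hr) as (_ & _ & Hc1 & _).
    destruct (C1p_ang v g z (Rpos_rad v g z Hpi)) as (_ & _ & Hc2 & _).
    set (r := Rmin (Rmin (rad v g z / 2) ((b + PI / 2 - Rabs (ang v g z)) / 2)) (PI / 4)).
    assert (Hr' : 0 < r /\ r <= rad v g z / 2 /\ r <= (b + PI / 2 - Rabs (ang v g z)) / 2 /\ r <= PI / 4).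
    { unfold r. split; [repeat apply Rmin_pos; lra|].
      pose proof (Rmin_l (Rmin (rad v g z / 2) ((b + PI / 2 - Rabs (ang v g z)) / 2)) (PI / 4)).
      pose proof (Rmin_r (Rmin (rad v g z / 2) ((b + PI / 2 - Rabs (ang v g z)) / 2)) (PI / 4)).
      pose proof (Rmin_l (rad v g z / 2) ((b + PI / 2 - Rabs (ang v g z)) / 2)).
      pose proof (Rmin_r (rad v g z / 2) ((b + PI / 2 - Rabs (ang v g z)) / 2)). lra. }
    destruct (proj1 (cts_pdist _ z) Hc1 r) as [d1 [Hd1 D1]]; [lra|].
    destruct (proj1 (cts_pdist _ z) Hc2 r) as [d2 [Hd2 D2]]; [lra|].
    exists (Rmin d1 d2). split; [apply Rmin_pos; assumption|]. exists r. split; [lra|].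
    intros p [_ Hp]. pose proof (Rmin_l d1 d2). pose proof (Rmin_r d1 d2).
    specialize (D1 p ltac:(lra)). specialize (D2 p ltac:(lra)). apply Rabs_def2 in D1. split; [lra|].
    pose proof (Rabs_triang_inv (ang v g p) (ang v g z)). lra.
Qed.

(* The cone spanned by the two rays lies in [K], so an inner normal of [K] is opposite to a
   direction [g + nu] of the normal cone of that cone. *)
Lemma supporting_normal (h : hp) : supporting K h ->
  exists nu, - b <= nu <= b /\ m1 h = - cos (g + nu) /\ m2 h = - sin (g + nu).
Proof.
  intros [Hm Hh]. pose proof PI_RGT_0.
  set (p := (- m1 h, - m2 h)).
  destruct (polar (0, 0) g p) as [E1 E2]. simpl in E1, E2.
  assert (Hr : rad (0, 0) g p = 1).
  { rewrite rad_dist. unfold pdist; simpl. replace (_ + _) with 1; [apply sqrt_1|]. lra. }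
  rewrite Hr in E1, E2. set (nu := ang (0, 0) g p) in *.
  pose proof (ang_range (0, 0) g p) as Hnu. fold nu in Hnu.
  exists nu. cut (- b <= nu <= b); [intros; split; [assumption|]; lra|].
  assert (Hdir : forall s, s = 1 \/ s = - 1 -> 0 <= m1 h * cos (g + s * (b + PI / 2)) + m2 h * sin (g + s * (b + PI / 2))).
  { intros s Hs. set (k := m1 h * cos (g + s * (b + PI / 2)) + m2 h * sin (g + s * (b + PI / 2))).
    apply Rnot_lt_le. intros Hk.
    assert (Ht : forall t, 0 <= t -> 0 <= ell h v + t * k).
    { intros t Ht. destruct (Hray t s Ht Hs) as [e [He HKe]].
      replace (ell h v + t * k) with (ell h (ray v g t (s * (b + PI / 2)))).
      - apply Hh, HKe. rewrite pdist_refl. lra.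
      - unfold ell, ray, k; simpl. ring. }
    pose proof (Ht 0 ltac:(lra)) as H0.
    specialize (Ht ((ell h v + 1) / - k)). 
    assert (0 <= (ell h v + 1) / - k) by (apply Rdiv_le_0_compat; lra).
    replace (ell h v + (ell h v + 1) / - k * k) with (- 1) in Ht by (field; lra).
    specialize (Ht H1). lra. }
  assert (F1 : sin (nu - b) <= 0).
  { specialize (Hdir 1 (or_introl eq_refl)).
    replace (sin (nu - b)) with (cos ((g + 1 * (b + PI / 2)) - (g + nu))).
    - rewrite cos_minus. nra.
    - replace (g + 1 * (b + PI / 2) - (g + nu)) with (PI / 2 - (nu - b)) by ring. apply cos_shift. }
  assert (F2 : 0 <= sin (nu + b)).
  { specialize (Hdir (- 1) (or_intror eq_refl)).
    replace (sin (nu + b)) with (- cos ((g + -1 * (b + PI / 2)) - (g + nu))).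
    - rewrite cos_minus. nra.
    - replace (g + -1 * (b + PI / 2) - (g + nu)) with (- (PI / 2 + (nu + b))) by ring.
      rewrite cos_neg. replace (PI / 2 + (nu + b)) with (PI / 2 - - (nu + b)) by ring.
      rewrite cos_shift, sin_neg. ring. }
  split; apply Rnot_lt_le; intros H1.
  - assert (0 < sin (- (nu + b))) by (apply sin_gt_0; lra). rewrite sin_neg in *. lra.
  - assert (0 < sin (nu - b)) by (apply sin_gt_0; lra). lra.
Qed.
End Admissible.

(** * The angular equation *)

Lemma is_derive_atan (x : R) : is_derive atan x (/ (1 + Rsqr x)).
Proof.
  apply is_derive_Reals. pose proof (derivable_pt_lim_atan x) as H.
  replace (/ (1 + Rsqr x)) with (/ (1 + x ^ 2)) by (unfold Rsqr; f_equal; ring). exact H.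
Qed.

Lemma derive_nonneg_incr (f f' : R -> R) (x y : R) : x <= y ->
  (forall t, x <= t <= y -> is_derive f t (f' t)) -> (forall t, x <= t <= y -> 0 <= f' t) -> f x <= f y.
Proof.
  intros Hxy Hd Hp.
  destruct (MVT_gen f x y f') as [z [Hz E]].
  - intros t. rewrite Rmin_left, Rmax_right by lra. intros Ht. apply Hd. lra.
  - intros t. rewrite Rmin_left, Rmax_right by lra. intros Ht.
    apply continuity_pt_filterlim. apply (ex_derive_continuous (V := R_NormedModule)). eexists. apply Hd, Ht.
  - rewrite Rmin_left, Rmax_right in Hz by lra. specialize (Hp z Hz). nra.
Qed.

(* The potential [c / kk^2], frozen outside [-X, X] to stay bounded. *)
Definition pot (c b X x : R) : R := c / kk b (clamp X x) ^ 2.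

Definition ground_state (c b X : R) (psi psi1 : R -> R) : Prop :=
  (forall x, is_derive psi x (psi1 x)) /\ (forall x, is_derive psi1 x (- pot c b X x * psi x)) /\
  psi 0 = 1 /\ psi1 0 = 0.

(** Strictness in [c' < c] makes the set of such [c] closed under suprema, and [X < b + PI / 2]
    stays away from the singularity of the potential at the edge of the sector. *)
Definition subcritical (c b : R) : Prop :=
  forall c' X, 0 <= c' < c -> 0 < X < b + PI / 2 ->
    exists psi psi1, ground_state c' b X psi psi1 /\ forall x, Rabs x <= X -> 0 < psi x.

Section Riccati.
Context (c b X : R) (psi psi1 : R -> R).
Context (Hc : 0 <= c) (Hb : 0 < b) (HX : 0 < X < b + PI / 2).
Context (Hgs : ground_state c b X psi psi1) (Hpos : forall x, Rabs x <= X -> 0 < psi x).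

Definition ricc (x : R) : R := - psi1 x / psi x.

Lemma clamp_X_range (x : R) : Rabs (clamp X x) <= X.
Proof. apply Rabs_le_between. apply clamp_range. lra. Qed.

Lemma kk_clamp_pos (x : R) : 0 < kk b (clamp X x) <= 1.
Proof. apply kk_range; [lra|]. pose proof (clamp_X_range x). lra. Qed.

Lemma pot_ge (x : R) : c <= pot c b X x.
Proof.
  unfold pot. pose proof (kk_clamp_pos x).
  apply Rle_div_r; [apply pow_lt; lra|]. assert (kk b (clamp X x) ^ 2 <= 1) by nra. nra.
Qed.

Lemma pot_eq (x : R) : Rabs x <= X -> pot c b X x = c / kk b x ^ 2.
Proof. intros Hx. unfold pot. rewrite clamp_mid; [reflexivity|]. apply Rabs_le_between, Hx. Qed.

Lemma continuous_pot (x : R) : continuous (pot c b X) x.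
Proof.
  unfold pot, Rdiv. apply (continuous_mult (K := R_AbsRing) (fun _ => c)); [apply continuous_const|].
  apply (continuous_comp (fun x => kk b (clamp X x)) (fun k => / k ^ 2)).
  - apply (continuous_comp (clamp X) (kk b)); [apply continuous_clamp; lra|apply continuous_kk; lra].
  - apply (ex_derive_continuous (V := R_NormedModule)). auto_derive.
    pose proof (kk_clamp_pos x). nra.
Qed.

Lemma ricc_derive (x : R) : Rabs x <= X -> is_derive ricc x (ricc x ^ 2 + pot c b X x).
Proof.
  intros Hx. destruct Hgs as (H1 & H2 & _). pose proof (Hpos x Hx) as Hp.
  unfold ricc.
  replace ((- psi1 x / psi x) ^ 2 + pot c b X x)
    with ((- (- pot c b X x * psi x) * psi x - - psi1 x * psi1 x) / psi x ^ 2) by (field; lra).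
  apply (is_derive_div (fun x => - psi1 x) psi x).
  - apply (is_derive_opp (V := R_NormedModule) psi1 x), H2.
  - apply H1.
  - lra.
Qed.

Lemma ricc_mono (x y : R) : - X <= x -> x <= y -> y <= X -> ricc x <= ricc y.
Proof.
  intros Hx Hxy Hy. apply (derive_nonneg_incr ricc (fun x => ricc x ^ 2 + pot c b X x)); [assumption| |].
  - intros t Ht. apply ricc_derive, Rabs_le_between. lra.
  - intros t _. pose proof (pot_ge t). pose proof (pow2_ge_0 (ricc t)). lra.
Qed.

Lemma ricc_0 : ricc 0 = 0.
Proof. unfold ricc. destruct Hgs as (_ & _ & H1 & ->). rewrite H1. field. Qed.

Lemma continuous_ricc_derive (x : R) : Rabs x <= X -> continuous (fun x => ricc x ^ 2 + pot c b X x) x.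
Proof.
  intros Hx. apply (continuous_plus (V := R_NormedModule)); [|apply continuous_pot].
  apply (continuous_comp ricc (fun t => t ^ 2)).
  - apply (ex_derive_continuous (V := R_NormedModule)). eexists. apply ricc_derive, Hx.
  - apply (ex_derive_continuous (V := R_NormedModule)). auto_derive. exact I.
Qed.

(* [F' = F^2 + c <= F^2 + 1/4] on the part where the distance is that to the vertex. *)
Lemma ricc_half (x : R) : c <= 1 / 4 -> b <= PI / 2 -> Rabs x <= X -> Rabs x <= b -> Rabs (ricc x) <= 1 / 2.
Proof.
  intros Hc4 HbP HxX Hxb. pose proof PI_RGT_0 as Hpi.
  (* [H] is nondecreasing and vanishes at 0. For [x >= 0] this gives
     [atan (2 * F) <= x / 2 <= PI / 4], the last step by [x <= b <= PI / 2]; the case [x < 0] is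
     symmetric. *)
  set (H := fun t => - (atan (2 * ricc t) - t / 2)).
  assert (Hmono : forall s t, - b <= s -> - X <= s -> s <= t -> t <= b -> t <= X -> H s <= H t).
  { intros s t A1 A2 A3 A4 A5.
    apply (derive_nonneg_incr H (fun x => - (2 * (ricc x ^ 2 + pot c b X x) / (1 + (2 * ricc x) ^ 2) - 1 / 2))); [assumption| |].
    - intros z Hz. assert (Hz' : Rabs z <= X) by (apply Rabs_le_between; lra).
      pose proof (ricc_derive z Hz') as D. unfold H.
      apply (is_derive_opp (V := R_NormedModule) (fun t => atan (2 * ricc t) - t / 2)).
      apply (is_derive_minus (V := R_NormedModule) (fun t => atan (2 * ricc t)) (fun t => t / 2)).
      + replace (2 * (ricc z ^ 2 + pot c b X z) / (1 + (2 * ricc z) ^ 2))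
          with (scal (2 * (ricc z ^ 2 + pot c b X z)) (/ (1 + Rsqr (2 * ricc z)))).
        * apply (is_derive_comp (V := R_NormedModule) atan (fun t => 2 * ricc t)).
          -- apply is_derive_atan.
          -- apply (is_derive_scal ricc z 2 _ D).
        * unfold scal, Rsqr; simpl; unfold mult; simpl. unfold Rdiv. f_equal. f_equal. ring.
      + auto_derive; [exact I|]. field.
    - intros z Hz. assert (Hz' : Rabs z <= X) by (apply Rabs_le_between; lra).
      rewrite (pot_eq z Hz'). unfold kk. rewrite clamp_mid, Rminus_diag, cos_0 by lra.
      assert (2 * (ricc z ^ 2 + c / 1 ^ 2) / (1 + (2 * ricc z) ^ 2) <= 1 / 2); [|lra].
      pose proof (pow2_ge_0 (ricc z)). apply Rle_div_l; [nra|]. lra. }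
  assert (H0 : H 0 = 0) by (unfold H; rewrite ricc_0, Rmult_0_r, atan_0; field).
  apply Rabs_le_between in HxX. apply Rabs_le_between in Hxb.
  assert (Ht : forall y, y <= PI / 4 -> - PI / 4 <= y -> Rabs (tan y) <= 1).
  { intros y Hy1 Hy2. apply Rabs_le_between. rewrite <- tan_PI4, <- tan_neg. split.
    - destruct (Rle_lt_or_eq_dec (- (PI / 4)) y) as [Hl| <-]; [lra| |lra]. apply Rlt_le, tan_increasing; lra.
    - destruct (Rle_lt_or_eq_dec y (PI / 4)) as [Hl| ->]; [lra| |lra]. apply Rlt_le, tan_increasing; lra. }
  assert (Ha : Rabs (atan (2 * ricc x)) <= PI / 4).
  { apply Rabs_le_between. destruct (Rle_or_lt 0 x) as [Hx|Hx].
    - pose proof (Hmono 0 x ltac:(lra) ltac:(lra) Hx ltac:(lra) ltac:(lra)) as Hm. rewrite H0 in Hm. unfold H in Hm.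
      pose proof (ricc_mono 0 x ltac:(lra) Hx ltac:(lra)) as Hp. rewrite ricc_0 in Hp.
      assert (0 <= atan (2 * ricc x)).
      { rewrite <- atan_0. destruct (Rle_lt_or_eq_dec 0 (ricc x) Hp) as [Hl|He]; [apply Rlt_le, atan_increasing; lra|].
        rewrite <- He, Rmult_0_r. lra. }
      lra.
    - pose proof (Hmono x 0 ltac:(lra) ltac:(lra) ltac:(lra) ltac:(lra) ltac:(lra)) as Hm. rewrite H0 in Hm. unfold H in Hm.
      pose proof (ricc_mono x 0 ltac:(lra) ltac:(lra) ltac:(lra)) as Hp. rewrite ricc_0 in Hp.
      assert (atan (2 * ricc x) <= 0).
      { rewrite <- atan_0. destruct (Rle_lt_or_eq_dec (ricc x) 0 Hp) as [Hl|He]; [apply Rlt_le, atan_increasing; lra|].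
        rewrite He, Rmult_0_r. lra. }
      lra. }
  apply Rabs_le_between in Ha.
  pose proof (Ht (atan (2 * ricc x)) ltac:(lra) ltac:(lra)) as Hf. rewrite tan_atan in Hf.
  rewrite Rabs_mult, (Rabs_pos_eq 2) in Hf; lra.
Qed.
End Riccati.

(* With [th] the angle to the boundary, [G = th * F] satisfies [G' >= ((G - 1/2)^2 + c - 1/4) / th]. *)
Lemma subcritical_le_quarter (c b : R) : 0 < b <= PI / 2 -> subcritical c b -> c <= 1 / 4.
Proof.
  intros Hb HN. pose proof PI_RGT_0. apply Rnot_lt_le. intros Hc.
  set (c' := (c + 1 / 4) / 2). set (dl := sqrt (c' - 1 / 4)).
  assert (Hdl : 0 < dl) by (apply sqrt_lt_R0; unfold c'; lra).
  assert (Hdl2 : dl ^ 2 = c' - 1 / 4) by (apply pow2_sqrt; unfold c'; lra).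
  (* Between [b] and [X] the distance to the edge shrinks from [PI / 2] to [t0], so
     [dl * ln (e - x)] drops by [2 * PI], more than the arctangent in [H1] can gain. *)
  set (t0 := PI / 2 * exp (- (2 * PI) / dl)).
  assert (Ht0 : 0 < t0 < PI / 2).
  { unfold t0. pose proof (exp_pos (- (2 * PI) / dl)). assert (exp (- (2 * PI) / dl) < 1).
    { rewrite <- exp_0. apply exp_increasing. unfold Rdiv. pose proof (Rinv_0_lt_compat dl Hdl). nra. }
    nra. }
  set (e := b + PI / 2). set (X := e - t0).
  destruct (HN c' X) as (psi & psi1 & Hgs & Hpos); [unfold c'; lra|unfold X, e; lra|].
  assert (HX : 0 < X < b + PI / 2) by (unfold X, e; lra).
  assert (Hc' : 0 <= c') by (unfold c'; lra).
  set (F := ricc psi psi1).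
  set (H1 := fun x => atan (((e - x) * F x - 1 / 2) / dl) + dl * ln (e - x)).
  set (dG := fun x => - F x + (e - x) * (F x ^ 2 + pot c' b X x)).
  assert (Hm : H1 b <= H1 X).
  { apply (derive_nonneg_incr H1 (fun x => dG x / dl / (1 + (((e - x) * F x - 1 / 2) / dl) ^ 2) - dl / (e - x))).
    - unfold X, e; lra.
    - intros x Hx. assert (HxX : Rabs x <= X) by (apply Rabs_le_between; lra).
      pose proof (ricc_derive c' b X psi psi1 Hgs Hpos x HxX) as D. fold F in D.
      assert (Hex : 0 < e - x) by (unfold X in Hx; lra).
      unfold H1. apply (is_derive_plus (V := R_NormedModule) (fun x => atan (((e - x) * F x - 1 / 2) / dl))).
      + replace (dG x / dl / (1 + (((e - x) * F x - 1 / 2) / dl) ^ 2))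
          with (scal (dG x / dl) (/ (1 + Rsqr (((e - x) * F x - 1 / 2) / dl)))).
        * apply (is_derive_comp (V := R_NormedModule) atan (fun x => ((e - x) * F x - 1 / 2) / dl)).
          -- apply is_derive_atan.
          -- assert (ED : Derive F x = F x ^ 2 + pot c' b X x) by (apply is_derive_unique, D).
             auto_derive; [eexists; exact D|]. change (Derive (fun x => F x) x) with (Derive F x). rewrite ED. unfold dG. field. lra.
        * unfold scal, Rsqr; simpl; unfold mult; simpl. unfold Rdiv. f_equal. f_equal. ring.
      + auto_derive; [assumption|]. field. lra.
    - intros x Hx. assert (HxX : Rabs x <= X) by (apply Rabs_le_between; lra).
      assert (Hex : 0 < e - x <= PI / 2) by (unfold X, e in *; lra).
      assert (Hk : kk b x = sin (e - x)).
      { unfold kk. rewrite clamp_hi by lra. replace (e - x) with (PI / 2 - (x - b)) by (unfold e; ring). symmetry. apply sin_shift. }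
      assert (Hs : 0 < sin (e - x)) by (apply sin_gt_0; lra).
      pose proof (sin_lt_x (e - x) ltac:(lra)) as Hsx.
      (* Since [sin t < t], the potential dominates the one-dimensional Hardy potential, whose
         critical constant is [1 / 4]. *)
      assert (Hpot : c' / (e - x) ^ 2 <= pot c' b X x).
      { rewrite (pot_eq c' b X x HxX), Hk. unfold Rdiv. apply Rmult_le_compat_l; [assumption|].
        apply Rinv_le_contravar; [apply pow_lt, Hs|]. nra. }
      set (th := e - x) in *. set (G := th * F x).
      assert (HdG : ((G - 1 / 2) ^ 2 + dl ^ 2) / th <= dG x).
      { unfold dG. fold th. rewrite Hdl2.
        apply Rle_trans with (- F x + th * (F x ^ 2 + c' / th ^ 2)).
        - right. unfold G. field. lra.
        - assert (th * (F x ^ 2 + c' / th ^ 2) <= th * (F x ^ 2 + pot c' b X x)) by (apply Rmult_le_compat_l; lra). lra. }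
      assert (Hden : 1 + ((G - 1 / 2) / dl) ^ 2 = ((G - 1 / 2) ^ 2 + dl ^ 2) / dl ^ 2) by (field; lra).
      rewrite Hden. assert (HS : 0 < (G - 1 / 2) ^ 2 + dl ^ 2) by (pose proof (pow2_ge_0 (G - 1 / 2)); nra).
      replace (dG x / dl / (((G - 1 / 2) ^ 2 + dl ^ 2) / dl ^ 2) - dl / th)
        with (dl / ((G - 1 / 2) ^ 2 + dl ^ 2) * (dG x - ((G - 1 / 2) ^ 2 + dl ^ 2) / th)) by (field; lra).
      apply Rmult_le_pos; [|lra]. apply Rdiv_le_0_compat; lra. }
  unfold H1 in Hm.
  pose proof (atan_bound (((e - b) * F b - 1 / 2) / dl)) as B1.
  pose proof (atan_bound (((e - X) * F X - 1 / 2) / dl)) as B2.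
  replace (e - b) with (PI / 2) in Hm at 2 by (unfold e; ring).
  replace (ln (e - X)) with (ln (PI / 2) - 2 * PI / dl) in Hm.
  - replace (dl * (ln (PI / 2) - 2 * PI / dl)) with (dl * ln (PI / 2) - 2 * PI) in Hm by (field; lra). lra.
  - replace (e - X) with t0 by (unfold X; ring). unfold t0.
    rewrite ln_mult, ln_exp; [field; lra|lra|apply exp_pos].
Qed.

(** * Gluing vector fields *)

Lemma exp_mono (x y : R) : x <= y -> exp x <= exp y.
Proof.
  intros [H| ->]; [apply Rlt_le, exp_increasing, H|apply Rle_refl].
Qed.

(** A local distance [fD] with gradient [(fG1, fG2)], together with the vector field [(fT, fS)] that
    proves the Hardy inequality for it. All partial derivatives are stored because the divergence of
    the glued field is computed explicitly. *)
Record patch : Type := Patch {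
  fD : pt -> R; fG1 : pt -> R; fG2 : pt -> R;
  fT : pt -> R; fTx : pt -> R; fTy : pt -> R;
  fS : pt -> R; fSx : pt -> R; fSy : pt -> R }.

Definition patch_C1 (p : pt) (i : patch) : Prop :=
  C1p (fD i) (fG1 i) (fG2 i) p /\ C1p (fT i) (fTx i) (fTy i) p /\ C1p (fS i) (fSx i) (fSy i) p.

Fixpoint lsum (f : patch -> R) (l : list patch) : R :=
  match l with nil => 0 | i :: l => f i + lsum f l end.

Lemma lsum_plus (f h : patch -> R) l : lsum (fun i => f i + h i) l = lsum f l + lsum h l.
Proof. induction l as [|i l IH]; simpl; [ring|rewrite IH; ring]. Qed.

Lemma lsum_scal (k : R) (f : patch -> R) l : lsum (fun i => k * f i) l = k * lsum f l.
Proof. induction l as [|i l IH]; simpl; [ring|rewrite IH; ring]. Qed.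

Lemma lsum_ext (f h : patch -> R) l : (forall i, In i l -> f i = h i) -> lsum f l = lsum h l.
Proof.
  induction l as [|i l IH]; simpl; intros H; [reflexivity|]. rewrite IH, (H i); auto.
Qed.

Lemma lsum_le (f h : patch -> R) l : (forall i, In i l -> f i <= h i) -> lsum f l <= lsum h l.
Proof.
  induction l as [|i l IH]; simpl; intros H; [lra|]. apply Rplus_le_compat; auto.
Qed.

Lemma lsum_const (k : R) l : lsum (fun _ => k) l = k * INR (length l).
Proof.
  induction l as [|i l IH]; [simpl; ring|]. change (length (i :: l)) with (S (length l)).
  rewrite S_INR. simpl lsum. rewrite IH. ring.
Qed.

Lemma lsum_ge (f : patch -> R) l i : (forall i, In i l -> 0 <= f i) -> In i l -> f i <= lsum f l.
Proof.
  induction l as [|j l IH]; intros H Hi; [destruct Hi|]. simpl.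
  assert (0 <= lsum f l).
  { rewrite <- (Rmult_0_l (INR (length l))), <- lsum_const. apply lsum_le. intros k Hk. apply H. right; assumption. }
  destruct Hi as [->|Hi]; [lra|]. assert (f i <= lsum f l) by (apply IH; [intros k Hk; apply H; right|]; assumption).
  assert (0 <= f j) by (apply H; left; reflexivity). lra.
Qed.

Lemma C1p_lsum (F Fx Fy : patch -> pt -> R) (p : pt) l : (forall i, In i l -> C1p (F i) (Fx i) (Fy i) p) ->
  C1p (fun q => lsum (fun i => F i q) l) (fun q => lsum (fun i => Fx i q) l) (fun q => lsum (fun i => Fy i q) l) p.
Proof.
  induction l as [|i l IH]; intros H; simpl.
  - apply C1p_const.
  - apply (C1p_plus (F i) (Fx i) (Fy i)); [apply H; left; reflexivity|].
    apply IH. intros j Hj. apply H; right; assumption.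
Qed.

(* The double sum is the variance-type identity
   [Z sum E g.T - (sum E g).(sum E T) = 1/2 sum_ij E_i E_j (g_i - g_j).(T_i - T_j)]. *)
Lemma lsum_covariance (E G1 G2 T S : patch -> R) l (Z k : R) : Z = lsum E l ->
  (forall i j, In i l -> In j l ->
     E i * E j * ((G1 i - G1 j) * (T i - T j) + (G2 i - G2 j) * (S i - S j)) <= k) ->
  2 * (Z * lsum (fun i => E i * (G1 i * T i + G2 i * S i)) l
     - lsum (fun i => E i * G1 i) l * lsum (fun i => E i * T i) l
     - lsum (fun i => E i * G2 i) l * lsum (fun i => E i * S i) l) <= k * INR (length l) ^ 2.
Proof.
  intros HZ H.
  set (Q := fun i => E i * (G1 i * T i + G2 i * S i)).
  assert (Hin : forall i, In i l -> E i * lsum Q l + Z * Q i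
     - (E i * G1 i) * lsum (fun i => E i * T i) l - (E i * T i) * lsum (fun i => E i * G1 i) l
     - (E i * G2 i) * lsum (fun i => E i * S i) l - (E i * S i) * lsum (fun i => E i * G2 i) l <= k * INR (length l)).
  { intros i Hi. rewrite <- lsum_const.
    replace (_ - _) with (lsum (fun j => E i * E j * ((G1 i - G1 j) * (T i - T j) + (G2 i - G2 j) * (S i - S j))) l).
    - apply lsum_le. intros j Hj. apply H; assumption.
    - rewrite (lsum_ext _ (fun j => E i * Q j + (Q i * E j + ((- (E i * G1 i)) * (E j * T j) + ((- (E i * T i)) * (E j * G1 j)
        + ((- (E i * G2 i)) * (E j * S j) + (- (E i * S i)) * (E j * G2 j)))))) l) by (intros; unfold Q; ring).
      rewrite !lsum_plus, !lsum_scal, HZ. ring. }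
  apply lsum_le in Hin. rewrite lsum_const in Hin.
  eapply Rle_trans; [|right; transitivity (k * INR (length l) * INR (length l)); [reflexivity|ring]].
  eapply Rle_trans; [|exact Hin]. right.
  symmetry. etransitivity; [apply (lsum_ext _ (fun i => lsum Q l * E i + (Z * Q i + ((- lsum (fun i => E i * T i) l) * (E i * G1 i)
     + ((- lsum (fun i => E i * G1 i) l) * (E i * T i) + ((- lsum (fun i => E i * S i) l) * (E i * G2 i)
     + (- lsum (fun i => E i * G2 i) l) * (E i * S i)))))) l); intros; cbv beta; ring|].
  rewrite !lsum_plus, !lsum_scal, <- HZ. fold Q. ring.
Qed.

(** * The exponentially weighted average of the fields *)

Section Softmin.
Context (l : list patch) (N : R) (u ux uy : pt -> R).

Definition wE (i : patch) (q : pt) : R := exp (- N * fD i q).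
Definition wZ (q : pt) : R := lsum (fun i => wE i q) l.
Definition wZx (q : pt) : R := lsum (fun i => wE i q * (- N * fG1 i q)) l.
Definition wZy (q : pt) : R := lsum (fun i => wE i q * (- N * fG2 i q)) l.
Definition wA (q : pt) : R := lsum (fun i => wE i q * fT i q) l.
Definition wAx (q : pt) : R := lsum (fun i => wE i q * (- N * fG1 i q) * fT i q + wE i q * fTx i q) l.
Definition wAy (q : pt) : R := lsum (fun i => wE i q * (- N * fG2 i q) * fT i q + wE i q * fTy i q) l.
Definition wB (q : pt) : R := lsum (fun i => wE i q * fS i q) l.
Definition wBx (q : pt) : R := lsum (fun i => wE i q * (- N * fG1 i q) * fS i q + wE i q * fSx i q) l.
Definition wBy (q : pt) : R := lsum (fun i => wE i q * (- N * fG2 i q) * fS i q + wE i q * fSy i q) l.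

(** With [A] equal to [wA] or [wB], a component of [u^2] times the weighted average of the fields:
    the vector field whose divergence is added to the energy in [barta]. *)
Definition fld (A : pt -> R) (q : pt) : R := u q * u q * A q / wZ q.
Definition fldd (A Ad ud Zd : pt -> R) (q : pt) : R :=
  ((ud q * u q + u q * ud q) * A q + u q * u q * Ad q) / wZ q - u q * u q * A q * Zd q / wZ q ^ 2.

Lemma wE_pos (i : patch) (q : pt) : 0 < wE i q.
Proof. apply exp_pos. Qed.

Lemma wZ_ge (i : patch) (q : pt) : In i l -> wE i q <= wZ q.
Proof. intros Hi. apply (lsum_ge (fun i => wE i q)); [intros; apply Rlt_le, wE_pos|assumption]. Qed.

Lemma wZ_pos (q : pt) : l <> nil -> 0 < wZ q.
Proof.
  intros Hl. destruct l as [|i l'] eqn:El; [contradiction|]. rewrite <- El in *.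
  apply Rlt_le_trans with (wE i q); [apply wE_pos|apply wZ_ge]. rewrite El; left; reflexivity.
Qed.

Lemma C1p_wE (i : patch) (p : pt) : patch_C1 p i ->
  C1p (wE i) (fun q => wE i q * (- N * fG1 i q)) (fun q => wE i q * (- N * fG2 i q)) p.
Proof.
  intros (H & _). apply (C1p_comp exp exp _ _ _ p).
  - apply is_derive_exp.
  - apply (ex_derive_continuous (V := R_NormedModule)). eexists; apply is_derive_exp.
  - apply C1p_scal, H.
Qed.

Lemma C1p_fields (p : pt) : (forall i, In i l -> patch_C1 p i) ->
  C1p wZ wZx wZy p /\ C1p wA wAx wAy p /\ C1p wB wBx wBy p.
Proof.
  intros H. split; [|split].
  - apply (C1p_lsum wE). intros i Hi. apply C1p_wE, H, Hi.
  - apply (C1p_lsum (fun i q => wE i q * fT i q)). intros i Hi. apply C1p_mult; [apply C1p_wE, H, Hi|apply (H i Hi)].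
  - apply (C1p_lsum (fun i q => wE i q * fS i q)). intros i Hi. apply C1p_mult; [apply C1p_wE, H, Hi|apply (H i Hi)].
Qed.

Lemma C1p_fld (A Ax Ay : pt -> R) (p : pt) : l <> nil -> (forall i, In i l -> patch_C1 p i) ->
  C1p u ux uy p -> C1p A Ax Ay p ->
  C1p (fld A) (fldd A Ax ux wZx) (fldd A Ay uy wZy) p.
Proof.
  intros Hl H Hu HA. destruct (C1p_fields p H) as (HZ & _).
  apply (C1p_div (fun q => u q * u q * A q) _ _ wZ wZx wZy).
  - pose proof (wZ_pos p Hl). lra.
  - apply (C1p_mult (fun q => u q * u q)); [|assumption]. apply C1p_mult; assumption.
  - assumption.
Qed.

Lemma C1p_fld_zero (A Ax Ay : pt -> R) (p : pt) :
  locally p (fun q => u q = 0 /\ ux q = 0 /\ uy q = 0) ->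
  C1p (fld A) (fldd A Ax ux wZx) (fldd A Ay uy wZy) p.
Proof.
  intros H. apply C1p_zero. revert H. apply filter_imp. intros q (E1 & E2 & E3).
  unfold fld, fldd. rewrite E1, E2, E3. unfold Rdiv. repeat split; ring.
Qed.

(* Completing the square in [sum w_i |grad u + u T_i|^2]. *)
Lemma softmin_barta (p : pt) (c e D k : R) : l <> nil -> 0 <= c -> 0 <= N -> 0 < e -> 0 < D ->
  (forall i, In i l -> 0 < fD i p /\ c / fD i p ^ 2 <= fTx i p + fSy i p - fT i p ^ 2 - fS i p ^ 2) ->
  (forall i j, In i l -> In j l ->
     wE i p * wE j p * ((fG1 i p - fG1 j p) * (fT i p - fT j p) + (fG2 i p - fG2 j p) * (fS i p - fS j p)) <= wZ p ^ 2 * k) ->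
  (exists i, In i l /\ fD i p <= D) ->
  u p ^ 2 * (c * (1 - INR (length l) * exp (- N * e)) / (D + e) ^ 2 - N * k * INR (length l) ^ 2) <=
  ux p ^ 2 + uy p ^ 2 + fldd wA wAx ux wZx p + fldd wB wBy uy wZy p.
Proof.
  intros Hl Hc HN He HD Hdiv Hcross [j [Hj HjD]].
  pose proof (wZ_pos p Hl) as HZ. set (n := INR (length l)).
  assert (Hn : 0 <= n) by apply pos_INR.
  pose proof (lsum_covariance (fun i => wE i p) (fun i => fG1 i p) (fun i => fG2 i p) (fun i => fT i p) (fun i => fS i p) l
     (wZ p) (wZ p ^ 2 * k) eq_refl Hcross) as Hcov. cbv beta in Hcov. fold n in Hcov.
  fold (wA p) (wB p) in Hcov.
  set (GT := lsum (fun i => wE i p * (fG1 i p * fT i p + fG2 i p * fS i p)) l) in *.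
  set (A1 := lsum (fun i => wE i p * fG1 i p) l) in *. set (A2 := lsum (fun i => wE i p * fG2 i p) l) in *.
  set (Q := lsum (fun i => wE i p * (fT i p ^ 2 + fS i p ^ 2)) l).
  set (V := lsum (fun i => wE i p * (fTx i p + fSy i p)) l).
  assert (EZx : wZx p = - N * A1).
  { unfold wZx, A1. rewrite <- lsum_scal. apply lsum_ext. intros; ring. }
  assert (EZy : wZy p = - N * A2).
  { unfold wZy, A2. rewrite <- lsum_scal. apply lsum_ext. intros; ring. }
  assert (EAB : wAx p + wBy p = V - N * GT).
  { unfold wAx, wBy, V, GT. rewrite <- lsum_plus. replace (N * _) with (- (- N * lsum (fun i => wE i p * (fG1 i p * fT i p + fG2 i p * fS i p)) l)) by ring.
    rewrite <- lsum_scal. unfold Rminus. rewrite Ropp_involutive, <- lsum_plus. apply lsum_ext. intros; ring. }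
  assert (Hsq : 0 <= wZ p * (ux p ^ 2 + uy p ^ 2) + 2 * u p * (ux p * wA p + uy p * wB p) + u p ^ 2 * Q).
  { apply Rle_trans with (lsum (fun i => wE i p * ((ux p + u p * fT i p) ^ 2 + (uy p + u p * fS i p) ^ 2)) l).
    - rewrite <- (Rmult_0_l (INR (length l))), <- lsum_const. apply lsum_le. intros i Hi.
      pose proof (wE_pos i p). pose proof (pow2_ge_0 (ux p + u p * fT i p)). pose proof (pow2_ge_0 (uy p + u p * fS i p)). nra.
    - right. unfold wZ, wA, wB, Q.
      rewrite (lsum_ext _ (fun i => (ux p ^ 2 + uy p ^ 2) * wE i p + (2 * u p * ux p * (wE i p * fT i p)
        + (2 * u p * uy p * (wE i p * fS i p) + u p ^ 2 * (wE i p * (fT i p ^ 2 + fS i p ^ 2))))) l) by (intros; ring).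
      rewrite !lsum_plus, !lsum_scal. ring. }
  (* Patches with [fD <= D + e] contribute at least [c / (D + e) ^ 2]. Any other patch exceeds the
     distance of patch [j] by more than [e], so its weight is at most [exp (- N * e) * wZ] and it
     may be dropped at that cost. *)
  assert (HVQ : c * (wZ p * (1 - n * exp (- N * e))) / (D + e) ^ 2 <= V - Q).
  { apply Rle_trans with (lsum (fun i => c / (D + e) ^ 2 * (wE i p - exp (- N * e) * wZ p)) l).
    - right. rewrite lsum_scal.
      rewrite (lsum_ext (fun i => wE i p - exp (- N * e) * wZ p) (fun i => wE i p + - (exp (- N * e) * wZ p))) by (intros; ring).
      rewrite lsum_plus, lsum_const. fold (wZ p) n. field. lra.
    - unfold V, Q. replace (lsum (fun i => wE i p * (fTx i p + fSy i p)) l - lsum (fun i => wE i p * (fT i p ^ 2 + fS i p ^ 2)) l)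
        with (lsum (fun i => wE i p * (fTx i p + fSy i p) + (- 1) * (wE i p * (fT i p ^ 2 + fS i p ^ 2))) l)
        by (rewrite lsum_plus, lsum_scal; ring).
      apply lsum_le. intros i Hi. destruct (Hdiv i Hi) as [Hdp Hd]. pose proof (wE_pos i p) as Hw.
      apply Rle_trans with (wE i p * (c / fD i p ^ 2)); [|nra].
      assert (Hc2 : 0 <= c / (D + e) ^ 2) by (apply Rdiv_le_0_compat; [assumption|apply pow_lt; lra]).
      destruct (Rle_or_lt (fD i p) (D + e)) as [Hle|Hlt].
      + assert (c / (D + e) ^ 2 <= c / fD i p ^ 2).
        { unfold Rdiv. apply Rmult_le_compat_l; [assumption|]. apply Rinv_le_contravar; [apply pow_lt, Hdp|]. nra. }
        pose proof (exp_pos (- N * e)). assert (0 <= exp (- N * e) * wZ p) by nra. nra.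
      + assert (wE i p <= exp (- N * e) * wZ p).
        { apply Rle_trans with (exp (- N * e) * wE j p).
          - unfold wE. rewrite <- exp_plus. apply exp_mono. nra.
          - apply Rmult_le_compat_l; [apply Rlt_le, exp_pos|apply wZ_ge, Hj]. }
        assert (0 <= c / fD i p ^ 2) by (apply Rdiv_le_0_compat; [assumption|apply pow_lt; lra]). nra. }
  assert (Hsum : ux p ^ 2 + uy p ^ 2 + fldd wA wAx ux wZx p + fldd wB wBy uy wZy p =
    (wZ p * (ux p ^ 2 + uy p ^ 2) + 2 * u p * (ux p * wA p + uy p * wB p) + u p ^ 2 * Q) / wZ p
    + u p ^ 2 * ((V - Q) / wZ p - N * (wZ p * GT - A1 * wA p - A2 * wB p) / wZ p ^ 2)).
  { assert (EV : V = wAx p + wBy p + N * GT) by lra. unfold fldd. rewrite EZx, EZy, EV. field. lra. }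
  rewrite Hsum.
  assert (H1 : c * (1 - n * exp (- N * e)) / (D + e) ^ 2 <= (V - Q) / wZ p).
  { apply (proj1 (Rle_div_r _ _ _ HZ)). eapply Rle_trans; [|exact HVQ]. right. field. lra. }
  assert (Hk : 0 <= k).
  { specialize (Hcross j j Hj Hj). assert (0 < wZ p ^ 2) by (apply pow_lt, HZ). nra. }
  assert (H2 : N * (wZ p * GT - A1 * wA p - A2 * wB p) / wZ p ^ 2 <= N * k * n ^ 2).
  { apply Rle_div_l; [apply pow_lt, HZ|]. 
    assert (wZ p * GT - A1 * wA p - A2 * wB p <= k * n ^ 2 * wZ p ^ 2).
    { pose proof (Rmult_le_pos _ _ (Rmult_le_pos _ _ Hk (pow2_ge_0 n)) (pow2_ge_0 (wZ p))). lra. }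
    replace (N * k * n ^ 2 * wZ p ^ 2) with (N * (k * n ^ 2 * wZ p ^ 2)) by ring. apply Rmult_le_compat_l; assumption. }
  assert (H3 : 0 <= (wZ p * (ux p ^ 2 + uy p ^ 2) + 2 * u p * (ux p * wA p + uy p * wB p) + u p ^ 2 * Q) / wZ p)
    by (apply Rdiv_le_0_compat; assumption).
  pose proof (pow2_ge_0 (u p)). nra.
Qed.
End Softmin.

(** * Supports, uniform bounds and the weight near the boundary *)

Lemma closure2_closed (S : pt -> Prop) (p : pt) : closure2 (closure2 S) p -> closure2 S p.
Proof.
  intros H e He. destruct (H (e / 2)) as [q [Hq H1]]; [lra|].
  destruct (Hq (e / 2)) as [w [Hw H2]]; [lra|]. exists w. split; [assumption|].
  pose proof (pdist_tri p q w). lra.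
Qed.

Lemma closure2_incl (S : pt -> Prop) (p : pt) : S p -> closure2 S p.
Proof. intros H e He. exists p. rewrite pdist_refl. split; [assumption|lra]. Qed.

Lemma off_support (u ux uy : pt -> R) (p : pt) : (forall p, C1p u ux uy p) -> ~ support u p ->
  locally p (fun q => u q = 0 /\ ux q = 0 /\ uy q = 0).
Proof.
  intros Hu Hp.
  assert (exists e, 0 < e /\ forall q, pdist p q < e -> u q = 0) as [e [He H0]].
  { apply NNPP. intros Hn. apply Hp. intros e He. apply NNPP. intros Hn'. apply Hn.
    exists e. split; [lra|]. intros q Hq. apply NNPP. intros Hq0. apply Hn'. exists q. split; assumption. }
  apply locally_pdist. exists e. split; [assumption|]. intros q Hq.
  assert (L : locally q (fun w => u w = 0)).
  { apply locally_pdist. exists (e - pdist p q). split; [lra|]. intros w Hw. apply H0.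
    pose proof (pdist_tri p q w). lra. }
  destruct (locally_lines q _ L) as [L1 L2]. destruct (Hu q) as (D1 & D2 & _).
  split; [apply H0, Hq|]. split.
  - rewrite <- (is_derive_unique _ _ _ D1). rewrite (Derive_ext_loc _ (fun _ => 0)); [apply Derive_const|exact L1].
  - rewrite <- (is_derive_unique _ _ _ D2). rewrite (Derive_ext_loc _ (fun _ => 0)); [apply Derive_const|exact L2].
Qed.

Lemma bounded_outside (u : pt -> R) : bounded2 (support u) ->
  exists L, 0 < L /\ forall x y, L <= Rabs x \/ L <= Rabs y -> ~ support u (x, y).
Proof.
  intros [M HM]. exists (Rabs M + 1). split; [pose proof (Rabs_pos M); lra|].
  intros x y Hxy Hs. specialize (HM _ Hs). destruct (pnorm_bounds (x, y)) as [B1 B2]. simpl in B1, B2.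
  pose proof (Rle_abs M). destruct Hxy; lra.
Qed.

Lemma unif_cont (f : pt -> R) (L : R) : 0 < L -> cts f -> outside0 L f ->
  forall eps, 0 < eps -> exists d, 0 < d /\ forall p q, pdist p q < d -> Rabs (f q - f p) < eps.
Proof.
  intros HL Hc H0 eps Heps.
  destruct (uniform_continuity_2d (fun x y => f (x, y)) (- (L + 1)) (L + 1) (- (L + 1)) (L + 1)) with (eps := mkposreal _ Heps) as [d Hd].
  { intros x y _ _. apply continuity_2d_cts, Hc. }
  exists (Rmin d 1). split; [apply Rmin_pos; [apply cond_pos|lra]|].
  intros [x y] [s t] Hpq. pose proof (Rmin_l d 1). pose proof (Rmin_r d 1).
  destruct (pdist_bounds (x, y) (s, t)) as (B1 & B2 & _). simpl in B1, B2.
  destruct (classic (Rabs x <= L + 1 /\ Rabs y <= L + 1 /\ Rabs s <= L + 1 /\ Rabs t <= L + 1)) as [(C1 & C2 & C3 & C4)|Hn].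
  - apply Rabs_le_between in C1, C2, C3, C4. apply (Hd x y s t); lra.
  - assert (T1 := Rabs_triang_inv s x). assert (T2 := Rabs_triang_inv t y).
    assert (T3 := Rabs_triang_inv x s). assert (T4 := Rabs_triang_inv y t).
    rewrite (Rabs_minus_sym x s) in T3. rewrite (Rabs_minus_sym y t) in T4.
    assert (E : (L <= Rabs x \/ L <= Rabs y) /\ (L <= Rabs s \/ L <= Rabs t)).
    { destruct (Rle_or_lt (Rabs x) (L + 1)); [|lra]. destruct (Rle_or_lt (Rabs y) (L + 1)); [|lra].
      destruct (Rle_or_lt (Rabs s) (L + 1)); [|lra]. destruct (Rle_or_lt (Rabs t) (L + 1)); [|lra]. tauto. }
    rewrite (H0 x y), (H0 s t) by apply E. rewrite Rminus_0_r, Rabs_R0. assumption.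
Qed.

Lemma outside0_bounded (f : pt -> R) (L : R) : outside0 L f -> bounded2 (support f).
Proof.
  intros H0. exists (2 * (L + 1)). intros p Hp. destruct (Hp 1 Rlt_0_1) as [[s t] [Hq Hpq]].
  assert (Hst : Rabs s < L /\ Rabs t < L) by (split; apply Rnot_le_lt; intros H; apply Hq, H0; tauto).
  destruct (pdist_bounds p (s, t)) as (B1 & B2 & _). destruct (pdist_bounds (0, 0) p) as (_ & _ & B).
  cbn [fst snd] in *. rewrite !Rminus_0_r in B.
  replace (pnorm p) with (pdist (0, 0) p) by (unfold pnorm, pdist; simpl; f_equal; ring).
  pose proof (Rabs_triang_inv (fst p) s). pose proof (Rabs_triang_inv (snd p) t).
  rewrite (Rabs_minus_sym s) in B1. rewrite (Rabs_minus_sym t) in B2. lra.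
Qed.

Lemma compact_bound (f : pt -> R) (L : R) : cts f -> outside0 L f ->
  exists U, 0 <= U /\ forall p, f p ^ 2 <= U.
Proof.
  intros Hc H0.
  destruct (compact_ind (support f) (fun S => exists U, 0 <= U /\ forall p, S p -> f p ^ 2 <= U)) as [U [HU HUp]].
  - apply (outside0_bounded f L H0).
  - intros p. apply closure2_closed.
  - exists 0. split; [lra|intros p []].
  - intros S S' HS [U [HU H]]. exists U. split; [assumption|]. intros p Hp. apply H, HS, Hp.
  - intros S S' [U [HU H]] [U' [HU' H']]. exists (Rmax U U'). pose proof (Rmax_l U U'). pose proof (Rmax_r U U').
    split; [lra|]. intros p [Hp|Hp]; [specialize (H p Hp)|specialize (H' p Hp)]; lra.
  - intros z _. destruct (proj1 (cts_pdist f z) (Hc z) 1 Rlt_0_1) as [d [Hd Hz]]. exists d. split; [assumption|].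
    exists ((Rabs (f z) + 1) ^ 2). split; [apply pow2_ge_0|]. intros p [_ Hp]. specialize (Hz p Hp).
    rewrite <- pow2_abs. apply pow_incr. pose proof (Rabs_triang_inv (f p) (f z)). split; [apply Rabs_pos|lra].
  - exists U. split; [assumption|]. intros p. destruct (Req_dec (f p) 0) as [->|Hp]; [lra|].
    apply HUp, closure2_incl, Hp.
Qed.

Lemma inv_sq_diff (d s : R) : 0 < d -> 0 <= s -> / d ^ 2 - / (d + s) ^ 2 <= 2 * s / d ^ 3.
Proof.
  intros Hd Hs.
  replace (2 * s / d ^ 3) with (/ d ^ 2 - / (d + s) ^ 2 + s ^ 2 * (3 * d + 2 * s) / (d ^ 3 * (d + s) ^ 2)).
  - assert (0 <= s ^ 2 * (3 * d + 2 * s) / (d ^ 3 * (d + s) ^ 2)); [|lra].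
    apply Rdiv_le_0_compat.
    + apply Rmult_le_pos; [apply pow2_ge_0|lra].
    + apply Rmult_lt_0_compat; apply pow_lt; lra.
  - field. lra.
Qed.

(* [K] need not be open, so the support of [u] may touch the boundary; there [u = o(bdist)]. *)
Lemma weight_shift (Om : pt -> Prop) (u ux uy : pt -> R) (c L : R) : (exists q, boundary2 Om q) ->
  0 <= c -> 0 < L -> (forall p, C1p u ux uy p) -> outside0 L u -> outside0 L ux -> outside0 L uy ->
  (forall p, support u p -> Om p) ->
  forall eta, 0 < eta -> exists e, 0 < e /\
    forall p, c * (u p ^ 2 / bdist Om p ^ 2) <= c * (u p ^ 2 / (bdist Om p + 5 * e) ^ 2) + eta.
Proof.
  intros Hne Hc HL Hu Ou Oux Ouy HO eta Heta.
  destruct (C1p_cts _ _ _ Hu) as (Cu & Cx & Cy).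
  destruct (compact_bound u L Cu Ou) as [U [HU HuU]].
  (* A bound on the partial derivatives near points outside [Om]. It will give
     [u^2 <= 16 * tau^2 * d^2] close to the boundary, hence an error of at most [eta]. *)
  set (tau := sqrt (eta / (16 * (c + 1)))).
  assert (Htau0 : 0 < eta / (16 * (c + 1))) by (apply Rdiv_lt_0_compat; lra).
  assert (Htau : 0 < tau) by (apply sqrt_lt_R0, Htau0).
  assert (Htau2 : 16 * (c + 1) * tau ^ 2 = eta) by (unfold tau; rewrite pow2_sqrt by lra; field; lra).
  destruct (unif_cont ux L HL Cx Oux tau Htau) as [d1 [Hd1 D1]].
  destruct (unif_cont uy L HL Cy Ouy tau Htau) as [d2 [Hd2 D2]].
  set (rho := Rmin d1 d2 / 4).
  assert (Hrho : 0 < rho /\ 4 * rho <= d1 /\ 4 * rho <= d2).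
  { pose proof (Rmin_l d1 d2). pose proof (Rmin_r d1 d2). assert (0 < Rmin d1 d2) by (apply Rmin_pos; assumption). unfold rho. lra. }
  destruct Hrho as (Hrho & Hr1 & Hr2).
  set (e := eta * rho ^ 3 / (10 * (c * U + 1))).
  assert (HcU : 0 <= c * U) by (apply Rmult_le_pos; assumption).
  assert (Hr3 : 0 < rho ^ 3) by (apply pow_lt, Hrho).
  assert (He : 0 < e) by (apply Rdiv_lt_0_compat; [apply Rmult_lt_0_compat; assumption|lra]).
  exists e. split; [assumption|]. intros p. set (d := bdist Om p).
  assert (Hd : 0 <= d) by (apply bdist_nonneg, Hne).
  assert (Hu2 : 0 <= u p ^ 2) by apply pow2_ge_0.
  assert (Hrest : 0 <= c * (u p ^ 2 / (d + 5 * e) ^ 2)).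
  { apply Rmult_le_pos; [assumption|]. apply Rdiv_le_0_compat; [assumption|apply pow_lt; lra]. }
  destruct (Rlt_or_le d rho) as [Hlt|Hge].
  - assert (Hz : forall z, ~ Om z -> u z = 0 /\ ux z = 0 /\ uy z = 0).
    { intros z Hz. apply (locally_singleton _ _ (off_support u ux uy z Hu (fun H => Hz (HO z H)))). }
    destruct (Rle_lt_or_eq_dec 0 d Hd) as [Hpos|Hzero].
    + destruct (bdist_out Om Hne p (2 * d)) as [z [HzO Hpz]]; [fold d; lra|].
      destruct (Hz z HzO) as (Z0 & Z1 & Z2).
      (* Mean value theorem along the two sides of an axis-parallel path from [z], where [u] and its
         gradient vanish; each side has length at most [2 * d]. *)
      assert (Hup : Rabs (u p) <= 4 * tau * d).
      { destruct p as [x y], z as [s t].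
        destruct (pdist_bounds (s, t) (x, y)) as (B1 & B2 & _). simpl in B1, B2. rewrite pdist_sym in B1, B2.
        destruct (MVT_gen (fun k => u (k, y)) s x (fun k => ux (k, y))) as [xi [Hxi E1]].
        { intros k _. apply (Hu (k, y)). }
        { intros k _. apply continuity_pt_filterlim. apply (cts_fst_slice u k y Cu). }
        destruct (MVT_gen (fun k => u (s, k)) t y (fun k => uy (s, k))) as [yi [Hyi E2]].
        { intros k _. apply (Hu (s, k)). }
        { intros k _. apply continuity_pt_filterlim. apply (cts_snd_slice u s k Cu). }
        assert (Bx : Rabs (xi - s) <= Rabs (x - s)) by (revert Hxi; unfold Rmin, Rmax, Rabs; destruct (Rle_dec s x); repeat destruct Rcase_abs; lra).
        assert (By : Rabs (yi - t) <= Rabs (y - t)) by (revert Hyi; unfold Rmin, Rmax, Rabs; destruct (Rle_dec t y); repeat destruct Rcase_abs; lra).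
        assert (Ux : Rabs (ux (xi, y)) < tau).
        { rewrite <- (Rminus_0_r (ux (xi, y))), <- Z1. apply D1.
          destruct (pdist_bounds (s, t) (xi, y)) as (_ & _ & B). simpl in B. lra. }
        assert (Uy : Rabs (uy (s, yi)) < tau).
        { rewrite <- (Rminus_0_r (uy (s, yi))), <- Z2. apply D2.
          destruct (pdist_bounds (s, t) (s, yi)) as (_ & _ & B). simpl in B. rewrite Rminus_diag, Rabs_R0 in B. lra. }
        replace (u (x, y)) with (ux (xi, y) * (x - s) + uy (s, yi) * (y - t)) by (rewrite <- E1, <- E2, Z0; ring).
        eapply Rle_trans; [apply Rabs_triang|]. rewrite !Rabs_mult.
        pose proof (Rabs_pos (x - s)). pose proof (Rabs_pos (y - t)).
        pose proof (Rabs_pos (ux (xi, y))). pose proof (Rabs_pos (uy (s, yi))).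
        assert (Rabs (ux (xi, y)) * Rabs (x - s) <= tau * (2 * d)) by (apply Rmult_le_compat; lra).
        assert (Rabs (uy (s, yi)) * Rabs (y - t) <= tau * (2 * d)) by (apply Rmult_le_compat; lra). lra. }
      assert (Hb : u p ^ 2 / d ^ 2 <= 16 * tau ^ 2).
      { apply Rle_div_l; [apply pow_lt, Hpos|]. rewrite <- pow2_abs.
        replace (16 * tau ^ 2 * d ^ 2) with ((4 * tau * d) ^ 2) by ring. apply pow_incr. split; [apply Rabs_pos|assumption]. }
      assert (c * (u p ^ 2 / d ^ 2) <= c * (16 * tau ^ 2)) by (apply Rmult_le_compat_l; assumption).
      pose proof (pow2_ge_0 tau). nra.
    (* On the boundary itself the quotient divides by zero; continuity forces [u p = 0], so the
       product is 0 whatever the inverse is. *)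
    + assert (Hup : u p = 0).
      { apply NNPP. intros Hn. pose proof (Rabs_pos_lt _ Hn) as Hab.
        destruct (proj1 (cts_pdist u p) (Cu p) (Rabs (u p)) Hab) as [e' [He' Hc']].
        destruct (bdist_out Om Hne p e') as [z [HzO Hpz]]; [fold d; lra|].
        destruct (Hz z HzO) as (Z0 & _). specialize (Hc' z Hpz). rewrite Z0 in Hc'.
        rewrite Rminus_0_l, Rabs_Ropp in Hc'. lra. }
      rewrite Hup in *. unfold Rdiv in *. rewrite pow_i in * by lia. lra.
  - assert (Hdp : 0 < d) by lra.
    pose proof (inv_sq_diff d (5 * e) Hdp ltac:(lra)) as Hdiff.
    assert (Hd3 : 2 * (5 * e) / d ^ 3 <= 10 * e / rho ^ 3).
    { unfold Rdiv. replace (2 * (5 * e)) with (10 * e) by ring. apply Rmult_le_compat_l; [lra|].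
      apply Rinv_le_contravar; [assumption|]. apply pow_incr. lra. }
    assert (He3 : (c * U + 1) * (10 * e / rho ^ 3) = eta) by (unfold e; field; split; lra).
    assert (H1 : u p ^ 2 * (/ d ^ 2 - / (d + 5 * e) ^ 2) <= U * (10 * e / rho ^ 3)).
    { apply Rle_trans with (u p ^ 2 * (10 * e / rho ^ 3)).
      - apply Rmult_le_compat_l; lra.
      - apply Rmult_le_compat_r; [apply Rdiv_le_0_compat; lra|apply HuU]. }
    assert (Hq : 0 <= 10 * e / rho ^ 3) by (apply Rdiv_le_0_compat; lra).
    unfold Rdiv at 1 2. 
    assert (c * (u p ^ 2 * (/ d ^ 2 - / (d + 5 * e) ^ 2)) <= c * (U * (10 * e / rho ^ 3))) by (apply Rmult_le_compat_l; assumption).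
    lra.
Qed.

(** [cr] is minus the interaction of the sector with a half plane. If [x >= nu] or [x >= b], the sum
    of the sines is nonnegative and so are all terms. Otherwise the only negative term is
    [- F / r * sin w] with [w = nu - x] and [F <= 1 / 2]; when [l <= 2 * al * r] it is beaten by
    [al / l * (1 + cos w)], because [al / l >= 1 / (2 * r)] and [sin w <= 1 + cos w]. The
    unconditional bound serves where [l > 2 * al * r], since the weights are then exponentially
    small. *)
Lemma cross_sign_half (b x nu F r al l : R) : 0 < b <= PI / 2 -> 0 <= x < b + PI / 2 -> - b <= nu <= b ->
  0 <= F -> (x <= b -> F <= 1 / 2) -> 1 / 2 < al -> 0 < r -> 0 < l ->
  let cr := F / r * (sin (x - clamp b x) + sin (x - nu)) + al / l * (1 + cos (clamp b x - nu)) in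
  (l <= 2 * al * r -> 0 <= cr) /\ - / (2 * r) <= cr.
Proof.
  intros Hb Hx Hnu HF HFb Hal Hr Hl cr. pose proof PI_RGT_0.
  assert (HFr : 0 <= F / r) by (apply Rdiv_le_0_compat; assumption).
  assert (Hal' : 0 < al / l) by (apply Rdiv_lt_0_compat; lra).
  assert (Hir : 0 < / (2 * r)) by (apply Rinv_0_lt_compat; lra).
  assert (good : 0 <= sin (x - clamp b x) + sin (x - nu) -> (l <= 2 * al * r -> 0 <= cr) /\ - / (2 * r) <= cr).
  { intros Hs. pose proof (COS_bound (clamp b x - nu)).
    assert (0 <= F / r * (sin (x - clamp b x) + sin (x - nu))) by (apply Rmult_le_pos; assumption).
    assert (0 <= al / l * (1 + cos (clamp b x - nu))) by (apply Rmult_le_pos; lra).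
    unfold cr. lra. }
  destruct (Rle_or_lt b x) as [H1|H1].
  - apply good. rewrite clamp_hi by lra. rewrite form3.
    apply Rmult_le_pos; [apply Rmult_le_pos; [lra|]|].
    + apply cos_ge_0; lra.
    + apply sin_ge_0; lra.
  - destruct (Rle_or_lt nu x) as [H2|H2].
    + apply good. rewrite clamp_mid, Rminus_diag, sin_0 by lra. assert (0 <= sin (x - nu)) by (apply sin_ge_0; lra). lra.
    + unfold cr. rewrite clamp_mid, Rminus_diag, sin_0 by lra.
      set (w := nu - x). assert (Hw : 0 < w <= PI / 2) by (unfold w; lra).
      replace (x - nu) with (- w) by (unfold w; ring). rewrite sin_neg, cos_neg.
      assert (0 <= cos w) by (apply cos_ge_0; lra).
      assert (0 <= sin w) by (apply sin_ge_0; lra).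
      pose proof (SIN_bound w).
      assert (HF2 : F / r <= / (2 * r)).
      { apply Rle_div_l; [assumption|]. replace (/ (2 * r) * r) with (1 / 2) by (field; lra). apply HFb. lra. }
      assert (E1 : F / r * sin w <= / (2 * r) * sin w) by (apply Rmult_le_compat_r; assumption).
      assert (E2 : / (2 * r) * sin w <= / (2 * r) * 1) by (apply Rmult_le_compat_l; lra).
      assert (E3 : 0 <= al / l * cos w) by (apply Rmult_le_pos; lra).
      split; [intros Hlr|nra].
      assert (/ (2 * r) <= al / l).
      { apply Rle_div_r; [lra|]. replace (/ (2 * r) * l) with (l / (2 * r)) by (field; lra).
        apply Rle_div_l; lra. }
      nra.
Qed.

(** Reflection in the axis changes the signs of [x], [nu] and [F] and leaves [cr] unchanged. *)
Lemma cross_sign (b x nu F r al l : R) : 0 < b <= PI / 2 -> Rabs x < b + PI / 2 -> - b <= nu <= b ->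
  (0 <= x -> 0 <= F) -> (x <= 0 -> F <= 0) -> (Rabs x <= b -> Rabs F <= 1 / 2) -> 1 / 2 < al -> 0 < r -> 0 < l ->
  let cr := F / r * (sin (x - clamp b x) + sin (x - nu)) + al / l * (1 + cos (clamp b x - nu)) in
  (l <= 2 * al * r -> 0 <= cr) /\ - / (2 * r) <= cr.
Proof.
  intros Hb Hx Hnu HF1 HF2 HFb Hal Hr Hl. apply Rabs_def2 in Hx.
  destruct (Rle_or_lt 0 x) as [H|H].
  - apply (cross_sign_half b x nu F r al l Hb (conj H (proj1 Hx)) Hnu (HF1 H)); try assumption.
    intros Hxb. eapply Rle_trans; [apply Rle_abs|]. apply HFb. rewrite Rabs_pos_eq; lra.
  - pose proof (cross_sign_half b (- x) (- nu) (- F) r al l Hb ltac:(lra) ltac:(lra)) as Hc.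
    rewrite clamp_opp in Hc by lra.
    replace (- F / r * (sin (- x - - clamp b x) + sin (- x - - nu)) + al / l * (1 + cos (- clamp b x - - nu)))
      with (F / r * (sin (x - clamp b x) + sin (x - nu)) + al / l * (1 + cos (clamp b x - nu))) in Hc.
    + apply Hc; try assumption; [specialize (HF2 ltac:(lra)); lra|].
      intros Hxb. specialize (HFb ltac:(rewrite Rabs_left; lra)).
      apply Rabs_le_between in HFb. lra.
    + replace (- x - - clamp b x) with (- (x - clamp b x)) by ring.
      replace (- x - - nu) with (- (x - nu)) by ring.
      replace (- clamp b x - - nu) with (- (clamp b x - nu)) by ring.
      rewrite !sin_neg, cos_neg. field. lra.
Qed.

Lemma exp_neg_bound (t : R) : 0 < t -> exp (- t) <= 4 / t ^ 2.
Proof.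
  intros Ht. rewrite exp_Ropp. unfold Rdiv.
  replace (4 * / t ^ 2) with (/ (t / 2) ^ 2) by (field; lra).
  apply Rinv_le_contravar; [apply pow_lt; lra|].
  replace t with (t / 2 + t / 2) at 2 by field. rewrite exp_plus.
  pose proof (exp_ineq1_le (t / 2)). nra.
Qed.

(** The interaction error carries a factor [N]; quadratic decay of the exponential still leaves
    [N * exp (- N * s)] of order [1 / N]. *)
Lemma large_N (P Q s eta : R) : 0 <= P -> 0 <= Q -> 0 < s -> 0 < eta ->
  exists N, 0 < N /\ P * exp (- N * s) + Q * N * exp (- N * s) <= eta.
Proof.
  intros HP HQ Hs He.
  set (N := 1 + 4 * (P + Q) / (s ^ 2 * eta)).
  assert (Hs2 : 0 < s ^ 2) by (apply pow_lt, Hs).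
  assert (H1 : 0 <= 4 * (P + Q) / (s ^ 2 * eta)) by (apply Rdiv_le_0_compat; nra).
  assert (HN : 1 <= N) by (unfold N; lra).
  exists N. split; [lra|].
  pose proof (exp_neg_bound (N * s) ltac:(nra)) as B. rewrite <- Ropp_mult_distr_l.
  assert (B' : exp (- (N * s)) <= 4 / (N * s ^ 2) * / N).
  { eapply Rle_trans; [exact B|]. right. field. lra. }
  pose proof (exp_pos (- (N * s))) as Hp.
  assert (HNi : 0 < / N <= 1).
  { split; [apply Rinv_0_lt_compat; lra|]. rewrite <- Rinv_1. apply Rinv_le_contravar; lra. }
  apply Rle_trans with ((P + Q) * (N * exp (- (N * s)))).
  - assert (P * exp (- (N * s)) <= P * (N * exp (- (N * s)))) by (apply Rmult_le_compat_l; nra). lra.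
  - apply Rle_trans with ((P + Q) * (4 / (N * s ^ 2))).
    + apply Rmult_le_compat_l; [lra|]. apply Rle_trans with (N * (4 / (N * s ^ 2) * / N)).
      * apply Rmult_le_compat_l; lra.
      * right. field. lra.
    + replace ((P + Q) * (4 / (N * s ^ 2))) with (4 * (P + Q) / s ^ 2 / N) by (field; lra).
      apply Rle_div_l; [lra|]. 
      assert (E : 4 * (P + Q) / s ^ 2 = eta * (N - 1)) by (unfold N; field; lra). rewrite E. nra.
Qed.

(** * The sector patch, the half-plane patches and their interactions *)

Section Patches.
Context (v : pt) (g b c al e : R) (X : R) (psi psi1 : R -> R).

Let F := ricc psi psi1.
Let dF := fun x => F x ^ 2 + pot c b X x.
Let dx (q : pt) : R := fst q - fst v.
Let dy (q : pt) : R := snd q - snd v.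
Let r2 (q : pt) : R := rad v g q ^ 2.

(* [- grad psi / psi] for the ground state [psi] in the angle, and [- al grad l / l] for a half plane. *)
Definition sector_patch : patch :=
  Patch (d0 v g b) (nx v g b) (ny v g b)
    (fun q => F (ang v g q) * (- dy q / r2 q))
    (fun q => dF (ang v g q) * (- dy q / r2 q) * (- dy q / r2 q) + F (ang v g q) * (2 * dx q * dy q / r2 q ^ 2))
    (fun q => dF (ang v g q) * (dx q / r2 q) * (- dy q / r2 q) + F (ang v g q) * (- 1 / r2 q + 2 * dy q ^ 2 / r2 q ^ 2))
    (fun q => F (ang v g q) * (dx q / r2 q))
    (fun q => dF (ang v g q) * (- dy q / r2 q) * (dx q / r2 q) + F (ang v g q) * (1 / r2 q - 2 * dx q ^ 2 / r2 q ^ 2))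
    (fun q => dF (ang v g q) * (dx q / r2 q) * (dx q / r2 q) + F (ang v g q) * (- (2 * dx q * dy q) / r2 q ^ 2)).

(** The shift by [e] keeps the denominators positive on the support of the test function, which may
    touch the edge of the half plane. *)
Definition halfplane_patch (h : hp) : patch :=
  Patch (fun q => ell h q + e) (fun _ => m1 h) (fun _ => m2 h)
    (fun q => - al * m1 h / (ell h q + e)) (fun q => al * m1 h ^ 2 / (ell h q + e) ^ 2) (fun q => al * m1 h * m2 h / (ell h q + e) ^ 2)
    (fun q => - al * m2 h / (ell h q + e)) (fun q => al * m1 h * m2 h / (ell h q + e) ^ 2) (fun q => al * m2 h ^ 2 / (ell h q + e) ^ 2).

Lemma C1p_ell (h : hp) (p : pt) : C1p (fun q => ell h q + e) (fun _ => m1 h) (fun _ => m2 h) p.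
Proof.
  eapply C1p_ext; [| | |apply (C1p_plus _ _ _ _ _ _ p
    (C1p_plus _ _ _ _ _ _ p (C1p_scal (m1 h) _ _ _ p (C1p_fst p)) (C1p_scal (m2 h) _ _ _ p (C1p_snd p)))
    (C1p_const (e - snd h) p))]; intros q; unfold ell; simpl; ring.
Qed.

Lemma halfplane_patch_C1 (h : hp) (p : pt) : 0 < ell h p + e -> patch_C1 p (halfplane_patch h).
Proof.
  intros Hp. assert (Hne : ell h p + e <> 0) by lra. pose proof (C1p_ell h p) as HE.
  split; [exact HE|]. split.
  - eapply C1p_ext; [| | |apply (C1p_div _ _ _ _ _ _ p Hne (C1p_const (- al * m1 h) p) HE)];
      intros q; simpl; unfold Rdiv; ring.
  - eapply C1p_ext; [| | |apply (C1p_div _ _ _ _ _ _ p Hne (C1p_const (- al * m2 h) p) HE)];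
      intros q; simpl; unfold Rdiv; ring.
Qed.

Lemma r2_eq (q : pt) : r2 q = dx q * dx q + dy q * dy q.
Proof. unfold r2. rewrite rad_dist, pdist_sq. unfold dx, dy. ring. Qed.

Lemma sector_patch_C1 (p : pt) : 0 <= c -> 0 < b -> 0 < X < b + PI / 2 -> b <= PI / 2 ->
  ground_state c b X psi psi1 -> (forall x, Rabs x <= X -> 0 < psi x) ->
  Rabs (ang v g p) <= X -> patch_C1 p sector_patch.
Proof.
  intros Hc Hb HX HbP Hgs Hpos Ha.
  assert (Hpi : ang v g p < PI) by (apply Rabs_le_between in Ha; lra).
  pose proof (rad_gt0 v g p Hpi) as Hr.
  pose proof (C1p_ang v g p (Rpos_rad v g p Hpi)) as HA.
  pose proof (C1p_comp F dF _ _ _ p (ricc_derive c b X psi psi1 Hgs Hpos _ Ha) (continuous_ricc_derive c b X psi psi1 Hb HX Hgs Hpos _ Ha) HA) as HF.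
  destruct (C1p_kxy v g p Hr) as [HQ HKy].
  assert (HP : C1p (fun q => - dy q / r2 q) (fun q => 2 * dx q * dy q / r2 q ^ 2) (fun q => - 1 / r2 q + 2 * dy q ^ 2 / r2 q ^ 2) p).
  { eapply C1p_ext; [| | |apply (C1p_scal (- 1) _ _ _ p HKy)];
      intros q; unfold ky, dx, dy, r2, Rdiv; ring. }
  split; [|split].
  - apply C1p_d0; assumption.
  - exact (C1p_mult _ _ _ _ _ _ p HF HP).
  - exact (C1p_mult _ _ _ _ _ _ p HF HQ).
Qed.

(** The field is [F] times the gradient of the angle, which is divergence-free of squared length
    [1 / r^2]. So divergence minus square is [(F' - F^2) / r^2], and the Riccati equation turns this
    into [c / d0^2]. *)
Lemma sector_patch_div (p : pt) : 0 < b -> 0 < X < b + PI / 2 -> b <= PI / 2 -> Rabs (ang v g p) <= X ->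
  let i := sector_patch in
  0 < fD i p /\ c / fD i p ^ 2 <= fTx i p + fSy i p - fT i p ^ 2 - fS i p ^ 2.
Proof.
  intros Hb HX HbP Ha. assert (Hpi : ang v g p < PI) by (apply Rabs_le_between in Ha; lra).
  pose proof (rad_gt0 v g p Hpi) as Hr.
  pose proof (kk_range b (ang v g p) ltac:(lra) ltac:(lra)) as Hk.
  simpl fD. simpl fTx. simpl fSy. simpl fT. simpl fS. split.
  - unfold d0. nra.
  - right. unfold dF. rewrite pot_eq by assumption. unfold d0.
    transitivity (c / kk b (ang v g p) ^ 2 / r2 p); [unfold r2; field; lra|].
    assert (Hr2 : 0 < r2 p) by (unfold r2; apply pow_lt, Hr).
    set (A := F (ang v g p)). set (k := kk b (ang v g p)) in *.
    transitivity ((c / k ^ 2) * (dx p * dx p + dy p * dy p) / r2 p ^ 2).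
    + rewrite <- r2_eq. field. lra.
    + field. lra.
Qed.

Lemma halfplane_patch_div (h : hp) (p : pt) : al * (1 - al) = c -> m1 h ^ 2 + m2 h ^ 2 = 1 -> 0 < ell h p + e ->
  let i := halfplane_patch h in
  0 < fD i p /\ c / fD i p ^ 2 <= fTx i p + fSy i p - fT i p ^ 2 - fS i p ^ 2.
Proof.
  intros Hal Hm Hp. simpl fD. simpl fTx. simpl fSy. simpl fT. simpl fS. split; [assumption|].
  right. rewrite <- Hal. transitivity ((al - al ^ 2) * (m1 h ^ 2 + m2 h ^ 2) / (ell h p + e) ^ 2).
  - rewrite Hm. field. lra.
  - field. lra.
Qed.

(** With unit normals the interaction equals [- al * (1 - m.m') * (1 / l + 1 / l')]: between the
    flat pieces of a convex boundary the gluing always helps. *)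
Lemma halfplane_cross (h h' : hp) (p : pt) : 0 <= al -> m1 h ^ 2 + m2 h ^ 2 = 1 -> m1 h' ^ 2 + m2 h' ^ 2 = 1 ->
  0 < ell h p + e -> 0 < ell h' p + e ->
  let i := halfplane_patch h in let j := halfplane_patch h' in
  (fG1 i p - fG1 j p) * (fT i p - fT j p) + (fG2 i p - fG2 j p) * (fS i p - fS j p) <= 0.
Proof.
  intros Hal Hm Hm' Hl Hl' i j. unfold i, j; simpl.
  set (l := ell h p + e) in *. set (l' := ell h' p + e) in *.
  assert (Hdot : m1 h * m1 h' + m2 h * m2 h' <= 1).
  { pose proof (pow2_ge_0 (m1 h - m1 h')). pose proof (pow2_ge_0 (m2 h - m2 h')). nra. }
  replace (_ + _) with (- (al * ((m1 h ^ 2 + m2 h ^ 2 - (m1 h * m1 h' + m2 h * m2 h')) / l + (m1 h' ^ 2 + m2 h' ^ 2 - (m1 h * m1 h' + m2 h * m2 h')) / l'))) by (field; lra).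
  rewrite Hm, Hm'.
  assert (0 <= (1 - (m1 h * m1 h' + m2 h * m2 h')) / l) by (apply Rdiv_le_0_compat; lra).
  assert (0 <= (1 - (m1 h * m1 h' + m2 h * m2 h')) / l') by (apply Rdiv_le_0_compat; lra).
  nra.
Qed.

(** The right-hand side is minus the quantity [cr] of [cross_sign], with [l = ell h p + e]. *)
Lemma sector_halfplane_cross (h : hp) (nu : R) (p : pt) : m1 h = - cos (g + nu) -> m2 h = - sin (g + nu) ->
  0 < rad v g p -> 0 < ell h p + e ->
  let i := sector_patch in let j := halfplane_patch h in
  (fG1 i p - fG1 j p) * (fT i p - fT j p) + (fG2 i p - fG2 j p) * (fS i p - fS j p) =
  - (F (ang v g p) / rad v g p * (sin (ang v g p - clamp b (ang v g p)) + sin (ang v g p - nu))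
     + al / (ell h p + e) * (1 + cos (clamp b (ang v g p) - nu))).
Proof.
  intros E1 E2 Hr Hl i j. unfold i, j; simpl. unfold nx, ny, dx, dy, r2. rewrite E1, E2.
  destruct (polar v g p) as [-> ->].
  set (x := ang v g p). set (y := clamp b x). set (A := F x). set (r := rad v g p) in *. set (l := ell h p + e) in *.
  replace (x - y) with ((g + x) - (g + y)) by ring.
  replace (x - nu) with ((g + x) - (g + nu)) by ring.
  replace (y - nu) with ((g + y) - (g + nu)) by ring.
  rewrite !sin_minus, cos_minus.
  replace 1 with (sin (g + nu) ^ 2 + cos (g + nu) ^ 2) by apply sc1.
  field. lra.
Qed.
End Patches.

(** * The Hardy inequality from positive ground states *)

Section LowerBound.
Context (K : pt -> Prop) (v : pt) (g b : R).
Context (Hb : 0 < b <= PI / 2) (HK : convex_set K) (Hv : interior2 K v).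
Context (Hray : forall t s, 0 <= t -> s = 1 \/ s = - 1 -> interior2 K (ray v g t (s * (b + PI / 2)))).

Lemma hardy_of_ground_states (c : R) : 0 <= c < 1 / 4 ->
  (forall X, 0 < X < b + PI / 2 -> exists psi psi1, ground_state c b X psi psi1 /\ forall x, Rabs x <= X -> 0 < psi x) ->
  hardy_ineq (Om K v g b) c.
Proof.
  intros Hc HN u ux uy A B (Hsm & Hbd & Hsupp) Hux Huy HA HB.
  pose proof PI_RGT_0 as Hpi.
  pose proof (smooth_C1p u ux uy Hsm Hux Huy) as Hu.
  destruct (C1p_cts _ _ _ Hu) as (Cu & Cx & Cy).
  destruct (bounded_outside u Hbd) as [L [HL Hout]].
  assert (Hz : forall x y, L <= Rabs x \/ L <= Rabs y -> u (x, y) = 0 /\ ux (x, y) = 0 /\ uy (x, y) = 0).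
  { intros x y Hxy. apply (locally_singleton _ _ (off_support u ux uy (x, y) Hu (Hout x y Hxy))). }
  assert (Ou : outside0 L u) by (intros x y Hxy; apply (Hz x y Hxy)).
  assert (Oux : outside0 L ux) by (intros x y Hxy; apply (Hz x y Hxy)).
  assert (Ouy : outside0 L uy) by (intros x y Hxy; apply (Hz x y Hxy)).
  destruct (compact_bound u L Cu Ou) as [U [HU HuU]].
  set (O := Om K v g b) in *.
  pose proof (Om_boundary_ne K v g b Hb Hray) as Hne. fold O in Hne.
  assert (Hcl : forall p, closure2 (support u) p -> support u p) by (intros p; apply closure2_closed).
  destruct (compact_polar_bounds K v g b Hb (support u) Hbd Hcl Hsupp) as [r0 [Hr0 Hpol]].
  set (X := b + PI / 2 - r0). assert (HX : 0 < X < b + PI / 2) by (unfold X; lra).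
  destruct (HN X HX) as (psi & psi1 & Hgs & Hpos).
  (* The larger root of [al * (1 - al) = c]; as [c < 1 / 4] it exceeds [1 / 2], the bound of
     [ricc_half]. *)
  set (al := (1 + sqrt (1 - 4 * c)) / 2).
  assert (Hsq : 0 < sqrt (1 - 4 * c)) by (apply sqrt_lt_R0; lra).
  assert (Hal : 1 / 2 < al) by (unfold al; lra).
  assert (Halc : al * (1 - al) = c).
  { unfold al. transitivity ((1 - sqrt (1 - 4 * c) ^ 2) / 4); [field|]. rewrite pow2_sqrt by lra. field. }
  (* Where [l > 2 * al * r], the half-plane distance exceeds [d0 <= r] by at least
     [(2 * al - 1) * r >= sg], so its weight is at most [exp (- N * sg)] times that of the
     sector. *)
  set (sg := (2 * al - 1) * r0). assert (Hsg : 0 < sg) by (apply Rmult_lt_0_compat; lra).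
  apply (barta O u ux uy A B c L HA HB Cx Cy).
  intros eta Heta.
  destruct (weight_shift O u ux uy c L Hne (proj1 Hc) HL Hu Ou Oux Ouy Hsupp (eta / 2) ltac:(lra)) as [e [He Hshift]].
  destruct (halfplane_cover K v g b Hb HK Hv Hray (support u) e Hbd Hcl Hsupp He) as [hs [Hhs Hcov]].
  set (sp := sector_patch v g b c X psi psi1).
  set (l := sp :: map (halfplane_patch al e) hs).
  set (n := INR (length l)). assert (Hn : 0 <= n) by apply pos_INR.
  set (s := Rmin e sg). assert (Hs : 0 < s) by (apply Rmin_pos; assumption).
  (* The first error comes from patches that are not nearly minimal, where [d + 5 * e >= 5 * e]
     bounds the weight by [1 / (25 * e^2)]; the second comes from interactions of unfavourable sign,
     bounded by [/ (2 * r0)]. *)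
  destruct (large_N (U * c * n / (25 * e ^ 2)) (U * n ^ 2 / (2 * r0)) s (eta / 2)) as [N [HN0 HNe]].
  { apply Rdiv_le_0_compat; [repeat apply Rmult_le_pos; lra|]. apply Rmult_lt_0_compat; [lra|apply pow_lt, He]. }
  { apply Rdiv_le_0_compat; [|lra]. apply Rmult_le_pos; [assumption|apply pow2_ge_0]. }
  { assumption. }
  { lra. }
  assert (Hl : l <> nil) by discriminate.
  assert (Hell : forall p h, support u p -> In h hs -> 0 < ell h p + e).
  { intros p h Hp Hh. destruct (Hhs h Hh) as [_ H]. specialize (H p (proj1 (Hsupp p Hp))). lra. }
  assert (HC1 : forall p, support u p -> forall i, In i l -> patch_C1 p i).
  { intros p Hp i [<-|Hi].
    - destruct (Hpol p Hp) as [_ Ha]. apply sector_patch_C1; try assumption; lra.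
    - apply in_map_iff in Hi. destruct Hi as [h [<- Hh]]. apply halfplane_patch_C1, Hell; assumption. }
  set (AA := wA l N). set (BB := wB l N).
  exists (fld l N u AA), (fldd l N u AA (wAx l N) ux (wZx l N)), (fldd l N u AA (wAy l N) uy (wZy l N)),
         (fld l N u BB), (fldd l N u BB (wBx l N) ux (wZx l N)), (fldd l N u BB (wBy l N) uy (wZy l N)).
  split; [|split; [|split; [|split]]].
  - intros p. destruct (classic (support u p)) as [Hp|Hp].
    + apply C1p_fld; [assumption|apply HC1, Hp|apply Hu|apply (C1p_fields l N p (HC1 p Hp))].
    + apply C1p_fld_zero, off_support; assumption.
  - intros p. destruct (classic (support u p)) as [Hp|Hp].
    + apply C1p_fld; [assumption|apply HC1, Hp|apply Hu|apply (C1p_fields l N p (HC1 p Hp))].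
    + apply C1p_fld_zero, off_support; assumption.
  - intros x y Hxy. unfold fld. rewrite Ou by assumption. unfold Rdiv. ring.
  - intros x y Hxy. unfold fld. rewrite Ou by assumption. unfold Rdiv. ring.
  - intros p. destruct (classic (support u p)) as [Hp|Hp].
    2:{ destruct (locally_singleton _ _ (off_support u ux uy p Hu Hp)) as (E1 & E2 & E3).
        unfold fldd. rewrite E1, E2, E3. unfold Rdiv. rewrite !pow_i by lia. lra. }
    destruct (Hpol p Hp) as [Hrp Hap].
    assert (HapX : Rabs (ang v g p) <= X) by exact Hap.
    assert (Hrp0 : 0 < rad v g p) by lra.
    set (d := bdist O p). assert (Hd : 0 <= d) by (apply bdist_nonneg, Hne).
    set (k := exp (- N * sg) / (2 * r0)).
    assert (Hk : 0 <= k) by (apply Rdiv_le_0_compat; [apply Rlt_le, exp_pos|lra]).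
    assert (HZ2 : 0 <= wZ l N p ^ 2) by apply pow2_ge_0.
    assert (Hx0h : forall h, In h hs -> let i := sp in let j := halfplane_patch al e h in
      wE N i p * wE N j p * ((fG1 i p - fG1 j p) * (fT i p - fT j p) + (fG2 i p - fG2 j p) * (fS i p - fS j p)) <= wZ l N p ^ 2 * k).
    { intros h Hh i j. destruct (supporting_normal K v g b Hb Hray h (Hhs h Hh)) as (nu & Hnu & E1 & E2).
      unfold i, j, sp. rewrite (sector_halfplane_cross v g b c al e X psi psi1 h nu p E1 E2 Hrp0 (Hell p h Hp Hh)).
      destruct (cross_sign b (ang v g p) nu (ricc psi psi1 (ang v g p)) (rad v g p) al (ell h p + e)) as [Cr1 Cr2];
        try assumption.
      { unfold X in HapX. lra. }
      { intros Ha. rewrite <- (ricc_0 c b X psi psi1 Hgs). apply Rabs_le_between in HapX.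
        apply (ricc_mono c b X psi psi1 (proj1 Hc) (proj1 Hb) HX Hgs Hpos); lra. }
      { intros Ha. rewrite <- (ricc_0 c b X psi psi1 Hgs). apply Rabs_le_between in HapX.
        apply (ricc_mono c b X psi psi1 (proj1 Hc) (proj1 Hb) HX Hgs Hpos); lra. }
      { intros Hab. apply (ricc_half c b X psi psi1 (proj1 Hc) (proj1 Hb) HX Hgs Hpos); lra. }
      { apply Hell; assumption. }
      set (cr := ricc psi psi1 (ang v g p) / rad v g p * _ + _) in *.
      fold sp. set (hpp := halfplane_patch al e h).
      pose proof (wE_pos N sp p) as W1. pose proof (wE_pos N hpp p) as W2.
      assert (W3 : wE N sp p <= wZ l N p) by (apply wZ_ge; left; reflexivity).
      destruct (Rle_or_lt (ell h p + e) (2 * al * rad v g p)) as [Hle|Hlt].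
      - specialize (Cr1 Hle). pose proof (Rmult_le_pos _ _ HZ2 Hk). assert (0 <= wE N sp p * wE N hpp p * cr) by (apply Rmult_le_pos; [apply Rlt_le, Rmult_lt_0_compat|]; assumption). lra.
      - assert (Hw : wE N hpp p <= exp (- N * sg) * wZ l N p).
        { apply Rle_trans with (exp (- N * sg) * wE N sp p); [|apply Rmult_le_compat_l; [apply Rlt_le, exp_pos|assumption]].
          unfold wE. rewrite <- exp_plus. apply exp_mono. simpl fD.
          assert (d0 v g b p <= rad v g p).
          { unfold d0. pose proof (kk_range b (ang v g p) ltac:(lra) ltac:(lra)). nra. }
          assert ((2 * al - 1) * r0 <= (2 * al - 1) * rad v g p) by (apply Rmult_le_compat_l; lra).
          assert (sg + d0 v g b p <= ell h p + e) by (unfold sg; lra).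
          pose proof (Rmult_le_compat_l N _ _ (Rlt_le _ _ HN0) H1). lra. }
        assert (Hww : wE N sp p * wE N hpp p <= wZ l N p ^ 2 * exp (- N * sg)).
        { apply Rle_trans with (wZ l N p * (exp (- N * sg) * wZ l N p)); [|right; ring].
          apply Rmult_le_compat; lra. }
        assert (Hcr : - cr <= / (2 * r0)).
        { apply Rle_trans with (/ (2 * rad v g p)); [lra|]. apply Rinv_le_contravar; lra. }
        assert (Hi : 0 < / (2 * r0)) by (apply Rinv_0_lt_compat; lra).
        apply Rle_trans with (wE N sp p * wE N hpp p * / (2 * r0)).
        + apply Rmult_le_compat_l; [apply Rlt_le, Rmult_lt_0_compat|]; assumption.
        + unfold k, Rdiv. rewrite <- Rmult_assoc. apply Rmult_le_compat_r; lra. }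
    assert (Hcross : forall i j, In i l -> In j l ->
      wE N i p * wE N j p * ((fG1 i p - fG1 j p) * (fT i p - fT j p) + (fG2 i p - fG2 j p) * (fS i p - fS j p)) <= wZ l N p ^ 2 * k).
    { pose proof (Rmult_le_pos _ _ HZ2 Hk) as HZk.
      intros i j [<-|Hi] [<-|Hj].
      - replace (_ * _) with 0; [assumption|ring].
      - apply in_map_iff in Hj. destruct Hj as [h [<- Hh]]. apply Hx0h, Hh.
      - apply in_map_iff in Hi. destruct Hi as [h [<- Hh]]. eapply Rle_trans; [|apply (Hx0h h Hh)]. right. ring.
      - apply in_map_iff in Hi. destruct Hi as [h [<- Hh]]. apply in_map_iff in Hj. destruct Hj as [h' [<- Hh']].
        pose proof (halfplane_cross al e h h' p ltac:(lra) (proj1 (Hhs h Hh)) (proj1 (Hhs h' Hh')) (Hell p h Hp Hh) (Hell p h' Hp Hh')) as Hx.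
        pose proof (wE_pos N (halfplane_patch al e h) p). pose proof (wE_pos N (halfplane_patch al e h') p).
        eapply Rle_trans; [|exact HZk]. simpl in Hx.
        rewrite <- (Rmult_0_r (wE N (halfplane_patch al e h) p * wE N (halfplane_patch al e h') p)).
        apply Rmult_le_compat_l; [apply Rlt_le, Rmult_lt_0_compat; assumption|exact Hx]. }
    assert (Hdiv : forall i, In i l -> 0 < fD i p /\ c / fD i p ^ 2 <= fTx i p + fSy i p - fT i p ^ 2 - fS i p ^ 2).
    { intros i [<-|Hi].
      - apply sector_patch_div; try assumption; lra.
      - apply in_map_iff in Hi. destruct Hi as [h [<- Hh]]. apply halfplane_patch_div; [assumption|apply (Hhs h Hh)|apply Hell; assumption]. }
    (* The cover costs [3 * e] and the shift of the half planes one more [e]; with the [e] spent in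
       [softmin_barta] this makes the [5 * e] of [weight_shift]. *)
    assert (Hmin : exists i, In i l /\ fD i p <= d + 4 * e).
    { destruct (Hcov p Hp) as [H|[h [Hh H]]]; fold O d in H.
      - exists sp. split; [left; reflexivity|]. simpl. lra.
      - exists (halfplane_patch al e h). split; [right; apply in_map, Hh|]. simpl. lra. }
    pose proof (softmin_barta l N u ux uy p c e (d + 4 * e) k Hl (proj1 Hc) ltac:(lra) He ltac:(lra) Hdiv Hcross Hmin) as Hmain.
    fold AA BB n in Hmain. replace (d + 4 * e + e) with (d + 5 * e) in Hmain by ring.
    specialize (Hshift p). fold d in Hshift. specialize (HuU p). pose proof (pow2_ge_0 (u p)) as Hu2.
    assert (Hexp1 : exp (- N * e) <= exp (- N * s)) by (apply exp_mono; assert (Hse : s <= e) by apply Rmin_l; nra).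
    assert (Hexp2 : exp (- N * sg) <= exp (- N * s)) by (apply exp_mono; assert (Hse : s <= sg) by apply Rmin_r; nra).
    assert (Herr1 : c * n * exp (- N * e) / (d + 5 * e) ^ 2 <= c * n / (25 * e ^ 2) * exp (- N * s)).
    { replace (c * n * exp (- N * e) / (d + 5 * e) ^ 2) with (c * n * (/ (d + 5 * e) ^ 2 * exp (- N * e))) by (field; lra).
      replace (c * n / (25 * e ^ 2) * exp (- N * s)) with (c * n * (/ (5 * e) ^ 2 * exp (- N * s))) by (field; lra).
      apply Rmult_le_compat_l; [apply Rmult_le_pos; lra|].
      apply Rmult_le_compat; [apply Rlt_le, Rinv_0_lt_compat, pow_lt; lra|apply Rlt_le, exp_pos| |assumption].
      apply Rinv_le_contravar; [apply pow_lt; lra|apply pow_incr; lra]. }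
    assert (Herr2 : N * k * n ^ 2 <= n ^ 2 / (2 * r0) * N * exp (- N * s)).
    { unfold k. replace (N * (exp (- N * sg) / (2 * r0)) * n ^ 2) with (n ^ 2 / (2 * r0) * N * exp (- N * sg)) by (field; lra).
      apply Rmult_le_compat_l; [|assumption]. apply Rmult_le_pos; [|lra]. apply Rdiv_le_0_compat; [apply pow2_ge_0|lra]. }
    set (E1 := c * n / (25 * e ^ 2) * exp (- N * s)) in *. set (E2 := n ^ 2 / (2 * r0) * N * exp (- N * s)) in *.
    assert (HE : U * (E1 + E2) <= eta / 2).
    { eapply Rle_trans; [|exact HNe]. right. unfold E1, E2. field. lra. }
    assert (HE0 : 0 <= E1 + E2).
    { unfold E1, E2. pose proof (exp_pos (- N * s)) as Hep.
      assert (0 <= c * n / (25 * e ^ 2)) by (apply Rdiv_le_0_compat; [apply Rmult_le_pos; lra|apply Rmult_lt_0_compat; [lra|apply pow_lt, He]]).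
      assert (0 <= n ^ 2 / (2 * r0)) by (apply Rdiv_le_0_compat; [apply pow2_ge_0|lra]).
      apply Rplus_le_le_0_compat; (apply Rmult_le_pos; [|lra]); [assumption|]. apply Rmult_le_pos; [assumption|lra]. }
    assert (Hlow : u p ^ 2 * (c / (d + 5 * e) ^ 2 - (E1 + E2)) <= u p ^ 2 * (c * (1 - n * exp (- N * e)) / (d + 5 * e) ^ 2 - N * k * n ^ 2)).
    { apply Rmult_le_compat_l; [assumption|].
      replace (c * (1 - n * exp (- N * e)) / (d + 5 * e) ^ 2) with (c / (d + 5 * e) ^ 2 - c * n * exp (- N * e) / (d + 5 * e) ^ 2) by (field; lra).
      lra. }
    assert (HuE : u p ^ 2 * (E1 + E2) <= U * (E1 + E2)) by (apply Rmult_le_compat_r; assumption).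
    replace (c * (u p ^ 2 / (d + 5 * e) ^ 2)) with (u p ^ 2 * (c / (d + 5 * e) ^ 2)) in Hshift by (field; lra).
    lra.
Qed.
End LowerBound.

(** * Mollification *)

Fixpoint Dn (n : nat) (f : R -> R) : Prop :=
  match n with
  | O => forall x, continuous f x
  | S n => exists f', (forall x, is_derive f x (f' x)) /\ Dn n f'
  end.

Lemma Dn_S (n : nat) : forall f, Dn (S n) f -> Dn n f.
Proof.
  induction n as [|n IH]; intros f [f' [H1 H2]].
  - intros x. apply (ex_derive_continuous (V := R_NormedModule)). eexists; apply H1.
  - exists f'. split; [assumption|apply IH, H2].
Qed.

Lemma Dn_plus (n : nat) : forall f h, Dn n f -> Dn n h -> Dn n (fun x => f x + h x).
Proof.
  induction n as [|n IH]; intros f h.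
  - intros H1 H2 x. apply (continuous_plus (V := R_NormedModule) f h); [apply H1|apply H2].
  - intros [f' [F1 F2]] [h' [G1 G2]]. exists (fun x => f' x + h' x). split; [|apply IH; assumption].
    intros x. apply (is_derive_plus (V := R_NormedModule) f h); [apply F1|apply G1].
Qed.

Lemma Dn_mult (n : nat) : forall f h, Dn n f -> Dn n h -> Dn n (fun x => f x * h x).
Proof.
  induction n as [|n IH]; intros f h Hf Hh.
  - intros x. apply (continuous_mult (K := R_AbsRing) f h); [apply Hf|apply Hh].
  - pose proof (Dn_S n f Hf) as Hf0. pose proof (Dn_S n h Hh) as Hh0.
    destruct Hf as [f' [F1 F2]]. destruct Hh as [h' [G1 G2]].
    exists (fun x => f' x * h x + f x * h' x). split.
    + intros x. apply (is_derive_mult (K := R_AbsRing) f h); [apply F1|apply G1|apply Rmult_comm].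
    + apply Dn_plus; apply IH; assumption.
Qed.

Lemma Dn_const (n : nat) : forall k, Dn n (fun _ => k).
Proof.
  induction n as [|n IH]; intros k.
  - intros x. apply continuous_const.
  - exists (fun _ => 0). split; [intros x; apply (is_derive_const k)|apply IH].
Qed.

Lemma Dn_affine (a k : R) (n : nat) : forall f, Dn n f -> Dn n (fun x => f (a * x + k)).
Proof.
  induction n as [|n IH]; intros f.
  - intros H x. apply (continuous_comp (fun x => a * x + k) f); [|apply H].
    apply (ex_derive_continuous (V := R_NormedModule)). auto_derive. exact I.
  - intros [f' [F1 F2]]. exists (fun x => a * f' (a * x + k)). split.
    + intros x. apply (is_derive_comp (V := R_NormedModule) f (fun x => a * x + k)); [apply F1|].
      auto_derive; [exact I|ring].
    + apply (Dn_mult n (fun _ => a)); [apply Dn_const|apply IH, F2].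
Qed.

Lemma Dn_Derive (f : R -> R) : (forall n, Dn n f) -> (forall x, is_derive f x (Derive f x)) /\ forall n, Dn n (Derive f).
Proof.
  intros H. split.
  - intros x. destruct (H 1%nat) as [f' [F1 _]]. apply Derive_correct. eexists; apply F1.
  - intros n. destruct (H (S n)) as [f' [F1 F2]].
    replace (Derive f) with f'; [assumption|]. apply functional_extensionality. intros x.
    symmetry. apply is_derive_unique, F1.
Qed.

Lemma Dn_Derive_n (f : R -> R) (n : nat) : (forall n, Dn n f) ->
  (forall x, is_derive (Derive_n f n) x (Derive_n f (S n) x)) /\ (forall x, continuous (Derive_n f n) x).
Proof.
  intros H. assert (Hn : forall m, Dn m (Derive_n f n)).
  { induction n as [|n IH]; [exact H|]. apply (Dn_Derive (Derive_n f n) IH). }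
  split; [apply (Dn_Derive _ Hn)|exact (Hn 0%nat)].
Qed.

(* The family is closed under differentiation: [flat j]' = [flat (j+2)] - j [flat (j+1)]. *)
Definition flat (j : nat) (x : R) : R := if Rlt_dec 0 x then (/ x) ^ j * exp (- / x) else 0.

Lemma exp_ge_pow (s : R) (n : nat) : 0 <= s -> (0 < n)%nat -> (s / INR n) ^ n <= exp s.
Proof.
  intros Hs Hn. assert (HN : 0 < INR n) by (apply lt_0_INR, Hn).
  replace (exp s) with (exp (s / INR n) ^ n).
  - apply pow_incr. split; [apply Rdiv_le_0_compat; assumption|]. pose proof (exp_ineq1_le (s / INR n)). lra.
  - replace s with (INR n * (s / INR n)) at 2 by (field; lra). generalize (s / INR n). intros t. clear.
    induction n as [|n IH]; [simpl; rewrite Rmult_0_l, exp_0; reflexivity|].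
    rewrite S_INR, Rmult_plus_distr_r, exp_plus, <- IH. simpl. rewrite Rmult_1_l. ring.
Qed.

(** The exponential beats the power [j + 2] of [/ x], which leaves a factor [x^2] and so makes the
    derivative at 0 vanish. *)
Lemma flat_quad (j : nat) : exists C, 0 < C /\ forall x, 0 < x -> Rabs (flat j x) <= C * x ^ 2.
Proof.
  set (n := (j + 2)%nat). assert (Hn : (0 < n)%nat) by (unfold n; lia).
  assert (HN : 0 < INR n) by (apply lt_0_INR, Hn).
  exists (INR n ^ n). split; [apply pow_lt, HN|]. intros x Hx. unfold flat.
  destruct (Rlt_dec 0 x); [|contradiction].
  assert (Hi : 0 < / x) by (apply Rinv_0_lt_compat, Hx).
  rewrite Rabs_pos_eq by (apply Rmult_le_pos; [apply pow_le; lra|apply Rlt_le, exp_pos]).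
  rewrite exp_Ropp. apply Rle_div_l; [apply exp_pos|].
  pose proof (exp_ge_pow (/ x) n ltac:(lra) Hn) as H.
  apply Rle_trans with (INR n ^ n * x ^ 2 * (/ x / INR n) ^ n).
  - right. unfold Rdiv. rewrite Rpow_mult_distr, (pow_inv (INR n)).
    assert (E : (/ x) ^ n = (/ x) ^ j * (/ x) ^ 2) by (unfold n; apply pow_add). rewrite E.
    set (J := (/ x) ^ j). assert (HP : INR n ^ n <> 0) by (apply pow_nonzero; lra).
    set (P := INR n ^ n) in *. field. split; [assumption|lra].
  - apply Rmult_le_compat_l; [|exact H]. apply Rmult_le_pos; [apply pow_le; lra|apply pow2_ge_0].
Qed.

Lemma flat_derive (j : nat) (x : R) : is_derive (flat j) x (flat (j + 2) x - INR j * flat (j + 1) x).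
Proof.
  destruct (Rtotal_order x 0) as [H|[-> |H]].
  - replace (flat (j + 2) x - INR j * flat (j + 1) x) with 0.
    + apply (is_derive_ext_loc (fun _ => 0)); [|apply (is_derive_const 0)].
      generalize (open_lt 0 x H). apply filter_imp. intros t Ht. unfold flat. destruct (Rlt_dec 0 t); [lra|reflexivity].
    + unfold flat. destruct (Rlt_dec 0 x); [lra|ring].
  - replace (flat (j + 2) 0 - INR j * flat (j + 1) 0) with 0 by (unfold flat; destruct (Rlt_dec 0 0); [lra|ring]).
    destruct (flat_quad j) as [C [HC Hq]].
    apply is_derive_Reals. intros eps Heps. assert (Hd : 0 < eps / C) by (apply Rdiv_lt_0_compat; assumption).
    exists (mkposreal _ Hd). intros h Hh Hhd. simpl in Hhd.
    assert (E0 : flat j 0 = 0) by (unfold flat; destruct (Rlt_dec 0 0); [lra|reflexivity]).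
    rewrite E0, Rplus_0_l, !Rminus_0_r.
    destruct (Rlt_or_le 0 h) as [H|H].
    + specialize (Hq h H). unfold Rdiv. rewrite Rabs_mult, Rabs_inv, (Rabs_pos_eq h) in * by lra.
      apply Rle_lt_trans with (C * h); [apply Rle_div_l; [assumption|]; nra|].
      apply Rlt_div_r in Hhd; [lra|assumption].
    + unfold flat. destruct (Rlt_dec 0 h); [lra|]. unfold Rdiv. rewrite Rmult_0_l, Rabs_R0. assumption.
  - apply (is_derive_ext_loc (fun t => (/ t) ^ j * exp (- / t))).
    + generalize (open_gt 0 x H). apply filter_imp. intros t Ht. unfold flat. destruct (Rlt_dec 0 t); [reflexivity|contradiction].
    + unfold flat. destruct (Rlt_dec 0 x); [|contradiction].
      auto_derive; [split; [lra|split; [lra|exact I]]|].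
      rewrite !pow_add. destruct j as [|j]; [simpl; field; lra|]. 
      rewrite Nat.pred_succ. rewrite <- (tech_pow_Rmult _ j). field. lra.
Qed.

Lemma flat_Dn (n : nat) : forall j, Dn n (flat j).
Proof.
  assert (H0 : forall j, Dn 0 (flat j)).
  { intros j x. apply (ex_derive_continuous (V := R_NormedModule)). eexists; apply flat_derive. }
  induction n as [|n IH]; intros j; [apply H0|].
  exists (fun x => flat (j + 2) x + (- INR j) * flat (j + 1) x). split.
  - intros x. replace (flat (j + 2) x + - INR j * flat (j + 1) x) with (flat (j + 2) x - INR j * flat (j + 1) x) by ring.
    apply flat_derive.
  - apply Dn_plus; [apply IH|]. apply (Dn_mult n (fun _ => - INR j)); [apply Dn_const|apply IH].
Qed.

Lemma RInt_0 (f : R -> R) (a c : R) : (forall x, Rmin a c < x < Rmax a c -> f x = 0) -> RInt f a c = 0.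
Proof.
  intros H. rewrite (RInt_ext f (fun _ => 0)) by assumption. rewrite RInt_const.
  unfold scal; simpl; unfold mult; simpl. ring.
Qed.

(** The product of two mirrored copies of [flat 0] is positive exactly on [(- e, e)]. The last
    clause is the normalisation in the shape in which it occurs in a convolution over a fixed window
    reaching at least [e] beyond [x]. *)
Lemma bump_exists (e : R) : 0 < e -> exists rho : R -> R, (forall n, Dn n rho) /\ (forall x, 0 <= rho x) /\
  (forall x, e <= Rabs x -> rho x = 0) /\
  forall L x, Rabs x <= L - e -> RInt (fun s => rho (x - s)) (- L) L = 1.
Proof.
  intros He.
  set (f := fun x => flat 0 (1 * x + e) * flat 0 (-1 * x + e)).
  assert (Hf : forall n, Dn n f).
  { intros n. apply (Dn_mult n (fun x => flat 0 (1 * x + e)) (fun x => flat 0 (-1 * x + e)));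
      apply (Dn_affine _ _ n (flat 0)), flat_Dn. }
  assert (H0 : forall x, 0 <= flat 0 x).
  { intros x. unfold flat. destruct (Rlt_dec 0 x); [simpl; rewrite Rmult_1_l; apply Rlt_le, exp_pos|lra]. }
  assert (Hf0 : forall x, 0 <= f x) by (intros x; apply Rmult_le_pos; apply H0).
  assert (Hout : forall x, e <= Rabs x -> f x = 0).
  { intros x Hx. unfold f, flat. destruct (Rlt_dec 0 (1 * x + e)); [|ring]. destruct (Rlt_dec 0 (-1 * x + e)); [|ring].
    exfalso. revert Hx. unfold Rabs. destruct Rcase_abs; lra. }
  assert (Hint : forall a c, ex_RInt f a c).
  { intros a c. apply (@ex_RInt_continuous R_CompleteNormedModule). intros; apply (Hf 0%nat). }
  set (Z := RInt f (- e) e).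
  assert (HZ : 0 < Z).
  { apply RInt_gt_0; [lra| |].
    - intros x Hx. unfold f, flat. destruct (Rlt_dec 0 (1 * x + e)); [|lra]. destruct (Rlt_dec 0 (-1 * x + e)); [|lra].
      simpl. apply Rmult_lt_0_compat; rewrite Rmult_1_l; apply exp_pos.
    - intros x _. apply (Hf 0%nat). }
  exists (fun x => / Z * f x). split; [|split; [|split]].
  - intros n. apply (Dn_mult n (fun _ => / Z)); [apply Dn_const|apply Hf].
  - intros x. apply Rmult_le_pos; [apply Rlt_le, Rinv_0_lt_compat, HZ|apply Hf0].
  - intros x Hx. rewrite Hout by assumption. ring.
  - intros L x Hx. apply Rabs_le_between in Hx.
    assert (E : RInt f (x + L) (x - L) = - Z).
    { rewrite <- (RInt_Chasles f (x + L) e (x - L)) by apply Hint.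
      rewrite <- (RInt_Chasles f e (- e) (x - L)) by apply Hint.
      rewrite (RInt_0 f (x + L) e), (RInt_0 f (- e) (x - L)).
      - rewrite <- (opp_RInt_swap f) by apply Hint. fold Z. unfold plus, opp; simpl. ring.
      - intros t. rewrite Rmin_right, Rmax_left by lra. intros Ht. apply Hout, Rabs_ge. lra.
      - intros t. rewrite Rmin_right, Rmax_left by lra. intros Ht. apply Hout, Rabs_ge. lra. }
    pose proof (RInt_comp_lin f (-1) x (- L) L (Hint _ _)) as Hl.
    replace (-1 * - L + x) with (x + L) in Hl by ring. replace (-1 * L + x) with (x - L) in Hl by ring.
    rewrite E in Hl.
    transitivity (RInt (fun s => scal (- / Z) (scal (-1) (f (-1 * s + x)))) (- L) L).
    + apply RInt_ext. intros s _. unfold scal; simpl; unfold mult; simpl. replace (-1 * s + x) with (x - s) by ring. ring.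
    + rewrite (RInt_scal (V := R_CompleteNormedModule)).
      * etransitivity; [apply (f_equal (fun z => scal (- / Z) z)); exact Hl|]. unfold scal; simpl; unfold mult; simpl. field. lra.
      * apply (ex_RInt_comp_lin (V := R_NormedModule)), Hint.
Qed.

Lemma cts_comp2 (f : pt -> R) (a c : pt -> R) : cts f -> cts a -> cts c -> cts (fun q => f (a q, c q)).
Proof.
  intros Hf Ha Hc p. apply (continuous_comp_2 a c (fun x y => f (x, y)) p); [apply Ha|apply Hc|].
  apply (continuous_ext f); [intros [? ?]; reflexivity|apply Hf].
Qed.

Lemma cts_fst : cts (fun q => fst q).
Proof. intros p. apply (continuous_fst (U := R_UniformSpace) (V := R_UniformSpace)). Qed.

Lemma cts_snd : cts (fun q => snd q).
Proof. intros p. apply (continuous_snd (U := R_UniformSpace) (V := R_UniformSpace)). Qed.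

Lemma cts_const (k : R) : cts (fun _ => k).
Proof. intros p. apply continuous_const. Qed.

Lemma cts_mult (f h : pt -> R) : cts f -> cts h -> cts (fun q => f q * h q).
Proof. intros Hf Hh p. apply cont_mult; [apply Hf|apply Hh]. Qed.

Lemma cts_plus (f h : pt -> R) : cts f -> cts h -> cts (fun q => f q + h q).
Proof. intros Hf Hh p. apply cont_plus; [apply Hf|apply Hh]. Qed.

Lemma cts_minus (f h : pt -> R) : cts f -> cts h -> cts (fun q => f q - h q).
Proof.
  intros Hf Hh p. apply (continuous_minus (V := R_NormedModule) f h); [apply Hf|apply Hh].
Qed.

Lemma cts_comp1 (h : R -> R) (f : pt -> R) : (forall x, continuous h x) -> cts f -> cts (fun q => h (f q)).
Proof. intros Hh Hf p. apply cont_comp; [apply Hh|apply Hf]. Qed.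

Section Mollify.
Context (rho : R -> R) (L : R) (u : pt -> R).
Context (Hrho : forall n, Dn n rho) (HL : 0 < L) (Hu : cts u).

(** Convolution with a product kernel, one variable at a time. The indices count the derivatives
    that fall on the kernel, so the family is closed under differentiation, as the corecursive proof
    of [moll_smooth] needs. *)
Definition mollJ (m : nat) (q : pt) : R :=
  RInt (fun t => u (fst q, t) * Derive_n rho m (snd q - t)) (- L) L.
Definition moll (n m : nat) (p : pt) : R :=
  RInt (fun s => Derive_n rho n (fst p - s) * mollJ m (s, snd p)) (- L) L.

Lemma rho_cts (n : nat) (x : R) : continuous (Derive_n rho n) x.
Proof. apply (Dn_Derive_n rho n Hrho). Qed.

Lemma mollJ_cts (m : nat) : cts (mollJ m).
Proof.
  intros q. unfold mollJ.
  apply (continuous_RInt_param (T := prod_UniformSpace R_UniformSpace R_UniformSpace) (fun t q => u (fst q, t) * Derive_n rho m (snd q - t))); [lra| |].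
  - intros s _. 
    apply (continuous_mult (K := R_AbsRing) (fun p : R * (R * R) => u (fst (snd p), fst p)) (fun p => Derive_n rho m (snd (snd p) - fst p))).
    + apply (continuous_comp_2 (fun p : R * (R * R) => fst (snd p)) (fun p => fst p) (fun x y => u (x, y))).
      * apply (continuous_comp snd fst); [apply continuous_snd|apply continuous_fst].
      * apply continuous_fst.
      * apply (continuous_ext u); [intros [? ?]; reflexivity|apply Hu].
    + apply (continuous_comp (fun p : R * (R * R) => snd (snd p) - fst p) (Derive_n rho m)); [|apply rho_cts].
      apply (continuous_minus (V := R_NormedModule) (fun p : R * (R * R) => snd (snd p)) (fun p => fst p)).
      * apply (continuous_comp snd snd); apply continuous_snd.
      * apply continuous_fst.
  - intros z s. apply (continuous_mult (K := R_AbsRing) (fun t => u (fst z, t)) (fun t => Derive_n rho m (snd z - t))).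
    + apply cts_snd_slice, Hu.
    + apply (continuous_comp (fun t => snd z - t) (Derive_n rho m)); [|apply rho_cts].
      apply (ex_derive_continuous (V := R_NormedModule)). auto_derive. exact I.
Qed.

Lemma moll_cts (n m : nat) : cts (moll n m).
Proof.
  intros q. unfold moll.
  apply (continuous_RInt_param (T := prod_UniformSpace R_UniformSpace R_UniformSpace) (fun s p => Derive_n rho n (fst p - s) * mollJ m (s, snd p))); [lra| |].
  - intros s _.
    apply (continuous_mult (K := R_AbsRing) (fun p : R * (R * R) => Derive_n rho n (fst (snd p) - fst p)) (fun p => mollJ m (fst p, snd (snd p)))).
    + apply (continuous_comp (fun p : R * (R * R) => fst (snd p) - fst p) (Derive_n rho n)); [|apply rho_cts].
      apply (continuous_minus (V := R_NormedModule) (fun p : R * (R * R) => fst (snd p)) (fun p => fst p)).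
      * apply (continuous_comp snd fst); [apply continuous_snd|apply continuous_fst].
      * apply continuous_fst.
    + apply (continuous_comp_2 (fun p : R * (R * R) => fst p) (fun p => snd (snd p)) (fun x y => mollJ m (x, y))).
      * apply continuous_fst.
      * apply (continuous_comp snd snd); apply continuous_snd.
      * apply (continuous_ext (mollJ m)); [intros [? ?]; reflexivity|apply mollJ_cts].
  - intros z s. apply (continuous_mult (K := R_AbsRing) (fun s => Derive_n rho n (fst z - s)) (fun s => mollJ m (s, snd z))).
    + apply (continuous_comp (fun s => fst z - s) (Derive_n rho n)); [|apply rho_cts].
      apply (ex_derive_continuous (V := R_NormedModule)). auto_derive. exact I.
    + apply cts_fst_slice, mollJ_cts.
Qed.

Lemma rho_shift_derive (n : nat) (x s : R) : is_derive (fun x => Derive_n rho n (x - s)) x (Derive_n rho (S n) (x - s)).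
Proof.
  replace (Derive_n rho (S n) (x - s)) with (scal 1 (Derive_n rho (S n) (x - s))) by (unfold scal; simpl; unfold mult; simpl; ring).
  apply (is_derive_comp (V := R_NormedModule) (Derive_n rho n) (fun x => x - s)).
  - apply (Dn_Derive_n rho n Hrho).
  - auto_derive; [exact I|ring].
Qed.

Lemma is_derive_scal_const (k : R) (f : R -> R) (x l : R) : is_derive f x l -> is_derive (fun t => k * f t) x (k * l).
Proof. intros H. apply (is_derive_scal f x k l H). Qed.

Lemma cts_rho_sub (n : nat) (a c : pt -> R) : cts a -> cts c -> cts (fun q => Derive_n rho n (a q - c q)).
Proof. intros Ha Hc. apply (cts_comp1 (Derive_n rho n)); [apply rho_cts|apply cts_minus; assumption]. Qed.

Lemma mollJ_dy (m : nat) (s y : R) : is_derive (fun y => mollJ m (s, y)) y (mollJ (S m) (s, y)).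
Proof.
  apply (inner_derive L (fun q => u (s, snd q) * Derive_n rho m (fst q - snd q)) (fun q => u (s, snd q) * Derive_n rho (S m) (fst q - snd q))).
  - apply cts_mult; [apply cts_comp2; [assumption|apply cts_const|apply cts_snd]|apply cts_rho_sub; [apply cts_fst|apply cts_snd]].
  - apply cts_mult; [apply cts_comp2; [assumption|apply cts_const|apply cts_snd]|apply cts_rho_sub; [apply cts_fst|apply cts_snd]].
  - intros x t. cbn [fst snd]. apply is_derive_scal_const, rho_shift_derive.
Qed.

Lemma moll_dx (n m : nat) (x y : R) : is_derive (fun x => moll n m (x, y)) x (moll (S n) m (x, y)).
Proof.
  apply (inner_derive L (fun q => Derive_n rho n (fst q - snd q) * mollJ m (snd q, y)) (fun q => Derive_n rho (S n) (fst q - snd q) * mollJ m (snd q, y))).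
  - apply cts_mult; [apply cts_rho_sub; [apply cts_fst|apply cts_snd]|apply cts_comp2; [apply mollJ_cts|apply cts_snd|apply cts_const]].
  - apply cts_mult; [apply cts_rho_sub; [apply cts_fst|apply cts_snd]|apply cts_comp2; [apply mollJ_cts|apply cts_snd|apply cts_const]].
  - intros z t. cbn [fst snd]. rewrite Rmult_comm.
    apply (is_derive_ext (fun x => mollJ m (t, y) * Derive_n rho n (x - t))); [intros; apply Rmult_comm|].
    apply is_derive_scal_const, rho_shift_derive.
Qed.

Lemma moll_dy (n m : nat) (x y : R) : is_derive (fun y => moll n m (x, y)) y (moll n (S m) (x, y)).
Proof.
  apply (inner_derive L (fun q => Derive_n rho n (x - snd q) * mollJ m (snd q, fst q)) (fun q => Derive_n rho n (x - snd q) * mollJ (S m) (snd q, fst q))).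
  - apply cts_mult; [apply cts_rho_sub; [apply cts_const|apply cts_snd]|apply cts_comp2; [apply mollJ_cts|apply cts_snd|apply cts_fst]].
  - apply cts_mult; [apply cts_rho_sub; [apply cts_const|apply cts_snd]|apply cts_comp2; [apply mollJ_cts|apply cts_snd|apply cts_fst]].
  - intros z t. cbn [fst snd]. apply is_derive_scal_const, mollJ_dy.
Qed.

Lemma moll_smooth : forall n m, smooth (moll n m).
Proof.
  cofix CH. intros n m. apply (smooth_intro (moll n m) (moll (S n) m) (moll n (S m))).
  - apply cont2_cts, moll_cts.
  - intros x y. apply is_derive_Reals, moll_dx.
  - intros x y. apply is_derive_Reals, moll_dy.
  - apply CH.
  - apply CH.
Qed.

Lemma moll_C1p (n m : nat) (p : pt) : C1p (moll n m) (moll (S n) m) (moll n (S m)) p.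
Proof.
  destruct p as [x y]. split; [|split; [|split; [|split]]].
  - apply moll_dx.
  - apply moll_dy.
  - apply moll_cts.
  - apply moll_cts.
  - apply moll_cts.
Qed.

Definition ker (n m : nat) (p q : pt) : R := Derive_n rho n (fst p - fst q) * Derive_n rho m (snd p - snd q).

Lemma ker_cts (n m : nat) (p : pt) : cts (ker n m p).
Proof.
  apply cts_mult; apply cts_rho_sub; try apply cts_const; [apply cts_fst|apply cts_snd].
Qed.

Lemma moll_I2 (n m : nat) (p : pt) : moll n m p = I2 L (fun q => u q * ker n m p q).
Proof.
  unfold moll, I2. apply RInt_ext. intros s _. unfold mollJ, inner, ker. cbn [fst snd].
  change (Derive_n rho n (fst p - s) * RInt (fun t => u (s, t) * Derive_n rho m (snd p - t)) (- L) L)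
    with (scal (Derive_n rho n (fst p - s)) (RInt (fun t => u (s, t) * Derive_n rho m (snd p - t)) (- L) L)).
  rewrite <- (RInt_scal (V := R_CompleteNormedModule)).
  - apply RInt_ext. intros t _. unfold scal; simpl; unfold mult; simpl. ring.
  - apply (@ex_RInt_continuous R_CompleteNormedModule). intros t _.
    apply (continuous_mult (K := R_AbsRing) (fun t => u (s, t)) (fun t => Derive_n rho m (snd p - t))).
    + apply cts_snd_slice, Hu.
    + apply (continuous_comp (fun t => snd p - t) (Derive_n rho m)); [|apply rho_cts].
      apply (ex_derive_continuous (V := R_NormedModule)). auto_derive. exact I.
Qed.
End Mollify.

(** Integration by parts on the square moves the derivative from the kernel to [u]; the boundary
    terms vanish with [u]. *)
Lemma moll_grad (rho : R -> R) (L : R) (u ux uy : pt -> R) (p : pt) :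
  (forall n, Dn n rho) -> 0 < L -> (forall p, C1p u ux uy p) -> outside0 L u ->
  moll rho L u 1 0 p = moll rho L ux 0 0 p /\ moll rho L u 0 1 p = moll rho L uy 0 0 p.
Proof.
  intros Hrho HL Hu H0. destruct (C1p_cts _ _ _ Hu) as (Cu & Cx & Cy).
  assert (Hk : forall q, C1p (ker rho 0 0 p) (fun q => - ker rho 1 0 p q) (fun q => - ker rho 0 1 p q) q).
  { intros q.
    assert (HD : forall n x, is_derive (Derive_n rho n) x (Derive_n rho (S n) x)) by (intros n; apply (Dn_Derive_n rho n Hrho)).
    eapply C1p_ext; [| | |apply (C1p_mult _ _ _ _ _ _ q
      (C1p_comp (Derive_n rho 0) (Derive_n rho 1) _ _ _ q (HD 0%nat _) (rho_cts rho Hrho 1 _)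
        (C1p_plus _ _ _ _ _ _ q (C1p_const (fst p) q) (C1p_scal (-1) _ _ _ q (C1p_fst q))))
      (C1p_comp (Derive_n rho 0) (Derive_n rho 1) _ _ _ q (HD 0%nat _) (rho_cts rho Hrho 1 _)
        (C1p_plus _ _ _ _ _ _ q (C1p_const (snd p) q) (C1p_scal (-1) _ _ _ q (C1p_snd q)))))];
    intros w; cbv beta; unfold ker;
    replace (fst p + -1 * fst w) with (fst p - fst w) by ring; replace (snd p + -1 * snd w) with (snd p - snd w) by ring; ring. }
  assert (HP : forall q, C1p (fun q => u q * ker rho 0 0 p q) (fun q => ux q * ker rho 0 0 p q + u q * - ker rho 1 0 p q)
     (fun q => uy q * ker rho 0 0 p q + u q * - ker rho 0 1 p q) q) by (intros q; apply C1p_mult; [apply Hu|apply Hk]).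
  destruct (C1p_I2x L _ _ _ ltac:(lra) HP) as [Ix Iy].
  { intros x y Hxy. rewrite H0 by assumption. ring. }
  assert (split_I : forall (w : pt -> R) (n m : nat), cts w ->
     I2 L (fun q => w q * ker rho 0 0 p q + u q * - ker rho n m p q) = 0 -> moll rho L u n m p = moll rho L w 0 0 p).
  { intros w n m Hw HI. rewrite !moll_I2 by (assumption || lra).
    assert (e1 : ex_I2 L (fun q => w q * ker rho 0 0 p q)) by (apply cts_ex_I2; [lra|apply cts_mult; [assumption|apply ker_cts, Hrho]]).
    assert (e2 : ex_I2 L (fun q => u q * ker rho n m p q)) by (apply cts_ex_I2; [lra|apply cts_mult; [assumption|apply ker_cts, Hrho]]).
    destruct (ex_I2_scal L (-1) _ e2) as [e3 i3]. destruct (ex_I2_plus L _ _ e1 e3) as [_ i4].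
    rewrite i3 in i4.
    rewrite (I2_ext L _ (fun q => w q * ker rho 0 0 p q + u q * - ker rho n m p q)) in i4 by (intros; ring).
    rewrite HI in i4. lra. }
  split; apply split_I; assumption.
Qed.

(** An average against a nonnegative kernel of mass 1. Its support is a square of half side [e],
    hence contained in the disc of radius [2 * e]. *)
Lemma moll_approx (rho : R -> R) (e L : R) (f : pt -> R) (p : pt) (om : R) :
  (forall n, Dn n rho) -> (forall x, 0 <= rho x) -> (forall x, e <= Rabs x -> rho x = 0) ->
  (forall L x, Rabs x <= L - e -> RInt (fun s => rho (x - s)) (- L) L = 1) ->
  0 < e -> 0 < L -> cts f -> Rabs (fst p) <= L - e -> Rabs (snd p) <= L - e ->
  (forall q, pdist p q <= 2 * e -> Rabs (f q - f p) <= om) -> 0 <= om ->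
  Rabs (moll rho L f 0 0 p - f p) <= om.
Proof.
  intros Hrho Hpos Hout Hint He HL Cf Hx Hy Hom Hom0. rewrite moll_I2 by assumption.
  assert (Ck : cts (ker rho 0 0 p)) by (apply ker_cts, Hrho).
  assert (I1 : I2 L (ker rho 0 0 p) = 1).
  { unfold I2, inner, ker. cbn [fst snd]. rewrite <- (Hint L (fst p) Hx). apply RInt_ext. intros s _.
    change (RInt (fun y => scal (Derive_n rho 0 (fst p - s)) (Derive_n rho 0 (snd p - y))) (- L) L = rho (fst p - s)).
    rewrite (RInt_scal (V := R_CompleteNormedModule)).
    - simpl Derive_n. rewrite (Hint L (snd p) Hy). unfold scal; simpl; unfold mult; simpl. ring.
    - apply (@ex_RInt_continuous R_CompleteNormedModule). intros t _.
      apply (continuous_comp (fun t => snd p - t) (Derive_n rho 0)); [|apply rho_cts, Hrho].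
      apply (ex_derive_continuous (V := R_NormedModule)). auto_derive. exact I. }
  assert (e1 : ex_I2 L (fun q => f q * ker rho 0 0 p q)) by (apply cts_ex_I2; [lra|apply cts_mult; assumption]).
  assert (e0 : ex_I2 L (ker rho 0 0 p)) by (apply cts_ex_I2; [lra|assumption]).
  assert (Hk : forall q, 0 <= ker rho 0 0 p q) by (intros q; apply Rmult_le_pos; apply Hpos).
  assert (Hfar : forall q, 2 * e < pdist p q -> ker rho 0 0 p q = 0).
  { intros q Hq. destruct (pdist_bounds p q) as (_ & _ & B). rewrite (Rabs_minus_sym (fst q)), (Rabs_minus_sym (snd q)) in B.
    unfold ker. simpl Derive_n.
    destruct (Rle_or_lt e (Rabs (fst p - fst q))); [rewrite Hout by assumption; ring|].
    rewrite (Hout (snd p - snd q)); [ring|lra]. }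
  assert (Hb : forall q, (f p - om) * ker rho 0 0 p q <= f q * ker rho 0 0 p q <= (f p + om) * ker rho 0 0 p q).
  { intros q. destruct (Rlt_or_le (2 * e) (pdist p q)) as [H|H].
    - rewrite Hfar by assumption. lra.
    - specialize (Hom q H). apply Rabs_le_between in Hom. specialize (Hk q). split; apply Rmult_le_compat_r; lra. }
  destruct (ex_I2_scal L (f p - om) _ e0) as [e2 i2]. destruct (ex_I2_scal L (f p + om) _ e0) as [e3 i3].
  rewrite I1 in i2, i3.
  apply Rabs_le_between. split.
  - assert (I2 L (fun q => (f p - om) * ker rho 0 0 p q) <= I2 L (fun q => f q * ker rho 0 0 p q))
      by (apply I2_le; [lra|assumption|assumption|intros; apply Hb]). lra.
  - assert (I2 L (fun q => f q * ker rho 0 0 p q) <= I2 L (fun q => (f p + om) * ker rho 0 0 p q))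
      by (apply I2_le; [lra|assumption|assumption|intros; apply Hb]). lra.
Qed.

Lemma moll_zero (rho : R -> R) (e L : R) (f : pt -> R) (p : pt) :
  (forall n, Dn n rho) -> (forall x, e <= Rabs x -> rho x = 0) ->
  0 < L -> cts f -> (forall q, pdist p q <= 2 * e -> f q = 0) -> moll rho L f 0 0 p = 0.
Proof.
  intros Hrho Hout HL Cf H0. rewrite moll_I2 by assumption.
  rewrite (I2_ext L _ (fun _ => 0)); [rewrite I2_const; ring|]. intros q.
  destruct (Rle_or_lt (pdist p q) (2 * e)) as [H|H]; [rewrite H0 by assumption; ring|].
  destruct (pdist_bounds p q) as (_ & _ & B). rewrite (Rabs_minus_sym (fst q)), (Rabs_minus_sym (snd q)) in B.
  unfold ker. simpl Derive_n.
  destruct (Rle_or_lt e (Rabs (fst p - fst q))); [rewrite Hout by assumption; ring|].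
  rewrite (Hout (snd p - snd q)); [ring|lra].
Qed.

(** * The Hardy inequality for C1 functions *)

Lemma quotient_cts (w d : pt -> R) : cts w -> cts d -> (forall p, support w p -> 0 < d p) ->
  cts (fun p => w p ^ 2 / d p ^ 2).
Proof.
  intros Hw Hd Hs p. destruct (classic (support w p)) as [Hp|Hp].
  - specialize (Hs p Hp). apply (cont_mult (fun p => w p ^ 2) (fun p => / d p ^ 2)).
    + apply (cont_comp (fun t => t ^ 2)); [|apply Hw].
      apply (ex_derive_continuous (V := R_NormedModule)). auto_derive. exact I.
    + apply (cont_comp (fun t => / t ^ 2)); [|apply Hd].
      apply (ex_derive_continuous (V := R_NormedModule)). auto_derive. nra.
  - apply (continuous_ext_loc _ (fun _ => 0)); [|apply continuous_const].
    assert (exists e, 0 < e /\ forall q, pdist p q < e -> w q = 0) as [e [He H0]].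
    { apply NNPP. intros Hn. apply Hp. intros e He. apply NNPP. intros Hn'. apply Hn.
      exists e. split; [lra|]. intros q Hq. apply NNPP. intros Hq0. apply Hn'. exists q. split; assumption. }
    apply locally_pdist. exists e. split; [assumption|]. intros q Hq. rewrite (H0 q Hq).
    change (0 = 0 ^ 2 * / d q ^ 2 :> R). ring.
Qed.

Lemma sq_close (a a' M om : R) : a ^ 2 <= M -> Rabs (a' - a) <= om -> om <= 1 ->
  a' ^ 2 <= a ^ 2 + om * (M + 2) /\ a ^ 2 - om * (M + 2) <= a' ^ 2.
Proof.
  intros HM Ho H1. assert (0 <= om) by (pose proof (Rabs_pos (a' - a)); lra).
  apply Rabs_le_between in Ho. set (t := a' - a) in *. replace a' with (a + t) by (unfold t; ring).
  assert (B : Rabs (2 * a * t) <= (a ^ 2 + 1) * om).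
  { rewrite Rabs_mult. apply Rmult_le_compat; try apply Rabs_pos; [|apply Rabs_le_between; lra].
    apply Rabs_le_between. pose proof (pow2_ge_0 (a - 1)). pose proof (pow2_ge_0 (a + 1)). split; lra. }
  apply Rabs_le_between in B. assert (0 <= t ^ 2 <= om) by (split; [apply pow2_ge_0|nra]).
  assert ((a ^ 2 + 1) * om <= (M + 1) * om) by (apply Rmult_le_compat_r; lra).
  split; lra.
Qed.

(** The test function that shows sharpness is only C1, whereas [hardy_ineq] speaks of smooth ones.
    Mollification bridges the gap since the support keeps a distance [d] from the complement, where
    the weight is bounded. The margin 3 of the square makes room for the gradient and for the
    mollified function. *)
Lemma hardy_C1 (Om : pt -> Prop) (c L0 d : R) (u ux uy : pt -> R) : (exists q, boundary2 Om q) ->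
  hardy_ineq Om c -> 0 <= c -> (forall p, C1p u ux uy p) -> 0 < L0 -> outside0 L0 u -> 0 < d ->
  (forall p q, u p <> 0 -> pdist p q < d -> Om q) ->
  cts (fun p => u p ^ 2 / bdist Om p ^ 2) /\
  c * I2 (L0 + 3) (fun p => u p ^ 2 / bdist Om p ^ 2) <= I2 (L0 + 3) (fun p => ux p ^ 2 + uy p ^ 2).
Proof.
  intros Hne Hh Hc Hu HL0 HuL Hd HO.
  destruct (C1p_cts _ _ _ Hu) as (Cu & Cx & Cy).
  set (L := L0 + 1). assert (HL : 0 < L) by (unfold L; lra).
  assert (Hsupp : forall p, support u p -> d / 2 <= bdist Om p).
  { intros p Hp. apply bdist_ball; [assumption|]. intros q Hq. destruct (Hp (d / 2)) as [w [Hw Hpw]]; [lra|].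
    apply (HO w q Hw). pose proof (pdist_tri w p q). rewrite (pdist_sym w p) in *. lra. }
  assert (Cq : cts (fun p => u p ^ 2 / bdist Om p ^ 2)).
  { apply quotient_cts; [assumption|apply bdist_cts, Hne|]. intros p Hp. specialize (Hsupp p Hp). lra. }
  split; [assumption|].
  assert (Hoff : forall x y, L <= Rabs x \/ L <= Rabs y -> u (x, y) = 0 /\ ux (x, y) = 0 /\ uy (x, y) = 0).
  { intros x y Hxy. apply (locally_singleton _ _ (off_support u ux uy (x, y) Hu ltac:(
      intros Hs; destruct (Hs 1 Rlt_0_1) as [[s t] [Hw Hqw]]; apply Hw, HuL;
      destruct (pdist_bounds (x, y) (s, t)) as (B1 & B2 & _); cbn [fst snd] in B1, B2;
      pose proof (Rabs_triang_inv x s); pose proof (Rabs_triang_inv y t);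
      rewrite (Rabs_minus_sym s) in B1; rewrite (Rabs_minus_sym t) in B2;
      unfold L in Hxy; destruct Hxy; [left|right]; lra))). }
  assert (H0 : outside0 L u) by (intros x y Hxy; apply (Hoff x y Hxy)).
  assert (Oux : outside0 L ux) by (intros x y Hxy; apply (Hoff x y Hxy)).
  assert (Ouy : outside0 L uy) by (intros x y Hxy; apply (Hoff x y Hxy)).
  destruct (compact_bound u L Cu H0) as [M [HM0 HM]].
  destruct (compact_bound ux L Cx Oux) as [M1 [HM10 HM1]].
  destruct (compact_bound uy L Cy Ouy) as [M2 [HM20 HM2]].
  replace (L0 + 3) with (L + 2) by (unfold L; ring). set (L' := L + 2).
  (* [k * om] is the total error when [u] and its partial derivatives are known up to [om]: [c]
     times the error of the weighted term, plus those of the two squared derivatives, over the area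
     of the square. *)
  set (k := (2 * L') ^ 2 * (c * (4 / d ^ 2 * (M + 2)) + (M1 + 2) + (M2 + 2))).
  assert (Hd2 : 0 < 4 / d ^ 2) by (apply Rdiv_lt_0_compat; [lra|apply pow_lt, Hd]).
  assert (Hk : 0 <= k).
  { unfold k. apply Rmult_le_pos; [apply pow2_ge_0|]. assert (0 <= c * (4 / d ^ 2 * (M + 2))) by (repeat apply Rmult_le_pos; lra). lra. }
  apply le_epsilon. intros eps Heps.
  set (om := Rmin 1 (eps / (k + 1))).
  assert (Hom : 0 < om /\ om <= 1 /\ k * om <= eps).
  { unfold om. split; [apply Rmin_pos; [lra|apply Rdiv_lt_0_compat; lra]|]. split; [apply Rmin_l|].
    apply Rle_trans with (k * (eps / (k + 1))); [apply Rmult_le_compat_l; [assumption|apply Rmin_r]|].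
    replace (k * (eps / (k + 1))) with (eps * (k / (k + 1))) by (field; lra).
    assert (k / (k + 1) <= 1) by (apply Rle_div_l; lra). nra. }
  destruct Hom as (Hom0 & Hom1 & Homk).
  destruct (unif_cont u L HL Cu H0 om Hom0) as [d0' [Hd0 D0]].
  destruct (unif_cont ux L HL Cx Oux om Hom0) as [d1 [Hd1 D1]].
  destruct (unif_cont uy L HL Cy Ouy om Hom0) as [d2 [Hd2' D2]].
  (* [d / 8] leaves the mollified support, within [3 * e] of that of [u], at distance [d / 2] from
     the complement; [1 / 4] keeps it in the larger square; the other bounds put [2 * e] within the
     moduli of continuity. *)
  set (e := Rmin (Rmin (d / 8) (1 / 4)) (Rmin (d0' / 4) (Rmin (d1 / 4) (d2 / 4)))).
  assert (He : 0 < e /\ e <= d / 8 /\ e <= 1 / 4 /\ e <= d0' / 4 /\ e <= d1 / 4 /\ e <= d2 / 4).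
  { unfold e. split; [repeat apply Rmin_pos; lra|].
    pose proof (Rmin_l (Rmin (d / 8) (1 / 4)) (Rmin (d0' / 4) (Rmin (d1 / 4) (d2 / 4)))).
    pose proof (Rmin_r (Rmin (d / 8) (1 / 4)) (Rmin (d0' / 4) (Rmin (d1 / 4) (d2 / 4)))).
    pose proof (Rmin_l (d / 8) (1 / 4)). pose proof (Rmin_r (d / 8) (1 / 4)).
    pose proof (Rmin_l (d0' / 4) (Rmin (d1 / 4) (d2 / 4))). pose proof (Rmin_r (d0' / 4) (Rmin (d1 / 4) (d2 / 4))).
    pose proof (Rmin_l (d1 / 4) (d2 / 4)). pose proof (Rmin_r (d1 / 4) (d2 / 4)). lra. }
  destruct He as (He & He1 & He2 & He3 & He4 & He5).
  destruct (bump_exists e He) as (rho & Hrho & Rpos & Rout & Rint1).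
  assert (HL' : 0 < L') by (unfold L'; lra).
  set (W := moll rho L' u 0 0). set (Wx := moll rho L' u 1 0). set (Wy := moll rho L' u 0 1).
  assert (HW : forall p, C1p W Wx Wy p) by (intros p; apply moll_C1p; assumption).
  destruct (C1p_cts _ _ _ HW) as (CW & CWx & CWy).
  assert (O' : outside0 L' u) by (intros x y Hxy; apply H0; unfold L' in Hxy; lra).
  assert (EWx : forall p, Wx p = moll rho L' ux 0 0 p /\ Wy p = moll rho L' uy 0 0 p).
  { intros p. apply moll_grad; assumption. }
  assert (Hnear : forall p, W p <> 0 -> exists q, u q <> 0 /\ pdist p q <= 2 * e).
  { intros p Hp. apply NNPP. intros Hn. apply Hp. apply (moll_zero rho e); try assumption.
    intros q Hq. apply NNPP. intros Hq0. apply Hn. exists q. auto. }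
  assert (WO : forall p, support W p -> exists q, u q <> 0 /\ pdist p q <= 3 * e).
  { intros p Hp. destruct (Hp e He) as [w [Hw Hpw]]. destruct (Hnear w Hw) as [q [Hq Hwq]].
    exists q. split; [assumption|]. pose proof (pdist_tri p w q). lra. }
  assert (Wbd : forall p, support W p -> d / 2 <= bdist Om p).
  { intros p Hp. destruct (WO p Hp) as [q [Hq Hpq]]. apply bdist_ball; [assumption|]. intros z Hz.
    apply (HO q z Hq). pose proof (pdist_tri q p z). rewrite (pdist_sym q p) in *. lra. }
  assert (Wsmall : forall (f : pt -> R) p, cts f -> outside0 L f -> L + 1 <= Rabs (fst p) \/ L + 1 <= Rabs (snd p) -> moll rho L' f 0 0 p = 0).
  { intros f p Cf Of Hp. apply (moll_zero rho e); try assumption. intros [x y] Hq. apply Of.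
    destruct (pdist_bounds p (x, y)) as (B1 & B2 & _). simpl in B1, B2.
    pose proof (Rabs_triang_inv (fst p) x) as T1. pose proof (Rabs_triang_inv (snd p) y) as T2.
    rewrite (Rabs_minus_sym (fst p)) in T1. rewrite (Rabs_minus_sym (snd p)) in T2. destruct Hp; [left|right]; lra. }
  assert (Hclose : forall (f : pt -> R) p, cts f -> outside0 L f ->
    (forall q, pdist p q <= 2 * e -> Rabs (f q - f p) <= om) -> Rabs (moll rho L' f 0 0 p - f p) <= om).
  { intros f p Cf Of Hf. destruct (classic (L + 1 <= Rabs (fst p) \/ L + 1 <= Rabs (snd p))) as [Hp|Hp].
    - rewrite Wsmall by assumption. destruct p as [x y]. rewrite Of by (simpl in Hp; lra). rewrite Rminus_0_r, Rabs_R0. lra.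
    - assert (Hp' : Rabs (fst p) < L + 1 /\ Rabs (snd p) < L + 1) by (split; apply Rnot_le_lt; intros H'; apply Hp; tauto).
      apply (moll_approx rho e); try assumption; unfold L'; lra. }
  assert (WL : outside0 L' W) by (intros x y Hxy; apply Wsmall; try assumption; simpl; unfold L' in Hxy; lra).
  assert (WLx : outside0 L' Wx).
  { intros x y Hxy. rewrite (proj1 (EWx (x, y))). apply Wsmall; try assumption; simpl; unfold L' in Hxy; lra. }
  assert (WLy : outside0 L' Wy).
  { intros x y Hxy. rewrite (proj2 (EWx (x, y))). apply Wsmall; try assumption; simpl; unfold L' in Hxy; lra. }
  assert (Htest : test_fn Om W).
  { split; [apply moll_smooth; assumption|]. split.
    - apply (outside0_bounded W L' WL).
    - intros p Hp. destruct (WO p Hp) as [q [Hq Hpq]]. apply (HO q p Hq). rewrite pdist_sym. lra. }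
  destruct (C1p_partial _ _ _ HW) as [Px Py].
  assert (CWq : cts (fun p => W p ^ 2 / bdist Om p ^ 2)).
  { apply quotient_cts; [assumption|apply bdist_cts, Hne|]. intros p Hp. specialize (Wbd p Hp). lra. }
  assert (csq : forall f, cts f -> cts (fun p => f p ^ 2)).
  { intros f Cf. apply (cts_comp1 (fun t => t ^ 2)); [|assumption].
    intros x. apply (ex_derive_continuous (V := R_NormedModule)). auto_derive. exact I. }
  assert (CWg : cts (fun p => Wx p ^ 2 + Wy p ^ 2)) by (apply cts_plus; apply csq; assumption).
  assert (Cg : cts (fun p => ux p ^ 2 + uy p ^ 2)) by (apply cts_plus; apply csq; assumption).
  pose proof (Hh W Wx Wy _ _ Htest Px Py
    (integral2_cts L' _ ltac:(lra) CWg ltac:(intros x y Hxy; rewrite WLx, WLy by assumption; ring))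
    (integral2_cts L' _ ltac:(lra) CWq ltac:(intros x y Hxy; rewrite WL by assumption; unfold Rdiv; ring))) as Hmain.
  set (K1 := 4 / d ^ 2 * (om * (M + 2))).
  set (K2 := om * (M1 + 2) + om * (M2 + 2)).
  assert (ex : forall f, cts f -> ex_I2 L' f) by (intros f Cf; apply cts_ex_I2; [lra|assumption]).
  assert (Hlow : I2 L' (fun p => u p ^ 2 / bdist Om p ^ 2 + - K1) <= I2 L' (fun p => W p ^ 2 / bdist Om p ^ 2)).
  { apply I2_le; [lra|apply ex, cts_plus; [assumption|apply cts_const]|apply ex; assumption|].
    intros x y _ _. set (p := (x, y)).
    assert (Hw : Rabs (W p - u p) <= om).
    { apply Hclose; try assumption. intros q Hq. apply Rlt_le, D0. lra. }
    destruct (sq_close (u p) (W p) M om (HM p) Hw Hom1) as [_ Hs].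
    assert (HK1 : 0 <= K1) by (unfold K1; repeat apply Rmult_le_pos; lra).
    assert (Hbb : 0 <= W p ^ 2 / bdist Om p ^ 2).
    { unfold Rdiv. apply Rmult_le_pos; [apply pow2_ge_0|]. 
      destruct (Req_dec (bdist Om p) 0) as [->|Hnz]; [rewrite pow_i by lia; rewrite Rinv_0; lra|].
      apply Rlt_le, Rinv_0_lt_compat. pose proof (pow2_ge_0 (bdist Om p)). pose proof (pow_nonzero _ 2 Hnz). lra. }
    destruct (Req_dec (u p) 0) as [Hu0|Hu0].
    - rewrite Hu0 at 1. replace (0 ^ 2 / bdist Om p ^ 2) with 0 by (unfold Rdiv; ring). lra.
    - pose proof (Hsupp p (closure2_incl _ p Hu0)) as Hbp.
      assert (Hi : / bdist Om p ^ 2 <= 4 / d ^ 2).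
      { replace (4 / d ^ 2) with (/ (d / 2) ^ 2) by (field; lra). apply Rinv_le_contravar; [apply pow_lt; lra|]. apply pow_incr. lra. }
      assert (Hi0 : 0 < / bdist Om p ^ 2) by (apply Rinv_0_lt_compat, pow_lt; lra).
      assert (Hom' : 0 <= om * (M + 2)) by (apply Rmult_le_pos; lra).
      assert (om * (M + 2) * / bdist Om p ^ 2 <= K1).
      { unfold K1. rewrite (Rmult_comm (4 / d ^ 2)). apply Rmult_le_compat_l; assumption. }
      assert ((u p ^ 2 - om * (M + 2)) * / bdist Om p ^ 2 <= W p ^ 2 * / bdist Om p ^ 2) by (apply Rmult_le_compat_r; lra).
      unfold Rdiv. lra. }
  assert (Hup : I2 L' (fun p => Wx p ^ 2 + Wy p ^ 2) <= I2 L' (fun p => ux p ^ 2 + uy p ^ 2 + K2)).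
  { apply I2_le; [lra|apply ex; assumption|apply ex, cts_plus; [assumption|apply cts_const]|].
    intros x y _ _. set (p := (x, y)). destruct (EWx p) as [Ex Ey].
    assert (Hw1 : Rabs (Wx p - ux p) <= om).
    { rewrite Ex. apply Hclose; try assumption. intros q Hq. apply Rlt_le, D1. lra. }
    assert (Hw2 : Rabs (Wy p - uy p) <= om).
    { rewrite Ey. apply Hclose; try assumption. intros q Hq. apply Rlt_le, D2. lra. }
    destruct (sq_close (ux p) (Wx p) M1 om (HM1 p) Hw1 Hom1) as [Hs1 _].
    destruct (sq_close (uy p) (Wy p) M2 om (HM2 p) Hw2 Hom1) as [Hs2 _]. unfold K2. lra. }
  destruct (ex_I2_plus L' _ _ (ex _ Cq) (ex _ (cts_const (- K1)))) as [_ i1].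
  destruct (ex_I2_plus L' _ _ (ex _ Cg) (ex _ (cts_const K2))) as [_ i2].
  rewrite i1, I2_const in Hlow. rewrite i2, I2_const in Hup.
  set (Iq := I2 L' (fun p => u p ^ 2 / bdist Om p ^ 2)) in *. set (Ig := I2 L' (fun p => ux p ^ 2 + uy p ^ 2)) in *.
  set (Wq := I2 L' (fun p => W p ^ 2 / bdist Om p ^ 2)) in *. set (Wg := I2 L' (fun p => Wx p ^ 2 + Wy p ^ 2)) in *.
  assert (Hcl : c * (Iq + - K1 * (2 * L') ^ 2) <= c * Wq) by (apply Rmult_le_compat_l; assumption).
  assert (Hkk : k * om = c * K1 * (2 * L') ^ 2 + K2 * (2 * L') ^ 2) by (unfold k, K1, K2; ring).
  lra.
Qed.

(** * Existence of the ground state *)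

Lemma primitive_bound (G g : R -> R) (r C : R) (n : nat) : 0 <= C -> (forall x, is_derive G x (g x)) -> G 0 = 0 ->
  (forall t, Rabs t <= r -> Rabs (g t) <= C * Rabs t ^ n) ->
  forall x, Rabs x <= r -> Rabs (G x) <= C * Rabs x ^ S n / INR (S n).
Proof.
  intros HC.
  assert (pos : forall G g, (forall x, is_derive G x (g x)) -> G 0 = 0 ->
    (forall t, Rabs t <= r -> Rabs (g t) <= C * Rabs t ^ n) -> forall x, 0 <= x <= r -> Rabs (G x) <= C * x ^ S n / INR (S n)).
  { clear G g. intros G g HG G0 Hg x Hx.
    assert (HN : INR (S n) <> 0) by (apply not_0_INR; lia).
    assert (HP : forall t, is_derive (fun t => C * t ^ S n / INR (S n)) t (C * t ^ n)).
    { intros t. apply (is_derive_ext (fun t => C / INR (S n) * t ^ S n)); [intros s; change (C / INR (S n) * s ^ S n = C * s ^ S n / INR (S n)); field; assumption|].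
      replace (C * t ^ n) with (C / INR (S n) * (INR (S n) * 1 * t ^ n)) by (field; assumption).
      apply (is_derive_scal (fun t => t ^ S n)). apply (is_derive_pow (fun t => t) (S n) t 1). apply (is_derive_id (K := R_AbsRing) t). }
    assert (E0 : C * 0 ^ S n / INR (S n) = 0) by (simpl; unfold Rdiv; ring).
    assert (Hgt : forall t, 0 <= t <= x -> - (C * t ^ n) <= g t <= C * t ^ n).
    { intros t Ht. specialize (Hg t). rewrite (Rabs_pos_eq t) in Hg by lra. apply Rabs_le_between, Hg. lra. }
    assert (Hup : C * 0 ^ S n / INR (S n) - G 0 <= C * x ^ S n / INR (S n) - G x).
    { apply (derive_nonneg_incr (fun t => C * t ^ S n / INR (S n) - G t) (fun t => C * t ^ n - g t)); [lra| |].
      - intros t _. apply (is_derive_minus (V := R_NormedModule) (fun t => C * t ^ S n / INR (S n)) G); [apply HP|apply HG].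
      - intros t Ht. specialize (Hgt t Ht). lra. }
    assert (Hlo : C * 0 ^ S n / INR (S n) + G 0 <= C * x ^ S n / INR (S n) + G x).
    { apply (derive_nonneg_incr (fun t => C * t ^ S n / INR (S n) + G t) (fun t => C * t ^ n + g t)); [lra| |].
      - intros t _. apply (is_derive_plus (V := R_NormedModule) (fun t => C * t ^ S n / INR (S n)) G); [apply HP|apply HG].
      - intros t Ht. specialize (Hgt t Ht). lra. }
    rewrite E0, G0 in Hup, Hlo. apply Rabs_le_between. lra. }
  intros HG G0 Hg x Hx.
  destruct (Rle_or_lt 0 x) as [H|H].
  - rewrite (Rabs_pos_eq x) in * by assumption. apply (pos G g); [assumption|assumption|assumption|lra].
  - rewrite (Rabs_left x) in * by assumption.
    replace (G x) with (G (- - x)) by (f_equal; ring).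
    apply (pos (fun t => G (- t)) (fun t => - g (- t))); [| | |lra].
    + intros t. replace (- g (- t)) with (scal (-1) (g (- t))) by (unfold scal; simpl; unfold mult; simpl; ring).
      apply (is_derive_comp (V := R_NormedModule) G (fun t => - t)); [apply HG|]. auto_derive; [exact I|ring].
    + rewrite Ropp_0. assumption.
    + intros t Ht. rewrite Rabs_Ropp. rewrite <- (Rabs_Ropp t). apply Hg. rewrite Rabs_Ropp. assumption.
Qed.

Section Picard.
Context (p : R -> R) (M : R) (Hp : forall x, continuous p x) (HM : 0 <= M) (HpM : forall x, Rabs (p x) <= M).

Definition prim (f : R -> R) (x : R) : R := RInt f 0 x.

Lemma prim_derive (f : R -> R) (x : R) : (forall x, continuous f x) -> is_derive (prim f) x (f x).
Proof.
  intros Hf. apply (is_derive_RInt f (prim f) 0 x).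
  - apply filter_forall. intros t. apply (RInt_correct (V := R_CompleteNormedModule)).
    apply (@ex_RInt_continuous R_CompleteNormedModule). intros; apply Hf.
  - apply Hf.
Qed.

Lemma prim_continuous (f : R -> R) (x : R) : (forall x, continuous f x) -> continuous (prim f) x.
Proof. intros Hf. apply (ex_derive_continuous (V := R_NormedModule)). eexists. apply prim_derive, Hf. Qed.

Lemma prim_0 (f : R -> R) : prim f 0 = 0.
Proof. unfold prim. rewrite RInt_point. reflexivity. Qed.

(** The equation [psi'' = - p * psi] with [psi 0 = 1] and [psi' 0 = 0] is the fixed-point equation
    [psi = 1 - pint psi]. *)
Definition pint (f : R -> R) : R -> R := prim (prim (fun t => p t * f t)).

Lemma pf_continuous (f : R -> R) : (forall x, continuous f x) -> forall x, continuous (fun t => p t * f t) x.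
Proof. intros Hf x. apply (continuous_mult (K := R_AbsRing) p f); [apply Hp|apply Hf]. Qed.

Lemma pint_continuous (f : R -> R) : (forall x, continuous f x) -> forall x, continuous (pint f) x.
Proof. intros Hf x. apply prim_continuous. intros y. apply prim_continuous. intros z. apply pf_continuous, Hf. Qed.

Lemma pint_diff (f h : R -> R) (r C : R) (n : nat) : 0 <= C ->
  (forall x, continuous f x) -> (forall x, continuous h x) ->
  (forall t, Rabs t <= r -> Rabs (f t - h t) <= C * Rabs t ^ n) ->
  forall x, Rabs x <= r -> Rabs (pint f x - pint h x) <= M * C / INR (S n) * Rabs x ^ S (S n) / INR (S (S n)).
Proof.
  intros HC Hf Hh Hd.
  set (f1 := prim (fun t => p t * f t)). set (h1 := prim (fun t => p t * h t)).
  assert (Cf1 : forall x, continuous f1 x) by (intros x; apply prim_continuous, pf_continuous, Hf).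
  assert (Ch1 : forall x, continuous h1 x) by (intros x; apply prim_continuous, pf_continuous, Hh).
  assert (HN : 0 < INR (S n)) by (apply lt_0_INR; lia).
  assert (H1 : forall t, Rabs t <= r -> Rabs (f1 t - h1 t) <= M * C / INR (S n) * Rabs t ^ S n).
  { intros t Ht. replace (M * C / INR (S n) * Rabs t ^ S n) with (M * C * Rabs t ^ S n / INR (S n)) by (field; lra).
    apply (primitive_bound (fun x => f1 x - h1 x) (fun x => p x * f x - p x * h x) r).
    - apply Rmult_le_pos; assumption.
    - intros x. apply (is_derive_minus (V := R_NormedModule) f1 h1);
        [apply (prim_derive (fun t => p t * f t)), pf_continuous, Hf|apply (prim_derive (fun t => p t * h t)), pf_continuous, Hh].
    - unfold f1, h1. rewrite !prim_0. ring.
    - intros s Hs. replace (p s * f s - p s * h s) with (p s * (f s - h s)) by ring. rewrite Rabs_mult, Rmult_assoc.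
      apply Rmult_le_compat; [apply Rabs_pos|apply Rabs_pos|apply HpM|apply Hd, Hs].
    - assumption. }
  apply (primitive_bound (fun x => pint f x - pint h x) (fun x => f1 x - h1 x) r).
  - apply Rdiv_le_0_compat; [apply Rmult_le_pos|]; assumption.
  - intros x. apply (is_derive_minus (V := R_NormedModule) (pint f) (pint h)); [apply (prim_derive f1), Cf1|apply (prim_derive h1), Ch1].
  - unfold pint. rewrite !prim_0. ring.
  - assumption.
Qed.

Fixpoint iter (n : nat) : R -> R :=
  match n with O => fun _ => 1 | S n => fun x => 1 - pint (iter n) x end.

Lemma iter_continuous (n : nat) : forall x, continuous (iter n) x.
Proof.
  induction n as [|n IH]; intros x; simpl.
  - apply continuous_const.
  - apply (continuous_minus (V := R_NormedModule) (fun _ => 1) (pint (iter n))); [apply continuous_const|apply pint_continuous, IH].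
Qed.

(** This is [M^n / (2 * n)!], as two integrations raise the degree by two. The weaker bound
    [M^n / n!] suffices and lets the exponential series control the limit on every bounded
    interval. *)
Fixpoint cof (n : nat) : R :=
  match n with O => 1 | S n => M * cof n / INR (S (2 * n)) / INR (S (S (2 * n))) end.

Lemma cof_bound (n : nat) : 0 <= cof n <= M ^ n / INR (fact n).
Proof.
  induction n as [|n [IH1 IH2]]; [simpl; lra|]. cbn [cof].
  assert (H1 : 0 < INR (S (2 * n))) by (apply lt_0_INR; lia).
  assert (H1' : 1 <= INR (S (2 * n))) by (apply (le_INR 1); lia).
  assert (H2 : 0 < INR (S n)) by (apply lt_0_INR; lia).
  assert (H3 : INR (S n) <= INR (S (S (2 * n)))) by (apply le_INR; lia).
  assert (H4 : 0 < INR (fact n)) by (apply lt_0_INR, lt_O_fact).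
  split.
  - apply Rdiv_le_0_compat; [apply Rdiv_le_0_compat; [apply Rmult_le_pos; assumption|assumption]|lra].
  - rewrite fact_simpl, mult_INR. simpl pow.
    apply Rle_trans with (M * cof n / INR (S n)).
    + unfold Rdiv at 1 3. apply Rmult_le_compat.
      * apply Rdiv_le_0_compat; [apply Rmult_le_pos; assumption|assumption].
      * apply Rlt_le, Rinv_0_lt_compat. lra.
      * apply Rle_div_l; [assumption|]. assert (0 <= M * cof n) by (apply Rmult_le_pos; assumption). nra.
      * apply Rinv_le_contravar; assumption.
    + replace (M * M ^ n / (INR (S n) * INR (fact n))) with (M * (M ^ n / INR (fact n)) / INR (S n)) by (field; lra).
      unfold Rdiv at 1 2. apply Rmult_le_compat_r; [apply Rlt_le, Rinv_0_lt_compat; assumption|].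
      apply Rmult_le_compat_l; assumption.
Qed.

Lemma iter_step (n : nat) : forall x, Rabs (iter (S n) x - iter n x) <= cof (S n) * Rabs x ^ (2 * S n).
Proof.
  induction n as [|n IH]; intros x.
  - simpl iter. replace (1 - pint (fun _ => 1) x - 1) with (- (pint (fun _ => 1) x - pint (fun _ => 0) x)).
    + rewrite Rabs_Ropp.
      eapply Rle_trans; [apply (pint_diff (fun _ => 1) (fun _ => 0) (Rabs x) 1 0)|].
      * lra.
      * intros; apply continuous_const.
      * intros; apply continuous_const.
      * intros. rewrite Rminus_0_r, Rabs_R1. simpl. lra.
      * lra.
      * right. simpl. field.
    + assert (E : pint (fun _ => 0) x = 0).
      { unfold pint, prim. rewrite (RInt_ext _ (fun _ => 0)).
        - rewrite RInt_const. unfold scal; simpl; unfold mult; simpl. ring.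
        - intros y _. rewrite (RInt_ext _ (fun _ => 0)).
          + rewrite RInt_const. unfold scal; simpl; unfold mult; simpl. apply Rmult_0_r.
          + intros t _. apply Rmult_0_r. }
      rewrite E. ring.
  - change (iter (S (S n)) x) with (1 - pint (iter (S n)) x). change (iter (S n) x) with (1 - pint (iter n) x) at 1.
    replace (1 - pint (iter (S n)) x - (1 - pint (iter n) x)) with (- (pint (iter (S n)) x - pint (iter n) x)) by ring.
    rewrite Rabs_Ropp. eapply Rle_trans; [apply (pint_diff (iter (S n)) (iter n) (Rabs x) (cof (S n)) (2 * S n))|].
    + apply cof_bound.
    + apply iter_continuous.
    + apply iter_continuous.
    + intros t _. apply IH.
    + lra.
    + right. change (cof (S (S n))) with (M * cof (S n) / INR (S (2 * S n)) / INR (S (S (2 * S n)))).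
      replace (2 * S (S n))%nat with (S (S (2 * S n))) by lia. field. split; apply not_0_INR; lia.
Qed.

Definition esum (z : R) (n : nat) : R := sum_n (fun k => z ^ k / INR (fact k)) n.

Lemma esum_lim (z : R) : is_lim_seq (esum z) (exp z).
Proof.
  pose proof (is_exp_Reals z) as H. unfold is_pseries in H.
  apply (is_lim_seq_ext (sum_n (fun k => scal (pow_n z k) (/ INR (fact k))))); [|exact H].
  intros n. apply sum_n_ext. intros k. rewrite pow_n_pow. reflexivity.
Qed.

Lemma iter_esum (r : R) (n m : nat) (x : R) : Rabs x <= r -> (n <= m)%nat ->
  Rabs (iter m x - iter n x) <= esum (M * r ^ 2) m - esum (M * r ^ 2) n.
Proof.
  intros Hx Hnm. induction Hnm as [|m Hnm IH].
  - rewrite !Rminus_diag, Rabs_R0. lra.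
  - replace (iter (S m) x - iter n x) with ((iter (S m) x - iter m x) + (iter m x - iter n x)) by ring.
    eapply Rle_trans; [apply Rabs_triang|].
    assert (E : esum (M * r ^ 2) (S m) = esum (M * r ^ 2) m + (M * r ^ 2) ^ S m / INR (fact (S m))).
    { unfold esum. rewrite sum_Sn. reflexivity. }
    rewrite E. assert (Rabs (iter (S m) x - iter m x) <= (M * r ^ 2) ^ S m / INR (fact (S m))); [|lra].
    eapply Rle_trans; [apply iter_step|].
    replace ((M * r ^ 2) ^ S m / INR (fact (S m))) with (M ^ S m / INR (fact (S m)) * r ^ (2 * S m)).
    + apply Rmult_le_compat; [apply cof_bound|apply pow_le, Rabs_pos|apply cof_bound|].
      apply pow_incr. split; [apply Rabs_pos|assumption].
    + rewrite Rpow_mult_distr, pow_mult. unfold Rdiv. ring.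
Qed.

Definition psol (x : R) : R := real (Lim_seq (fun n => iter n x)).

Lemma psol_lim (x : R) : is_lim_seq (fun n => iter n x) (psol x).
Proof.
  apply Lim_seq_correct'. apply ex_lim_seq_cauchy_corr. intros eps.
  set (z := M * Rabs x ^ 2).
  assert (He : 0 < eps / 2) by (pose proof (cond_pos eps); lra).
  destruct (proj2 (is_lim_seq_spec _ _) (esum_lim z) (mkposreal _ He)) as [N HN]. cbn [pos] in HN.
  assert (H : forall n m, (N <= n)%nat -> (n <= m)%nat -> Rabs (iter m x - iter n x) < eps).
  { intros n m Hn Hm. eapply Rle_lt_trans; [apply (iter_esum (Rabs x)); [lra|assumption]|]. fold z.
    pose proof (HN n Hn) as A. pose proof (HN m ltac:(lia)) as B. apply Rabs_def2 in A. apply Rabs_def2 in B. lra. }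
  exists N. intros n m Hn Hm. destruct (Nat.le_ge_cases n m).
  - rewrite Rabs_minus_sym. apply H; assumption.
  - apply H; assumption.
Qed.

Lemma psol_approx (r : R) (n : nat) (x : R) : Rabs x <= r -> Rabs (psol x - iter n x) <= exp (M * r ^ 2) - esum (M * r ^ 2) n.
Proof.
  intros Hx.
  apply (is_lim_seq_le_loc (fun m => Rabs (iter m x - iter n x)) (fun m => esum (M * r ^ 2) m - esum (M * r ^ 2) n)
     (Rabs (psol x - iter n x)) (exp (M * r ^ 2) - esum (M * r ^ 2) n)).
  - exists n. intros m Hm. apply iter_esum; assumption.
  - apply (is_lim_seq_abs _ (psol x - iter n x)). apply is_lim_seq_minus'; [apply psol_lim|apply is_lim_seq_const].
  - apply is_lim_seq_minus'; [apply esum_lim|apply is_lim_seq_const].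
Qed.

Lemma tail_small (r eps : R) : 0 < eps -> exists n, forall m, (n <= m)%nat -> 0 <= exp (M * r ^ 2) - esum (M * r ^ 2) m < eps.
Proof.
  intros He. destruct (proj2 (is_lim_seq_spec _ _) (esum_lim (M * r ^ 2)) (mkposreal _ He)) as [N HN]. cbn [pos] in HN.
  exists N. intros m Hm. specialize (HN m Hm). apply Rabs_def2 in HN. split; [|lra].
  pose proof (psol_approx r m 0) as H. rewrite Rabs_R0 in H.
  destruct (Rle_or_lt 0 r) as [Hr|Hr]; [specialize (H Hr); pose proof (Rabs_pos (psol 0 - iter m 0)); lra|].
  pose proof (psol_approx (- r) m 0) as H'. rewrite Rabs_R0 in H'. specialize (H' ltac:(lra)).
  replace ((- r) ^ 2) with (r ^ 2) in H' by ring. pose proof (Rabs_pos (psol 0 - iter m 0)). lra.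
Qed.

Lemma psol_continuous (x : R) : continuous psol x.
Proof.
  intros P [e HP].
  assert (He3 : 0 < e / 3) by (pose proof (cond_pos e); lra).
  destruct (tail_small (Rabs x + 1) (e / 3) He3) as [n Hn]. specialize (Hn n (le_n n)).
  destruct (iter_continuous n x (fun y => Rabs (y - iter n x) < e / 3)) as [d Hd].
  { exists (mkposreal _ He3). intros y Hy. exact Hy. }
  assert (Hd1 : 0 < Rmin d 1) by (apply Rmin_pos; [apply cond_pos|lra]).
  exists (mkposreal _ Hd1). intros y Hy. apply HP.
  change (Rabs (y - x) < Rmin d 1) in Hy. change (Rabs (psol y - psol x) < e).
  pose proof (Rmin_l d 1). pose proof (Rmin_r d 1).
  assert (Hyx : Rabs y <= Rabs x + 1) by (pose proof (Rabs_triang_inv y x); lra).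
  pose proof (psol_approx _ n y Hyx) as A. pose proof (psol_approx (Rabs x + 1) n x ltac:(lra)) as B.
  assert (C : Rabs (iter n y - iter n x) < e / 3) by (apply Hd; change (Rabs (y - x) < d); lra).
  apply Rabs_le_between in A. apply Rabs_le_between in B. apply Rabs_def2 in C. apply Rabs_def1; lra.
Qed.

Lemma psol_fix (x : R) : psol x = 1 - pint psol x.
Proof.
  apply Rminus_diag_uniq. apply NNPP. intros Hn. pose proof (Rabs_pos_lt _ Hn) as Hab.
  (* The residual of the fixed-point equation is at most the error at step [n + 1] plus [M * r^2]
     times the error at step [n]. Tails below [w / (2 * k)] therefore contradict a residual
     [w > 0]. *)
  set (r := Rabs x). set (k := M * r ^ 2 + 1).
  assert (Hk : 1 <= k) by (unfold k; pose proof (pow2_ge_0 r); nra).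
  set (w := Rabs (psol x - (1 - pint psol x))) in *.
  destruct (tail_small r (w / (2 * k))) as [n Hnn]; [apply Rdiv_lt_0_compat; lra|].
  pose proof (Hnn n ltac:(lia)) as T1. pose proof (Hnn (S n) ltac:(lia)) as T2.
  set (tn := exp (M * r ^ 2) - esum (M * r ^ 2) n) in *. set (tn' := exp (M * r ^ 2) - esum (M * r ^ 2) (S n)) in *.
  assert (A : Rabs (pint psol x - pint (iter n) x) <= M * tn * r ^ 2).
  { eapply Rle_trans; [apply (pint_diff psol (iter n) r tn 0)|].
    - lra.
    - apply psol_continuous.
    - apply iter_continuous.
    - intros t Ht. rewrite pow_O, Rmult_1_r. apply psol_approx, Ht.
    - unfold r; lra.
    - fold r. simpl. assert (0 <= M * tn * (r * r)) by (apply Rmult_le_pos; [apply Rmult_le_pos; lra|nra]). lra. }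
  pose proof (psol_approx r (S n) x ltac:(unfold r; lra)) as B. fold tn' in B. simpl iter in B.
  assert (Hw : w <= tn' + M * tn * r ^ 2).
  { unfold w. replace (psol x - (1 - pint psol x)) with ((psol x - (1 - pint (iter n) x)) + (pint psol x - pint (iter n) x)) by ring.
    eapply Rle_trans; [apply Rabs_triang|]. lra. }
  assert (Hq : w / (2 * k) * k = w / 2) by (field; lra).
  assert (tn * (M * r ^ 2) <= w / (2 * k) * (M * r ^ 2)) by (apply Rmult_le_compat_r; [unfold k in Hk|]; lra).
  assert (tn' + M * tn * r ^ 2 < w / (2 * k) * k) by (unfold k at 2; lra). lra.
Qed.

Lemma picard : (forall x, p (- x) = p x) -> exists psi psi1,
  (forall x, is_derive psi x (psi1 x)) /\ (forall x, is_derive psi1 x (- p x * psi x)) /\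
  psi 0 = 1 /\ psi1 0 = 0 /\ forall x, psi (- x) = psi x.
Proof.
  intros Heven.
  set (h := prim (fun t => p t * psol t)).
  assert (D2 : forall x, is_derive h x (p x * psol x)) by (intros x; apply (prim_derive (fun t => p t * psol t)), pf_continuous, psol_continuous).
  assert (D1 : forall x, is_derive psol x (- h x)).
  { intros x. apply (is_derive_ext (fun x => 1 - pint psol x)); [intros t; symmetry; apply psol_fix|].
    replace (- h x) with (minus 0 (h x)) by (unfold minus, plus, opp; simpl; ring).
    apply (is_derive_minus (V := R_NormedModule) (fun _ => 1) (pint psol)); [apply (is_derive_const 1)|].
    apply (prim_derive h). intros y. apply prim_continuous, pf_continuous, psol_continuous. }
  assert (D1' : forall x, is_derive (fun x => psol (- x)) x (h (- x))).
  { intros x. replace (h (- x)) with (scal (-1) (- h (- x))) by (unfold scal; simpl; unfold mult; simpl; ring).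
    apply (is_derive_comp (V := R_NormedModule) psol (fun t => - t)); [apply D1|]. auto_derive; [exact I|ring]. }
  assert (D2' : forall x, is_derive (fun x => h (- x)) x (- (p x * psol (- x)))).
  { intros x. replace (- (p x * psol (- x))) with (scal (-1) (p (- x) * psol (- x)))
      by (rewrite Heven; unfold scal; simpl; unfold mult; simpl; ring).
    apply (is_derive_comp (V := R_NormedModule) h (fun t => - t)); [apply D2|]. auto_derive; [exact I|ring]. }
  (* Averaging with the reflection yields an even solution without appeal to uniqueness. *)
  exists (fun x => / 2 * (psol x + psol (- x))), (fun x => / 2 * (- h x + h (- x))).
  split; [|split; [|split; [|split]]].
  - intros x. apply (is_derive_scal (fun x => psol x + psol (- x))).
    apply (is_derive_plus (V := R_NormedModule) psol (fun x => psol (- x))); [apply D1|apply D1'].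
  - intros x. replace (- p x * (/ 2 * (psol x + psol (- x)))) with (/ 2 * (- (p x * psol x) + - (p x * psol (- x)))) by ring.
    apply (is_derive_scal (fun x => - h x + h (- x))).
    apply (is_derive_plus (V := R_NormedModule) (fun x => - h x) (fun x => h (- x))); [|apply D2'].
    apply (is_derive_opp (V := R_NormedModule) h), D2.
  - assert (E : psol 0 = 1) by (rewrite psol_fix; unfold pint; rewrite prim_0; ring).
    rewrite Ropp_0, E. change (/ 2 * (1 + 1) = 1). field.
  - unfold h. rewrite Ropp_0, prim_0. change (/ 2 * (- 0 + 0) = 0). ring.
  - intros x. rewrite Ropp_involutive. apply f_equal, Rplus_comm.
Qed.
End Picard.

(** * Sharpness *)

Definition cut (A : R) (F : R -> R) (s : R) : R := if Rlt_dec (Rabs s) A then F s else 0.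

Lemma cut_in (A : R) (F : R -> R) (s : R) : Rabs s < A -> cut A F s = F s.
Proof. intros H. unfold cut. destruct (Rlt_dec (Rabs s) A); [reflexivity|contradiction]. Qed.

Lemma cut_out (A : R) (F : R -> R) (s : R) : A <= Rabs s -> cut A F s = 0.
Proof. intros H. unfold cut. destruct (Rlt_dec (Rabs s) A); [lra|reflexivity]. Qed.

Lemma cut_abs (A : R) (F : R -> R) (s : R) : Rabs (cut A F s) <= Rabs (F s).
Proof. unfold cut. destruct (Rlt_dec (Rabs s) A); [lra|]. rewrite Rabs_R0. apply Rabs_pos. Qed.

Lemma locally_in (A x : R) : Rabs x < A -> locally x (fun y => Rabs y < A).
Proof.
  intros H. apply Rabs_def2 in H. generalize (filter_and _ _ (open_lt A x (proj1 H)) (open_gt (- A) x (proj2 H))).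
  apply filter_imp. intros y [H1 H2]. apply Rabs_def1; lra.
Qed.

Lemma locally_out (A x : R) : A < Rabs x -> locally x (fun y => A < Rabs y).
Proof.
  intros H. assert (Hd : 0 < Rabs x - A) by lra. exists (mkposreal _ Hd). intros y Hy.
  change (Rabs (y - x) < Rabs x - A) in Hy. pose proof (Rabs_triang_inv x y). rewrite Rabs_minus_sym in Hy. lra.
Qed.

Lemma continuous_eps (f : R -> R) (x : R) : continuous f x <->
  forall eps, 0 < eps -> exists d, 0 < d /\ forall y, Rabs (y - x) < d -> Rabs (f y - f x) < eps.
Proof.
  split.
  - intros H eps He. destruct (H (fun z => Rabs (z - f x) < eps)) as [d Hd].
    { exists (mkposreal _ He). intros z Hz. exact Hz. }
    exists d. split; [apply cond_pos|]. intros y Hy. apply Hd, Hy.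
  - intros H P [e HP]. destruct (H e (cond_pos e)) as [d [Hd Hy]]. exists (mkposreal _ Hd). intros y Hyx. apply HP, Hy, Hyx.
Qed.

Lemma cut_continuous_gen (A : R) (F : R -> R) (x : R) : (Rabs x < A -> continuous F x) ->
  (Rabs x = A -> forall eps, 0 < eps -> exists d, 0 < d /\ forall y, Rabs (y - x) < d -> Rabs y < A -> Rabs (F y) < eps) ->
  continuous (cut A F) x.
Proof.
  intros Hin Hedge. destruct (Rtotal_order (Rabs x) A) as [H|[H|H]].
  - apply (continuous_ext_loc _ F); [|apply Hin, H]. generalize (locally_in A x H). apply filter_imp.
    intros y Hy. symmetry. apply cut_in, Hy.
  - apply continuous_eps. intros eps He. destruct (Hedge H eps He) as [d [Hd Hy]]. exists d. split; [assumption|].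
    intros y Hyx. rewrite (cut_out A F x) by lra. rewrite Rminus_0_r.
    destruct (Rlt_or_le (Rabs y) A); [rewrite cut_in by assumption; auto|rewrite cut_out, Rabs_R0; assumption].
  - apply (continuous_ext_loc _ (fun _ => 0)); [|apply continuous_const]. generalize (locally_out A x H). apply filter_imp.
    intros y Hy. symmetry. apply cut_out. lra.
Qed.

Lemma derive_little_o (F : R -> R) (x l : R) : is_derive F x l ->
  forall eps, 0 < eps -> exists d, 0 < d /\ forall y, Rabs (y - x) < d -> Rabs (F y - F x - l * (y - x)) <= eps * Rabs (y - x).
Proof.
  intros H eps He. apply is_derive_Reals in H. destruct (H eps He) as [d Hd]. exists d. split; [apply cond_pos|].
  intros y Hy. destruct (Req_dec y x) as [->|Hne].
  - rewrite !Rminus_diag, Rmult_0_r, Rminus_diag, Rabs_R0. lra.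
  - assert (Hh : y - x <> 0) by lra. specialize (Hd (y - x) Hh Hy). replace (x + (y - x)) with y in Hd by ring.
    replace (F y - F x - l * (y - x)) with (((F y - F x) / (y - x) - l) * (y - x)) by (field; assumption).
    rewrite Rabs_mult. apply Rmult_le_compat_r; [apply Rabs_pos|lra].
Qed.

Lemma derive_of_little_o (F : R -> R) (x : R) : F x = 0 ->
  (forall eps, 0 < eps -> exists d, 0 < d /\ forall y, Rabs (y - x) < d -> Rabs (F y) <= eps * Rabs (y - x)) -> is_derive F x 0.
Proof.
  intros F0 H. apply is_derive_Reals. intros eps He. destruct (H (eps / 2)) as [d [Hd Hy]]; [lra|].
  exists (mkposreal _ Hd). intros h Hh Hhd. specialize (Hy (x + h)). replace (x + h - x) with h in Hy by ring.
  specialize (Hy Hhd). rewrite F0, !Rminus_0_r. unfold Rdiv. rewrite Rabs_mult, Rabs_inv.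
  assert (0 < Rabs h) by (apply Rabs_pos_lt, Hh).
  apply Rle_lt_trans with (eps / 2); [|lra]. apply Rle_div_l; assumption.
Qed.

Lemma cut_derive (A : R) (F F' : R -> R) (x : R) : is_derive F x (F' x) ->
  (Rabs x = A -> F x = 0 /\ F' x = 0) -> is_derive (cut A F) x (cut A F' x).
Proof.
  intros HF Hedge. destruct (Rtotal_order (Rabs x) A) as [H|[H|H]].
  - rewrite cut_in by assumption. apply (is_derive_ext_loc F); [|assumption]. generalize (locally_in A x H). apply filter_imp.
    intros y Hy. symmetry. apply cut_in, Hy.
  - destruct (Hedge H) as [E0 E1]. rewrite cut_out by lra. apply derive_of_little_o; [apply cut_out; lra|].
    intros eps He. destruct (derive_little_o F x _ HF eps He) as [d [Hd Hy]]. exists d. split; [assumption|].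
    intros y Hyx. specialize (Hy y Hyx). rewrite E0, E1 in Hy. rewrite Rmult_0_l, !Rminus_0_r in Hy.
    pose proof (cut_abs A F y). lra.
  - rewrite cut_out by lra. apply (is_derive_ext_loc (fun _ => 0)); [|apply (is_derive_const 0)].
    generalize (locally_out A x H). apply filter_imp. intros y Hy. symmetry. apply cut_out. lra.
Qed.

Lemma cut_continuous (A : R) (F : R -> R) (x : R) : continuous F x -> (Rabs x = A -> F x = 0) -> continuous (cut A F) x.
Proof.
  intros HF Hedge. apply cut_continuous_gen; [intros; assumption|].
  intros H eps He. destruct (proj1 (continuous_eps F x) HF eps He) as [d [Hd Hy]]. exists d. split; [assumption|].
  intros y Hyx _. specialize (Hy y Hyx). rewrite (Hedge H), Rminus_0_r in Hy. assumption.
Qed.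

(** * Powers of the ground state, cut off at its first zero *)

Section Power.
Context (a : R) (psi psi1 : R -> R).
Context (D1 : forall x, is_derive psi x (psi1 x)) (Hin : forall x, Rabs x < a -> 0 < psi x) (H0 : forall x, Rabs x = a -> psi x = 0).

Definition wp (s : R) : R -> R := cut a (fun x => Rpower (psi x) s).

Lemma psi_cont (x : R) : continuous psi x.
Proof. apply (ex_derive_continuous (V := R_NormedModule)). eexists; apply D1. Qed.

Lemma wp_mult (s t x : R) : wp s x * wp t x = wp (s + t) x.
Proof. unfold wp, cut. destruct (Rlt_dec (Rabs x) a); [symmetry; apply Rpower_plus|ring]. Qed.

Lemma wp_S (s x : R) : wp (s + 1) x = psi x * wp s x.
Proof.
  unfold wp, cut. destruct (Rlt_dec (Rabs x) a) as [H|H]; [|ring].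
  rewrite Rpower_plus, Rpower_1 by (apply Hin, H). ring.
Qed.

Lemma wp_cont (s x : R) : 0 < s -> continuous (wp s) x.
Proof.
  intros Hs. apply cut_continuous_gen.
  - intros H. apply (continuous_comp psi (fun y => Rpower y s)); [apply psi_cont|].
    apply (ex_derive_continuous (V := R_NormedModule)). eexists. apply is_derive_Reals, derivable_pt_lim_power, Hin, H.
  - intros H eps He.
    assert (Hq : 0 < Rpower eps (/ s)) by apply exp_pos.
    destruct (proj1 (continuous_eps psi x) (psi_cont x) _ Hq) as [d [Hd Hy]]. exists d. split; [assumption|].
    intros y Hyx Hya. specialize (Hy y Hyx). rewrite (H0 x H), Rminus_0_r in Hy. pose proof (Hin y Hya) as Hp.
    rewrite Rabs_pos_eq in Hy by lra. rewrite Rabs_pos_eq by (apply Rlt_le, exp_pos).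
    apply Rlt_le_trans with (Rpower (Rpower eps (/ s)) s).
    + apply Rlt_Rpower_l; [assumption|split; assumption].
    + rewrite Rpower_mult, Rinv_l, Rpower_1 by lra. lra.
Qed.

(** At a zero of [psi] the power [psi^(s+1)] is [psi], of linear size, times [psi^s], which tends to
    0. An exponent above 1 thus makes the extension by zero differentiable, which [psi] itself need
    not be after cutting. *)
Lemma wp_derive (s x : R) : 0 < s -> is_derive (wp (s + 1)) x ((s + 1) * wp s x * psi1 x).
Proof.
  intros Hs. destruct (Rtotal_order (Rabs x) a) as [H|[H|H]].
  - unfold wp at 2. rewrite cut_in by assumption.
    apply (is_derive_ext_loc (fun x => Rpower (psi x) (s + 1))).
    + generalize (locally_in a x H). apply filter_imp. intros y Hy. symmetry. apply (cut_in a (fun x => Rpower (psi x) (s + 1))), Hy.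
    + replace ((s + 1) * Rpower (psi x) s * psi1 x) with (scal (psi1 x) ((s + 1) * Rpower (psi x) (s + 1 - 1))).
      * apply (is_derive_comp (V := R_NormedModule) (fun y => Rpower y (s + 1)) psi); [|apply D1].
        apply is_derive_Reals, derivable_pt_lim_power, Hin, H.
      * replace (s + 1 - 1) with s by ring. unfold scal; simpl; unfold mult; simpl. ring.
  - assert (E : wp s x = 0) by (apply cut_out; lra). rewrite E, Rmult_0_r, Rmult_0_l.
    apply derive_of_little_o; [apply cut_out; lra|]. intros eps He.
    destruct (derive_little_o psi x _ (D1 x) 1 Rlt_0_1) as [d1 [Hd1 Hy1]].
    set (k := Rabs (psi1 x) + 1). assert (Hk : 0 < k) by (unfold k; pose proof (Rabs_pos (psi1 x)); lra).
    destruct (proj1 (continuous_eps (wp s) x) (wp_cont s x Hs) (eps / k)) as [d2 [Hd2 Hy2]]; [apply Rdiv_lt_0_compat; assumption|].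
    exists (Rmin d1 d2). split; [apply Rmin_pos; assumption|]. intros y Hy.
    pose proof (Rmin_l d1 d2). pose proof (Rmin_r d1 d2).
    specialize (Hy1 y ltac:(lra)). specialize (Hy2 y ltac:(lra)). rewrite E, Rminus_0_r in Hy2.
    rewrite (H0 x H), Rminus_0_r in Hy1. rewrite wp_S, Rabs_mult.
    assert (Hpsi : Rabs (psi y) <= k * Rabs (y - x)).
    { replace (psi y) with ((psi y - psi1 x * (y - x)) + psi1 x * (y - x)) by ring.
      eapply Rle_trans; [apply Rabs_triang|]. rewrite Rabs_mult. unfold k. lra. }
    apply Rle_trans with (k * Rabs (y - x) * (eps / k)).
    + apply Rmult_le_compat; try apply Rabs_pos; [assumption|lra].
    + right. field. lra.
  - unfold wp at 2. rewrite cut_out by lra. rewrite Rmult_0_r, Rmult_0_l.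
    apply (is_derive_ext_loc (fun _ => 0)); [|apply (is_derive_const 0)].
    generalize (locally_out a x H). apply filter_imp. intros y Hy. symmetry. apply cut_out. lra.
Qed.
End Power.

Lemma first_zero (psi : R -> R) (X x0 : R) : (forall x, continuous psi x) -> (forall x, psi (- x) = psi x) ->
  0 < psi 0 -> Rabs x0 <= X -> psi x0 <= 0 ->
  exists a, 0 < a <= X /\ (forall x, Rabs x < a -> 0 < psi x) /\ (forall x, Rabs x = a -> psi x = 0).
Proof.
  intros Hc Hev H0 Hx0 Hneg.
  assert (Habs : forall x, psi (Rabs x) = psi x) by (intros x; unfold Rabs; destruct Rcase_abs; [apply Hev|reflexivity]).
  destruct (completeness (fun t => 0 <= t /\ forall s, 0 <= s <= t -> 0 < psi s)) as [a [Ha1 Ha2]].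
  { exists (Rabs x0). intros t [Ht Hs]. apply Rnot_lt_le. intros Hlt. specialize (Hs (Rabs x0)). rewrite Habs in Hs.
    pose proof (Rabs_pos x0). specialize (Hs ltac:(lra)). lra. }
  { exists 0. split; [lra|]. intros s Hs. replace s with 0 by lra. assumption. }
  assert (Hbelow : forall t, 0 <= t < a -> 0 < psi t).
  { intros t Ht. apply NNPP. intros Hn. assert (a <= t); [|lra]. apply Ha2. intros t' [Ht' Hs].
    apply Rnot_lt_le. intros Hlt. apply Hn, Hs. lra. }
  assert (Hext : forall t, 0 <= t -> (forall s, 0 <= s <= t -> 0 < psi s) -> t < a).
  { intros t Ht Hs. destruct (proj1 (continuous_eps psi t) (Hc t) (psi t)) as [d [Hd Hy]]; [apply Hs; lra|].
    assert (t + d / 2 <= a); [|lra]. apply Ha1. split; [lra|]. intros s Hs'. destruct (Rle_or_lt s t); [apply Hs; lra|].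
    specialize (Hy s). rewrite Rabs_pos_eq in Hy by lra. specialize (Hy ltac:(lra)). apply Rabs_def2 in Hy. lra. }
  assert (Hapos : 0 < a).
  { apply Hext; [lra|]. intros s Hs. replace s with 0 by lra. assumption. }
  assert (HaX : a <= X).
  { apply Ha2. intros t [Ht Hs]. apply Rnot_lt_le. intros Hlt. specialize (Hs (Rabs x0)). rewrite Habs in Hs.
    pose proof (Rabs_pos x0). specialize (Hs ltac:(lra)). lra. }
  assert (Hza : psi a = 0).
  { destruct (Rtotal_order (psi a) 0) as [H|[H|H]]; [|assumption|].
    - exfalso. destruct (proj1 (continuous_eps psi a) (Hc a) (- psi a)) as [d [Hd Hy]]; [lra|].
      set (t := Rmax 0 (a - d / 2)). assert (Ht : 0 <= t < a /\ a - d / 2 <= t).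
      { unfold t. split; [split; [apply Rmax_l|apply Rmax_lub_lt; lra]|apply Rmax_r]. }
      specialize (Hy t). rewrite Rabs_left1 in Hy by lra. specialize (Hy ltac:(lra)). apply Rabs_def2 in Hy.
      pose proof (Hbelow t (proj1 Ht)). lra.
    - exfalso. assert (a < a); [|lra]. apply Hext; [lra|]. intros s Hs.
      destruct (Req_dec s a) as [->|Hne]; [assumption|apply Hbelow; lra]. }
  exists a. split; [lra|]. split.
  - intros x Hx. rewrite <- Habs. apply Hbelow. split; [apply Rabs_pos|assumption].
  - intros x Hx. rewrite <- Habs, Hx. assumption.
Qed.

(** * Products of a radial and an angular profile in logarithmic polar coordinates *)

Section PolarProducts.
Context (v : pt) (g a A s0 : R) (Ha : 0 < a < PI) (HA : 0 < A) (Hs0 : s0 <= - A).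

Definition lr (p : pt) : R := ln (rad v g p) - s0.

Definition vanish_from (A : R) (f : R -> R) : Prop := forall s, A <= Rabs s -> f s = 0.

Definition pprod (f h : R -> R) (p : pt) : R := f (lr p) * h (ang v g p).

(** Polar coordinates fail on the half line opposite to the axis. Around its points other than the
    vertex the angular factor vanishes because [a < PI], and around the vertex the radial factor
    vanishes. *)
Lemma live_or_dead (p : pt) : 0 < rad v g p + cX v g p \/
  locally p (fun q => A <= Rabs (lr q) \/ a <= Rabs (ang v g q)).
Proof.
  pose proof (rad_cX v g p) as Hrc. destruct (Rle_lt_or_eq_dec _ _ Hrc) as [H|H]; [left; assumption|right].
  assert (Crad : cts (rad v g)).
  { intros q. apply cts_pdist. intros e He. exists e. split; [assumption|]. intros w Hw.
    rewrite !rad_dist. pose proof (pdist_tri w q v). pose proof (pdist_tri q w v). rewrite (pdist_sym w q) in *.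
    apply Rabs_def1; lra. }
  pose proof (rad_pos v g p) as Hr. destruct (Rle_lt_or_eq_dec 0 _ Hr) as [Hr0|Hr0].
  - assert (Hcos : -1 < cos a) by (rewrite <- cos_PI; apply cos_decreasing_1; lra).
    assert (Cf : continuous (fun q => cX v g q + - cos a * rad v g q) p).
    { apply cont_plus; [apply (C1p_cX v g p)|]. apply cont_mult; [apply continuous_const|apply Crad]. }
    generalize (cont_lt _ p 0 Cf ltac:(nra)). apply filter_imp. intros q Hq. right.
    apply Rnot_lt_le. intros Hlt. destruct (cX_polar v g q) as [E _].
    assert (cos a <= cos (ang v g q)).
    { replace (cos (ang v g q)) with (cos (Rabs (ang v g q))) by (unfold Rabs; destruct Rcase_abs; [apply cos_neg|reflexivity]).
      apply cos_decr_1; try lra; apply Rabs_pos. }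
    change (cX v g q + - cos a * rad v g q < 0) in Hq.
    pose proof (rad_pos v g q). rewrite E in Hq. nra.
  - assert (He : rad v g p < exp (s0 - A)) by (rewrite <- Hr0; apply exp_pos).
    generalize (cont_lt _ p _ (Crad p) He). apply filter_imp. intros q Hq. left. unfold lr.
    pose proof (rad_pos v g q) as Hrq. destruct (Rle_lt_or_eq_dec 0 _ Hrq) as [Hp|Hp].
    + apply ln_increasing in Hq; [|assumption]. rewrite ln_exp in Hq. rewrite Rabs_left; lra.
    (* At the vertex [ln 0] is 0 by convention, so [lr] equals [- s0]; this is at least [A] because
       [s0 <= - A]. *)
    + rewrite <- Hp. unfold ln. destruct (Rlt_dec 0 0) as [C|C]; [destruct (Rlt_irrefl 0 C)|]. rewrite Rabs_pos_eq; lra.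
Qed.

Section Product.
Context (f f' h h' : R -> R).
Context (Df : forall s, is_derive f s (f' s)) (Cf : forall s, continuous f' s).
Context (Dh : forall s, is_derive h s (h' s)) (Ch : forall s, continuous h' s).
Context (Vf : vanish_from A f) (Vf' : vanish_from A f') (Vh : vanish_from a h) (Vh' : vanish_from a h').

Definition pprodx (p : pt) : R := f' (lr p) * kx v g p * h (ang v g p) + f (lr p) * (h' (ang v g p) * - ky v g p).
Definition pprody (p : pt) : R := f' (lr p) * ky v g p * h (ang v g p) + f (lr p) * (h' (ang v g p) * kx v g p).

Lemma pprod_dead (q : pt) : A <= Rabs (lr q) \/ a <= Rabs (ang v g q) ->
  pprod f h q = 0 /\ pprodx q = 0 /\ pprody q = 0.
Proof.
  unfold pprod, pprodx, pprody. intros [H|H].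
  - rewrite (Vf _ H), (Vf' _ H). repeat split; ring.
  - rewrite (Vh _ H), (Vh' _ H). repeat split; ring.
Qed.

Lemma C1p_pprod_live (p : pt) : 0 < rad v g p + cX v g p -> C1p (pprod f h) pprodx pprody p.
Proof.
  intros H. assert (Hr : 0 < rad v g p).
  { pose proof (rad_pos v g p). destruct (Req_dec (rad v g p) 0) as [E|E]; [|lra]. exfalso.
    pose proof (rad_sq v g p). pose proof (pow2_ge_0 (cY v g p)). rewrite E in *. nra. }
  assert (HL : C1p lr (kx v g) (ky v g) p).
  { eapply C1p_ext; [| | |apply (C1p_plus _ _ _ _ _ _ p (C1p_ln_rad v g p Hr) (C1p_const (- s0) p))];
      intros q; unfold lr; simpl; ring. }
  apply (C1p_mult (fun q => f (lr q)) _ _ (fun q => h (ang v g q))).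
  - apply (C1p_comp f f' lr); [apply Df|apply Cf|assumption].
  - apply (C1p_comp h h' (ang v g)); [apply Dh|apply Ch|apply C1p_ang_kelvin, H].
Qed.

Lemma C1p_pprod (p : pt) : C1p (pprod f h) pprodx pprody p.
Proof.
  destruct (live_or_dead p) as [H|H]; [apply C1p_pprod_live, H|].
  apply C1p_zero. revert H. apply filter_imp. intros q Hq. apply pprod_dead, Hq.
Qed.

(** Products with the gradients of [ln r] and, up to rotation, of the angle. Their divergences
    perform the radial and the angular integration by parts of the sharpness proof in Cartesian
    coordinates. *)
Lemma C1p_pprod_k (p : pt) :
  C1p (fun q => pprod f h q * kx v g q)
    (fun q => pprodx q * kx v g q + pprod f h q * (1 / rad v g q ^ 2 - 2 * (fst q - fst v) ^ 2 / (rad v g q ^ 2) ^ 2))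
    (fun q => pprody q * kx v g q + pprod f h q * (- (2 * (fst q - fst v) * (snd q - snd v)) / (rad v g q ^ 2) ^ 2)) p /\
  C1p (fun q => pprod f h q * ky v g q)
    (fun q => pprodx q * ky v g q + pprod f h q * (- (2 * (fst q - fst v) * (snd q - snd v)) / (rad v g q ^ 2) ^ 2))
    (fun q => pprody q * ky v g q + pprod f h q * (1 / rad v g q ^ 2 - 2 * (snd q - snd v) ^ 2 / (rad v g q ^ 2) ^ 2)) p.
Proof.
  destruct (live_or_dead p) as [H|H].
  - assert (Hr : 0 < rad v g p).
    { pose proof (rad_pos v g p). destruct (Req_dec (rad v g p) 0) as [E|E]; [|lra]. exfalso.
      pose proof (rad_sq v g p). pose proof (pow2_ge_0 (cY v g p)). rewrite E in *. nra. }
    destruct (C1p_kxy v g p Hr) as [K1 K2]. pose proof (C1p_pprod_live p H) as HP.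
    split; [exact (C1p_mult _ _ _ _ _ _ p HP K1)|exact (C1p_mult _ _ _ _ _ _ p HP K2)].
  - split; apply C1p_zero; revert H; apply filter_imp; intros q Hq;
      destruct (pprod_dead q Hq) as (E1 & E2 & E3); rewrite E1, E2, E3; repeat split; ring.
Qed.
End Product.
End PolarProducts.

Lemma kk_ge (b X y : R) : 0 < b -> 0 < X < b + PI / 2 -> b <= PI / 2 -> Rabs y <= X -> kk b X <= kk b y.
Proof.
  intros Hb HX HbP Hy. pose proof PI_RGT_0.
  assert (E : kk b y = kk b (Rabs y)) by (unfold Rabs; destruct Rcase_abs; [rewrite kk_opp; lra|reflexivity]).
  rewrite E. pose proof (Rabs_pos y). set (z := Rabs y) in *. unfold kk.
  destruct (Rle_or_lt z b) as [Hz|Hz].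
  - rewrite (clamp_mid b z), Rminus_diag, cos_0 by lra. apply COS_bound.
  - rewrite !clamp_hi by lra. apply cos_decr_1; lra.
Qed.

(* [f = cos (k s)^2] cut off at [|k s| = PI / 2], and [F = f f']. *)
Lemma radial_profile (k : R) : 0 < k -> exists A f f' F F', 0 < A /\
  (forall s, is_derive f s (f' s)) /\ (forall s, continuous f' s) /\
  (forall s, is_derive F s (F' s)) /\ (forall s, continuous F' s) /\
  vanish_from A f /\ vanish_from A f' /\ vanish_from A F /\ vanish_from A F' /\
  f 0 = 1 /\ forall s, f' s ^ 2 <= F' s + 2 * k ^ 2 * f s ^ 2.
Proof.
  intros Hk. pose proof PI_RGT_0 as Hpi. set (A := PI / (2 * k)).
  assert (HA : 0 < A) by (apply Rdiv_lt_0_compat; lra).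
  assert (EA : k * A = PI / 2) by (unfold A; field; lra).
  assert (edge : forall s, Rabs s = A -> cos (k * s) = 0).
  { intros s Hs. unfold Rabs in Hs. destruct (Rcase_abs s).
    - replace (k * s) with (- (k * A)) by (rewrite <- Hs; ring). rewrite cos_neg, EA. apply cos_PI2.
    - rewrite Hs, EA. apply cos_PI2. }
  (* With the square, [f], [f'], [F] and [F'] all vanish at the edge, so the cut functions remain
     C1; a plain cosine would leave a corner. *)
  set (f := fun s => cos (k * s) ^ 2). set (f' := fun s => - 2 * k * cos (k * s) * sin (k * s)).
  set (F := fun s => - 2 * k * cos (k * s) ^ 3 * sin (k * s)).
  set (F' := fun s => - 2 * k ^ 2 * (cos (k * s) ^ 4 - 3 * cos (k * s) ^ 2 * sin (k * s) ^ 2)).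
  exists A, (cut A f), (cut A f'), (cut A F), (cut A F'). split; [assumption|].
  assert (Cf' : forall s, continuous f' s) by (intros s; apply (ex_derive_continuous (V := R_NormedModule)); unfold f'; auto_derive; exact I).
  assert (CF' : forall s, continuous F' s) by (intros s; apply (ex_derive_continuous (V := R_NormedModule)); unfold F'; auto_derive; exact I).
  split; [|split; [|split; [|split; [|split; [|split; [|split; [|split; [|split]]]]]]]]; try (intros s Hs; apply cut_out, Hs).
  - intros s. apply cut_derive.
    + unfold f, f'. auto_derive; [exact I|]. ring.
    + intros Hs. unfold f, f'. rewrite (edge s Hs). split; ring.
  - intros s. apply cut_continuous; [apply Cf'|]. intros Hs. unfold f'. rewrite (edge s Hs). ring.
  - intros s. apply cut_derive.
    + unfold F, F'. auto_derive; [exact I|]. ring.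
    + intros Hs. unfold F, F'. rewrite (edge s Hs). split; ring.
  - intros s. apply cut_continuous; [apply CF'|]. intros Hs. unfold F'. rewrite (edge s Hs). ring.
  - rewrite cut_in by (rewrite Rabs_R0; assumption). unfold f. rewrite Rmult_0_r, cos_0. apply pow1.
  - intros s. unfold cut. destruct (Rlt_dec (Rabs s) A); [|rewrite pow_i by lia; lra].
    unfold f, f', F'. pose proof (sc1 (k * s)) as E.
    set (cc := cos (k * s)) in *. set (ss := sin (k * s)) in *.
    assert (E' : ss ^ 2 = 1 - cc ^ 2) by lra.
    replace ((-2 * k * cc * ss) ^ 2) with (4 * k ^ 2 * cc ^ 2 * ss ^ 2) by ring. rewrite E'.
    assert (0 <= k ^ 2 * (2 * (cc ^ 2 * ss ^ 2))) by (apply Rmult_le_pos; [apply pow2_ge_0|]; pose proof (pow2_ge_0 (cc * ss)); nra).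
    rewrite E' in *. nra.
Qed.

Lemma kelvin_inner (v : pt) (g : R) (q : pt) : 0 < rad v g q ->
  kx v g q ^ 2 + ky v g q ^ 2 = 1 / rad v g q ^ 2 /\
  (fst q - fst v) = kx v g q * rad v g q ^ 2 /\ (snd q - snd v) = ky v g q * rad v g q ^ 2.
Proof.
  intros Hr. unfold kx, ky. split; [|split; field; lra].
  assert (E : rad v g q ^ 2 = (fst q - fst v) ^ 2 + (snd q - snd v) ^ 2) by (rewrite rad_dist; apply pdist_sq).
  transitivity (((fst q - fst v) ^ 2 + (snd q - snd v) ^ 2) / (rad v g q ^ 2) ^ 2); [field; lra|].
  rewrite <- E. field. lra.
Qed.

(** * Necessity of positive ground states *)

Section Sharpness.
Context (K : pt -> Prop) (v : pt) (g b : R).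
Context (Hb : 0 < b <= PI / 2) (HK : convex_set K) (Hv : interior2 K v).
Context (Hray : forall t s, 0 <= t -> s = 1 \/ s = - 1 -> interior2 K (ray v g t (s * (b + PI / 2)))).

(** By contraposition. If the ground state for some [c' < c] has a first zero [a <= X], the product
    of a slowly varying radial profile and [psi^(1+eta)] has an energy strictly below [c] times its
    weighted integral. *)
Lemma subcritical_of_hardy (c : R) : 0 <= c -> hardy_ineq (Om K v g b) c -> subcritical c b.
Proof.
  intros Hc0 Hh c' X Hc' HX. pose proof PI_RGT_0 as Hpi.
  assert (Hm : 0 < kk b X) by (apply kk_range; [lra|rewrite Rabs_pos_eq; lra]).
  assert (HXr : forall x, Rabs (clamp X x) <= X) by (intros x; apply Rabs_le_between, clamp_range; lra).
  assert (Hpot : forall x, 0 <= pot c' b X x <= c' / kk b X ^ 2).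
  { intros x. unfold pot. pose proof (kk_ge b X (clamp X x) (proj1 Hb) HX (proj2 Hb) (HXr x)) as Hge. split.
    - apply Rdiv_le_0_compat; [lra|apply pow_lt; lra].
    - unfold Rdiv. apply Rmult_le_compat_l; [lra|]. apply Rinv_le_contravar; [apply pow_lt, Hm|apply pow_incr; lra]. }
  destruct (picard (pot c' b X) (c' / kk b X ^ 2)) as (psi & psi1 & D1 & D2 & P0 & P1 & Pev).
  { intros x. apply continuous_pot; lra. }
  { apply Rdiv_le_0_compat; [lra|apply pow_lt, Hm]. }
  { intros x. rewrite Rabs_pos_eq; apply Hpot. }
  { intros x. unfold pot. rewrite clamp_opp, kk_opp by lra. reflexivity. }
  exists psi, psi1. split; [exact (conj D1 (conj D2 (conj P0 P1)))|].
  apply NNPP. intros Hnot.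
  assert (exists x0, Rabs x0 <= X /\ psi x0 <= 0) as (x0 & Hx0 & Hneg).
  { apply NNPP. intros Hn. apply Hnot. intros x Hx. apply Rnot_le_lt. intros Hle. apply Hn. exists x. auto. }
  assert (Cpsi : forall x, continuous psi x) by (intros x; apply (ex_derive_continuous (V := R_NormedModule)); eexists; apply D1).
  assert (Cpsi1 : forall x, continuous psi1 x) by (intros x; apply (ex_derive_continuous (V := R_NormedModule)); eexists; apply D2).
  assert (P0' : 0 < psi 0) by lra.
  destruct (first_zero psi X x0 Cpsi Pev P0' Hx0 Hneg) as (a & Ha & Hin & Hz).
  assert (HaPI : 0 < a < PI) by lra.
  (* The gap [c - c'] is divided in three: a quarter pays for the exponent [1 + eta] through
     [k1 <= 1 + eta], a quarter is [2 * k^2] for the radial profile, and the remaining half becomes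
     the gain [dl]. *)
  set (eta := Rmin 1 ((c - c') / (4 * (c' + 1)))).
  assert (Heta : 0 < eta /\ eta <= 1 /\ c' * eta <= (c - c') / 4).
  { unfold eta. assert (Hq : 0 < (c - c') / (4 * (c' + 1))) by (apply Rdiv_lt_0_compat; lra).
    split; [apply Rmin_pos; lra|]. split; [apply Rmin_l|].
    apply Rle_trans with (c' * ((c - c') / (4 * (c' + 1)))); [apply Rmult_le_compat_l; [lra|apply Rmin_r]|].
    replace (c' * ((c - c') / (4 * (c' + 1)))) with ((c - c') / 4 * (c' / (c' + 1))) by (field; lra).
    assert (c' / (c' + 1) <= 1) by (apply Rle_div_l; lra). assert (0 <= c' / (c' + 1)) by (apply Rdiv_le_0_compat; lra). nra. }
  destruct Heta as (Heta0 & Heta1 & Heta2).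
  set (k := sqrt ((c - c') / 8)). assert (Hk2 : k ^ 2 = (c - c') / 8) by (apply pow2_sqrt; lra).
  assert (Hk : 0 < k) by (apply sqrt_lt_R0; lra).
  set (k1 := (1 + eta) ^ 2 / (1 + 2 * eta)).
  assert (Hk1 : 0 <= k1 <= 1 + eta).
  { unfold k1. split; [apply Rdiv_le_0_compat; [apply pow2_ge_0|lra]|]. apply Rle_div_l; [lra|]. nra. }
  assert (Hk1c : k1 * c' + 2 * k ^ 2 <= c - (c - c') / 2).
  { assert (k1 * c' <= (1 + eta) * c') by (apply Rmult_le_compat_r; lra). rewrite Hk2. nra. }
  destruct (radial_profile k Hk) as (A & f & f' & F & F' & HA & Df & Cf & DF & CF & Vf & Vf' & VF & VF' & f0 & Hprof).
  destruct Hv as [r3 [Hr3 HKv]].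
  (* Confines the test function to radii at most [r3 / 2], well inside a disc of [K] around the
     vertex, and ensures [s0 <= - A]. *)
  set (s0 := Rmin (ln (r3 / 2)) 0 - A).
  assert (Hs0 : s0 <= - A /\ s0 + A <= ln (r3 / 2)).
  { unfold s0. pose proof (Rmin_l (ln (r3 / 2)) 0). pose proof (Rmin_r (ln (r3 / 2)) 0). lra. }
  destruct Hs0 as [Hs0 Hs0'].
  (* [w = psi^(1+eta)] is [C^1] at the zeros of [psi], and [w'^2 = k1 * (Y' + pot * w^2)]. *)
  set (w := wp a psi (eta + 1)). set (w1 := fun x => (eta + 1) * wp a psi eta x * psi1 x).
  set (Y := fun x => wp a psi (2 * eta + 1) x * psi1 x).
  set (Y1 := fun x => (2 * eta + 1) * wp a psi (2 * eta) x * psi1 x * psi1 x + wp a psi (2 * eta + 1) x * (- pot c' b X x * psi x)).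
  assert (Dw : forall x, is_derive w x (w1 x)) by (intros x; apply wp_derive; assumption).
  assert (cmul : forall (f h : R -> R) x, continuous f x -> continuous h x -> continuous (fun x => f x * h x) x)
    by (intros f1 h1 x H1 H2; apply (continuous_mult (K := R_AbsRing) f1 h1); assumption).
  assert (wpc : forall s x, 0 < s -> continuous (wp a psi s) x) by (intros s x Hs; apply (wp_cont a psi psi1); assumption).
  assert (Cw1 : forall x, continuous w1 x).
  { intros x. apply (cmul (fun x => (eta + 1) * wp a psi eta x) psi1); [|apply Cpsi1].
    apply (cmul (fun _ => eta + 1)); [apply continuous_const|apply wpc; lra]. }
  assert (DY : forall x, is_derive Y x (Y1 x)).
  { intros x. apply (is_derive_mult (K := R_AbsRing) (wp a psi (2 * eta + 1)) psi1); [|apply D2|apply Rmult_comm].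
    apply wp_derive; try assumption. lra. }
  assert (CY1 : forall x, continuous Y1 x).
  { intros x. apply (continuous_plus (V := R_NormedModule) (fun x => (2 * eta + 1) * wp a psi (2 * eta) x * psi1 x * psi1 x)).
    - apply (cmul (fun x => (2 * eta + 1) * wp a psi (2 * eta) x * psi1 x) psi1); [|apply Cpsi1].
      apply (cmul (fun x => (2 * eta + 1) * wp a psi (2 * eta) x) psi1); [|apply Cpsi1].
      apply (cmul (fun _ => 2 * eta + 1)); [apply continuous_const|apply wpc; lra].
    - apply cmul; [apply wpc; lra|]. apply (cmul (fun x => - pot c' b X x) psi); [|apply Cpsi].
      apply (continuous_opp (V := R_NormedModule) (pot c' b X)). apply continuous_pot; lra. }
  assert (Vwp : forall s x, a <= Rabs x -> wp a psi s x = 0) by (intros s x Hx; apply cut_out, Hx).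
  assert (Vw : vanish_from a w) by (intros x Hx; apply Vwp, Hx).
  assert (Vw1 : vanish_from a w1) by (intros x Hx; unfold w1; rewrite Vwp by assumption; ring).
  assert (VY : vanish_from a Y) by (intros x Hx; unfold Y; rewrite Vwp by assumption; ring).
  assert (VY1 : vanish_from a Y1) by (intros x Hx; unfold Y1; rewrite !Vwp by assumption; ring).
  assert (Hw1sq : forall x, w1 x ^ 2 = k1 * (Y1 x + pot c' b X x * w x ^ 2)).
  { intros x. unfold w1, Y1, w.
    replace (wp a psi (eta + 1) x ^ 2) with (wp a psi (2 * eta + 1) x * psi x).
    - replace (((eta + 1) * wp a psi eta x * psi1 x) ^ 2) with ((eta + 1) ^ 2 * (wp a psi eta x * wp a psi eta x) * psi1 x ^ 2) by ring.
      rewrite wp_mult. replace (eta + eta) with (2 * eta) by ring. unfold k1. field. lra.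
    - replace (wp a psi (eta + 1) x ^ 2) with (wp a psi (eta + 1) x * wp a psi (eta + 1) x) by ring. rewrite wp_mult.
      replace (eta + 1 + (eta + 1)) with (2 * eta + 1 + 1) by ring. rewrite (wp_S a psi Hin (2 * eta + 1) x). ring. }
  set (f2 := fun s => f s * f s). set (f2' := fun s => f' s * f s + f s * f' s).
  set (w2 := fun x => w x * w x). set (w2' := fun x => w1 x * w x + w x * w1 x).
  assert (cD : forall f f' : R -> R, (forall s, is_derive f s (f' s)) -> forall s, continuous f s)
    by (intros h h' Hd s; apply (ex_derive_continuous (V := R_NormedModule)); eexists; apply Hd).
  assert (Dsq : forall h h' : R -> R, (forall s, is_derive h s (h' s)) -> forall s, is_derive (fun s => h s * h s) s (h' s * h s + h s * h' s))
    by (intros h h' Hd s; apply (is_derive_mult (K := R_AbsRing) h h); [apply Hd|apply Hd|apply Rmult_comm]).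
  assert (Csq : forall h h' : R -> R, (forall s, is_derive h s (h' s)) -> (forall s, continuous h' s) -> forall s, continuous (fun s => h' s * h s + h s * h' s) s).
  { intros h h' Hd Hc s. apply (continuous_plus (V := R_NormedModule) (fun s => h' s * h s)); apply cmul; try apply Hc; apply (cD h h' Hd). }
  assert (Vf2 : vanish_from A f2) by (intros s Hs; unfold f2; rewrite (Vf s Hs); ring).
  assert (Vf2' : vanish_from A f2') by (intros s Hs; unfold f2'; rewrite (Vf s Hs); ring).
  assert (Vw2 : vanish_from a w2) by (intros s Hs; unfold w2; rewrite (Vw s Hs); ring).
  assert (Vw2' : vanish_from a w2') by (intros s Hs; unfold w2'; rewrite (Vw s Hs); ring).
  set (u := pprod v g s0 f w). set (ux := pprodx v g s0 f f' w w1). set (uy := pprody v g s0 f f' w w1).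
  assert (Hu : forall p, C1p u ux uy p) by (intros p; apply (C1p_pprod v g a A s0); assumption).
  pose proof (fun p => C1p_pprod_k v g a A s0 HaPI HA Hs0 f2 f2' Y Y1 (Dsq f f' Df) (Csq f f' Df Cf) DY CY1 Vf2 Vf2' VY VY1 p) as HX1.
  pose proof (fun p => C1p_pprod_k v g a A s0 HaPI HA Hs0 F F' w2 w2' DF CF (Dsq w w1 Dw) (Csq w w1 Dw Cw1) VF VF' Vw2 Vw2' p) as HX2.
  set (L := Rabs (fst v) + Rabs (snd v) + r3).
  assert (HL : 0 < L) by (unfold L; pose proof (Rabs_pos (fst v)); pose proof (Rabs_pos (snd v)); lra).
  assert (Halive : forall p, Rabs (lr v g s0 p) < A -> Rabs (ang v g p) < a ->
     exp (s0 - A) <= rad v g p <= r3 / 2 /\ 0 < rad v g p).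
  { intros p H1 H2. apply Rabs_def2 in H2. pose proof (rad_gt0 v g p ltac:(lra)) as Hr. split; [|assumption].
    unfold lr in H1. apply Rabs_def2 in H1. split.
    - rewrite <- (exp_ln (rad v g p)) by assumption. apply Rlt_le, exp_increasing. lra.
    - apply Rnot_lt_le. intros Hlt. apply ln_increasing in Hlt; lra. }
  assert (Hdead : forall x y, L <= Rabs x \/ L <= Rabs y -> A <= Rabs (lr v g s0 (x, y)) \/ a <= Rabs (ang v g (x, y))).
  { intros x y Hxy. destruct (Rle_or_lt A (Rabs (lr v g s0 (x, y)))) as [H1|H1]; [left; assumption|].
    destruct (Rle_or_lt a (Rabs (ang v g (x, y)))) as [H2|H2]; [right; assumption|]. exfalso.
    destruct (Halive _ H1 H2) as [[_ Hr] _]. rewrite rad_dist, pdist_sym in Hr.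
    destruct (pdist_bounds v (x, y)) as (B1 & B2 & _). simpl in B1, B2.
    pose proof (Rabs_triang_inv x (fst v)). pose proof (Rabs_triang_inv y (snd v)).
    pose proof (Rabs_pos (fst v)). pose proof (Rabs_pos (snd v)). unfold L in Hxy. destruct Hxy; lra. }
  assert (Hu0 : forall q, A <= Rabs (lr v g s0 q) \/ a <= Rabs (ang v g q) -> u q = 0).
  { intros q Hq. apply (pprod_dead v g a A s0 f f' w w1 Vf Vf' Vw Vw1 q Hq). }
  assert (Ou : outside0 L u) by (intros x y Hxy; apply Hu0, Hdead, Hxy).
  (* On the support the radius is at least [exp (s0 - A)] and the profile at least [kk b X], so the
     second bound keeps nearby points in the sector and the first keeps them in [K]. *)
  set (d := Rmin (r3 / 2) (exp (s0 - A) * kk b X)).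
  assert (Hd : 0 < d) by (apply Rmin_pos; [lra|apply Rmult_lt_0_compat; [apply exp_pos|assumption]]).
  assert (HdO : forall p q, u p <> 0 -> pdist p q < d -> Om K v g b q).
  { intros p q Hp Hpq. pose proof (Rmin_l (r3 / 2) (exp (s0 - A) * kk b X)) as B1.
    pose proof (Rmin_r (r3 / 2) (exp (s0 - A) * kk b X)) as B2. fold d in B1, B2.
    assert (H1 : Rabs (lr v g s0 p) < A) by (apply Rnot_le_lt; intros H; apply Hp, Hu0; left; assumption).
    assert (H2 : Rabs (ang v g p) < a) by (apply Rnot_le_lt; intros H; apply Hp, Hu0; right; assumption).
    destruct (Halive p H1 H2) as [[R1 R2] R3]. split.
    - apply HKv. rewrite rad_dist, pdist_sym in R2. pose proof (pdist_tri v p q). lra.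
    - apply Rnot_le_lt. intros Hq. pose proof (d0_le v g b p q ltac:(lra) Hq) as Hle.
      unfold d0 in Hle. pose proof (kk_ge b X (ang v g p) (proj1 Hb) HX (proj2 Hb) ltac:(lra)) as Hk'.
      assert (exp (s0 - A) * kk b X <= rad v g p * kk b (ang v g p)).
      { apply Rmult_le_compat; [apply Rlt_le, exp_pos|lra|assumption|assumption]. }
      lra. }
  pose proof (Om_boundary_ne K v g b Hb Hray) as Hne.
  destruct (hardy_C1 (Om K v g b) c L d u ux uy Hne Hh Hc0 Hu HL Ou Hd HdO) as [Cq Hmain].
  set (Lp := L + 3) in *. assert (HLp : 0 < Lp) by (unfold Lp; lra).
  destruct (C1p_cts _ _ _ Hu) as (Cu & Cux & Cuy).
  (* [(- T1, S1)] is [f^2 * Y] times the gradient of the angle, and [(T2, S2)] is [F * w^2] times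
     the gradient of [ln r]. Their divergences supply the terms with [Y'] and [F'] that bound the
     energy, and integrate to zero. *)
  set (T1 := fun p => pprod v g s0 f2 Y p * ky v g p). set (S1 := fun p => pprod v g s0 f2 Y p * kx v g p).
  set (T2 := fun p => pprod v g s0 F w2 p * kx v g p). set (S2 := fun p => pprod v g s0 F w2 p * ky v g p).
  assert (Dead1 : forall q, A <= Rabs (lr v g s0 q) \/ a <= Rabs (ang v g q) ->
     pprod v g s0 f2 Y q = 0 /\ pprodx v g s0 f2 f2' Y Y1 q = 0 /\ pprody v g s0 f2 f2' Y Y1 q = 0)
    by (intros q Hq; apply (pprod_dead v g a A s0); assumption).
  assert (Dead2 : forall q, A <= Rabs (lr v g s0 q) \/ a <= Rabs (ang v g q) ->
     pprod v g s0 F w2 q = 0 /\ pprodx v g s0 F F' w2 w2' q = 0 /\ pprody v g s0 F F' w2 w2' q = 0)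
    by (intros q Hq; apply (pprod_dead v g a A s0); assumption).
  assert (Out1 : forall x y, Lp <= Rabs x \/ Lp <= Rabs y -> A <= Rabs (lr v g s0 (x, y)) \/ a <= Rabs (ang v g (x, y)))
    by (intros x y Hxy; apply Hdead; unfold Lp in Hxy; destruct Hxy; [left|right]; lra).
  set (P := fun q => - (2 * (fst q - fst v) * (snd q - snd v)) / (rad v g q ^ 2) ^ 2).
  set (Qx := fun q => 1 / rad v g q ^ 2 - 2 * (fst q - fst v) ^ 2 / (rad v g q ^ 2) ^ 2).
  set (Qy := fun q => 1 / rad v g q ^ 2 - 2 * (snd q - snd v) ^ 2 / (rad v g q ^ 2) ^ 2).
  set (T1x := fun q => pprodx v g s0 f2 f2' Y Y1 q * ky v g q + pprod v g s0 f2 Y q * P q).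
  set (S1y := fun q => pprody v g s0 f2 f2' Y Y1 q * kx v g q + pprod v g s0 f2 Y q * P q).
  set (T2x := fun q => pprodx v g s0 F F' w2 w2' q * kx v g q + pprod v g s0 F w2 q * Qx q).
  set (S2y := fun q => pprody v g s0 F F' w2 w2' q * ky v g q + pprod v g s0 F w2 q * Qy q).
  assert (I1 : I2 Lp T1x = 0).
  { apply (C1p_I2x Lp T1 T1x _ (Rlt_le _ _ HLp) (fun p => proj2 (HX1 p))).
    intros x y Hxy. unfold T1. rewrite (proj1 (Dead1 _ (Out1 x y Hxy))). ring. }
  assert (J1 : I2 Lp S1y = 0).
  { apply (C1p_I2x Lp S1 _ S1y (Rlt_le _ _ HLp) (fun p => proj1 (HX1 p))).
    intros x y Hxy. unfold S1. rewrite (proj1 (Dead1 _ (Out1 x y Hxy))). ring. }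
  assert (I2' : I2 Lp T2x = 0).
  { apply (C1p_I2x Lp T2 T2x _ (Rlt_le _ _ HLp) (fun p => proj1 (HX2 p))).
    intros x y Hxy. unfold T2. rewrite (proj1 (Dead2 _ (Out1 x y Hxy))). ring. }
  assert (J2 : I2 Lp S2y = 0).
  { apply (C1p_I2x Lp S2 _ S2y (Rlt_le _ _ HLp) (fun p => proj2 (HX2 p))).
    intros x y Hxy. unfold S2. rewrite (proj1 (Dead2 _ (Out1 x y Hxy))). ring. }
  assert (CT1 : cts T1x) by (intros p; apply (proj2 (HX1 p))).
  assert (CS1 : cts S1y) by (intros p; apply (proj1 (HX1 p))).
  assert (CT2 : cts T2x) by (intros p; apply (proj1 (HX2 p))).
  assert (CS2 : cts S2y) by (intros p; apply (proj2 (HX2 p))).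
  (* The spare half of the gap, multiplied by the lower bound [4 / r3^2] for [1 / r^2] on the
     support. *)
  set (dl := (c - c') / 2 * (4 / r3 ^ 2)).
  assert (Hdl : 0 < dl) by (unfold dl; apply Rmult_lt_0_compat; [lra|apply Rdiv_lt_0_compat; [lra|apply pow_lt; lra]]).
  assert (Hpt : forall p, dl * u p ^ 2 + (ux p ^ 2 + uy p ^ 2) <=
     c * (u p ^ 2 / bdist (Om K v g b) p ^ 2) + (k1 * (-1 * T1x p + S1y p) + (T2x p + S2y p))).
  { intros p. destruct (Rle_or_lt A (Rabs (lr v g s0 p))) as [H1|H1]; [|destruct (Rle_or_lt a (Rabs (ang v g p))) as [H2|H2]].
    - assert (Hq : A <= Rabs (lr v g s0 p) \/ a <= Rabs (ang v g p)) by (left; assumption).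
      destruct (pprod_dead v g a A s0 f f' w w1 Vf Vf' Vw Vw1 p Hq) as (E1 & E2 & E3). fold u ux uy in E1, E2, E3.
      destruct (Dead1 p Hq) as (G1 & G2 & G3). destruct (Dead2 p Hq) as (K1 & K2 & K3).
      unfold T1x, S1y, T2x, S2y. rewrite E1, E2, E3, G1, G2, G3, K1, K2, K3. unfold Rdiv. lra.
    - assert (Hq : A <= Rabs (lr v g s0 p) \/ a <= Rabs (ang v g p)) by (right; assumption).
      destruct (pprod_dead v g a A s0 f f' w w1 Vf Vf' Vw Vw1 p Hq) as (E1 & E2 & E3). fold u ux uy in E1, E2, E3.
      destruct (Dead1 p Hq) as (G1 & G2 & G3). destruct (Dead2 p Hq) as (K1 & K2 & K3).
      unfold T1x, S1y, T2x, S2y. rewrite E1, E2, E3, G1, G2, G3, K1, K2, K3. unfold Rdiv. lra.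
    - destruct (Halive p H1 H2) as [[R1 R2] R3].
      destruct (kelvin_inner v g p R3) as (Kn & Ex & Ey).
      set (r := rad v g p) in *. set (x := ang v g p) in *. set (s := lr v g s0 p) in *.
      set (KX := kx v g p) in *. set (KY := ky v g p) in *.
      set (n2 := 1 / r ^ 2) in *. assert (Hn2 : 0 < n2) by (unfold n2; apply Rdiv_lt_0_compat; [lra|apply pow_lt, R3]).
      assert (HP : P p = - (2 * KX * KY)).
      { unfold P. fold r. rewrite Ex, Ey. field. lra. }
      assert (HQx : Qx p = n2 - 2 * KX ^ 2).
      { unfold Qx. fold r n2. rewrite Ex. field. lra. }
      assert (HQy : Qy p = n2 - 2 * KY ^ 2).
      { unfold Qy. fold r n2. rewrite Ey. field. lra. }
      assert (Hgrad : ux p ^ 2 + uy p ^ 2 = (f' s ^ 2 * w x ^ 2 + f s ^ 2 * w1 x ^ 2) * n2).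
      { unfold ux, uy, pprodx, pprody. fold s x KX KY. rewrite <- Kn. ring. }
      assert (Hdiv1 : -1 * T1x p + S1y p = f s ^ 2 * Y1 x * n2).
      { unfold T1x, S1y, pprodx, pprody, pprod, f2, f2'. fold s x KX KY. rewrite HP, <- Kn. ring. }
      assert (Hdiv2 : T2x p + S2y p = F' s * w x ^ 2 * n2).
      { unfold T2x, S2y, pprodx, pprody, pprod, w2, w2'. fold s x KX KY. rewrite HQx, HQy, <- Kn. ring. }
      assert (Hup : u p = f s * w x) by reflexivity.
      assert (Hxa : Rabs x < b + PI / 2) by lra.
      pose proof (kk_range b x ltac:(lra) Hxa) as Hkk.
      assert (Hppos : pot c' b X x = c' / kk b x ^ 2) by (apply pot_eq; lra).
      set (q := / kk b x ^ 2).
      assert (Hq1 : 1 <= q).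
      { unfold q. rewrite <- Rinv_1 at 1. apply Rinv_le_contravar; [apply pow_lt; lra|]. nra. }
      pose proof (pow2_ge_0 (f s)) as Hf2. pose proof (pow2_ge_0 (w x)) as Hw2.
      assert (Hfw : 0 <= f s ^ 2 * w x ^ 2) by (apply Rmult_le_pos; assumption).
      (* The inequality [bdist <= d0] makes the weight of the domain at least that of the sector;
         positivity of [bdist] is needed to invert it. *)
      assert (Hbd : f s ^ 2 * w x ^ 2 * n2 * q <= u p ^ 2 / bdist (Om K v g b) p ^ 2).
      { destruct (Req_dec (u p) 0) as [Hz0|Hz0].
        - rewrite Hz0. replace (f s ^ 2 * w x ^ 2) with (u p ^ 2) by (rewrite Hup; ring). rewrite Hz0. right. unfold Rdiv. ring.
        - assert (Hb1 : d <= bdist (Om K v g b) p) by (apply bdist_ball; [assumption|]; intros z Hzz; apply (HdO p z Hz0 Hzz)).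
          pose proof (bdist_le_d0 K v g b Hb Hray p Hxa) as Hb2. unfold d0 in Hb2. fold r x in Hb2.
          replace (f s ^ 2 * w x ^ 2 * n2 * q) with (u p ^ 2 * / (r * kk b x) ^ 2).
          + unfold Rdiv. apply Rmult_le_compat_l; [apply pow2_ge_0|]. apply Rinv_le_contravar; [apply pow_lt; lra|]. apply pow_incr. lra.
          + rewrite Hup. unfold q, n2. field. lra. }
      assert (Hn2r : 4 / r3 ^ 2 <= n2).
      { unfold n2, Rdiv. rewrite Rmult_1_l. replace (4 * / r3 ^ 2) with (/ (r3 / 2) ^ 2) by (field; lra).
        apply Rinv_le_contravar; [apply pow_lt, R3|]. apply pow_incr. lra. }
      rewrite Hgrad, Hdiv1, Hdiv2, (Hw1sq x), Hppos, Hup. rewrite Hup in Hbd.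
      specialize (Hprof s).
      assert (G1 : f' s ^ 2 * (w x ^ 2 * n2) <= (F' s + 2 * k ^ 2 * f s ^ 2) * (w x ^ 2 * n2)).
      { apply Rmult_le_compat_r; [apply Rmult_le_pos; lra|assumption]. }
      assert (G2 : c * (f s ^ 2 * w x ^ 2 * n2 * q) <= c * ((f s * w x) ^ 2 / bdist (Om K v g b) p ^ 2)) by (apply Rmult_le_compat_l; assumption).
      set (B := f s ^ 2 * w x ^ 2 * n2) in *. assert (HB : 0 <= B) by (apply Rmult_le_pos; lra).
      assert (G3 : dl * (f s * w x) ^ 2 <= (c - c') / 2 * B).
      { unfold dl, B. replace ((c - c') / 2 * (4 / r3 ^ 2) * (f s * w x) ^ 2) with ((c - c') / 2 * (f s ^ 2 * w x ^ 2 * (4 / r3 ^ 2))) by ring.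
        apply Rmult_le_compat_l; [lra|]. apply Rmult_le_compat_l; assumption. }
      assert (G4 : ((c - c') / 2 + k1 * c' * q + 2 * k ^ 2) * B <= c * q * B).
      { apply Rmult_le_compat_r; [assumption|].
        assert (0 <= (c - k1 * c') * (q - 1)); [|lra].
        apply Rmult_le_pos; [|lra]. pose proof (pow2_ge_0 k). lra. }
      replace (c' / kk b x ^ 2) with (c' * q) by (unfold q, Rdiv; ring).
      unfold B in *. lra. }
  assert (csq : forall f, cts f -> cts (fun p => f p ^ 2)).
  { intros h Ch. apply (cts_comp1 (fun t => t ^ 2)); [|assumption].
    intros y. apply (ex_derive_continuous (V := R_NormedModule)). auto_derive. exact I. }
  assert (ex : forall f, cts f -> ex_I2 Lp f) by (intros h Ch; apply cts_ex_I2; [lra|assumption]).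
  destruct (ex_I2_scal Lp dl _ (ex _ (csq _ Cu))) as [e1 i1].
  destruct (ex_I2_plus Lp _ _ e1 (ex _ (cts_plus _ _ (csq _ Cux) (csq _ Cuy)))) as [e2 i2].
  destruct (ex_I2_scal Lp c _ (ex _ Cq)) as [e3 i3].
  destruct (ex_I2_scal Lp (-1) _ (ex _ CT1)) as [e4 i4].
  destruct (ex_I2_plus Lp _ _ e4 (ex _ CS1)) as [e5 i5].
  destruct (ex_I2_scal Lp k1 _ e5) as [e6 i6].
  destruct (ex_I2_plus Lp _ _ (ex _ CT2) (ex _ CS2)) as [e7 i7].
  destruct (ex_I2_plus Lp _ _ e6 e7) as [e8 i8].
  destruct (ex_I2_plus Lp _ _ e3 e8) as [e9 i9].
  pose proof (I2_le Lp _ _ ltac:(lra) e2 e9 ltac:(intros x y _ _; apply Hpt)) as Hfin.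
  rewrite i2, i1, i9, i3, i8, i6, i5, i4, i7, I1, J1, I2', J2 in Hfin.
  (* Combined with the Hardy inequality, what remains says that [dl] times the integral of [u^2] is
     at most 0; but [u] equals 1 at a point on the axis. *)
  assert (Hposu : 0 < I2 Lp (fun p => u p ^ 2)).
  { set (p0 := ray v g (exp s0) 0).
    assert (Hr0 : rad v g p0 = exp s0) by (apply rad_ray, Rlt_le, exp_pos).
    assert (Ha0 : ang v g p0 = 0) by (apply ang_ray; [apply exp_pos|lra]).
    assert (Hl0 : lr v g s0 p0 = 0) by (unfold lr; rewrite Hr0, ln_exp; ring).
    assert (Hu1 : u p0 = 1).
    { unfold u, pprod. rewrite Hl0, Ha0, f0. unfold w, wp. rewrite cut_in by (rewrite Rabs_R0; lra).
      rewrite P0. unfold Rpower. rewrite ln_1, Rmult_0_r, exp_0. ring. }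
    assert (Hbox : Rabs (fst p0) < Lp /\ Rabs (snd p0) < Lp).
    { split; apply Rnot_le_lt; intros Hge; destruct (Out1 (fst p0) (snd p0)) as [H|H]; try (left; assumption); try (right; assumption);
        rewrite pt_eta in H; rewrite ?Hl0, ?Ha0, Rabs_R0 in H; lra. }
    destruct Hbox as [B1 B2]. apply Rabs_def2 in B1. apply Rabs_def2 in B2.
    apply (I2_pos Lp (fun p => u p ^ 2) (fst p0) (snd p0)); [apply csq, Cu|intros; apply pow2_ge_0|lra|lra|].
    rewrite pt_eta, Hu1. lra. }
  assert (0 < dl * I2 Lp (fun p => u p ^ 2)) by (apply Rmult_lt_0_compat; assumption).
  lra.
Qed.
End Sharpness.

(** * The Hardy constant *)

(** The supremum is itself subcritical, since any [c' < c] is already below some subcritical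
    constant. The bound [1 / 4] makes it finite. *)
Lemma critical_exists (b : R) : 0 < b <= PI / 2 -> exists c, 0 <= c /\ subcritical c b /\
  forall c', 0 <= c' -> subcritical c' b -> c' <= c.
Proof.
  intros Hb. destruct (completeness (fun c => 0 <= c /\ subcritical c b)) as [c [Hc1 Hc2]].
  - exists (1 / 4). intros c [_ Hc]. apply (subcritical_le_quarter c b Hb Hc).
  - exists 0. split; [lra|]. intros c' X Hc'. lra.
  - exists c. split; [|split].
    + apply Hc1. split; [lra|]. intros c' X Hc'. lra.
    + intros c' X Hc' HX.
      assert (exists c1, subcritical c1 b /\ c' < c1) as (c1 & Hs & Hlt).
      { apply NNPP. intros Hn. assert (c <= c'); [|lra]. apply Hc2. intros c1 [_ Hs]. apply Rnot_lt_le. intros Hlt. apply Hn. exists c1. auto. }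
      apply (Hs c' X); [lra|assumption].
    + intros c' H0 Hs. apply Hc1. split; assumption.
Qed.

(** Ground states give the inequality below [c] only. At [c] a test function with [A < c * B] would
    also violate the inequality for the midpoint of [A / B] and [c], which is strictly smaller than
    [c]. *)
Lemma hardy_const_critical (K : pt -> Prop) (v : pt) (g b c : R) : 0 < b <= PI / 2 -> convex_set K -> interior2 K v ->
  (forall t s, 0 <= t -> s = 1 \/ s = - 1 -> interior2 K (ray v g t (s * (b + PI / 2)))) ->
  0 <= c -> subcritical c b -> (forall c', 0 <= c' -> subcritical c' b -> c' <= c) ->
  is_hardy_const (Om K v g b) c.
Proof.
  intros Hb HK Hv Hray Hc Hs Hmax. split; [assumption|]. split.
  - pose proof (subcritical_le_quarter c b Hb Hs) as Hq.
    (* The constant 1 is a ground state for the zero potential. The resulting [0 <= A] makes [B]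
       positive and [A / B] nonnegative. *)
    assert (H0 : hardy_ineq (Om K v g b) 0).
    { apply hardy_of_ground_states; try assumption; [lra|]. intros X _. exists (fun _ => 1), (fun _ => 0).
      split; [|intros; lra]. split; [intros x; apply (is_derive_const 1)|]. split; [|split; reflexivity].
      intros x. replace (- pot 0 b X x * 1) with 0 by (unfold pot, Rdiv; ring). apply (is_derive_const 0). }
    intros u ux uy A B Ht Hx Hy HA HB.
    pose proof (H0 u ux uy A B Ht Hx Hy HA HB) as HA0. rewrite Rmult_0_l in HA0.
    apply Rnot_lt_le. intros Hlt. assert (HB0 : 0 < B) by nra.
    assert (HAB : A / B < c) by (apply Rlt_div_l; lra).
    assert (HAB0 : 0 <= A / B) by (apply Rdiv_le_0_compat; lra).
    assert (Hh : hardy_ineq (Om K v g b) ((A / B + c) / 2)).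
    { apply hardy_of_ground_states; try assumption; [lra|]. intros X HX. apply Hs; [lra|assumption]. }
    specialize (Hh u ux uy A B Ht Hx Hy HA HB).
    replace ((A / B + c) / 2 * B) with ((A + c * B) / 2) in Hh by (field; lra). lra.
  - intros c' Hc' Hh. apply Hmax; [assumption|]. apply (subcritical_of_hardy K v g b Hb Hv Hray); assumption.
Qed.

Lemma interior_full (p : pt) : interior2 (fun _ => True) p.
Proof. exists 1. split; [lra|auto]. Qed.

(** Taking the whole plane for [K] lets one lemma give both the Hardy constant of the sector and
    that of the domain. *)
Lemma Om_full (beta phi : R) (v : pt) : PI < beta <= 2 * PI ->
  Om (fun _ => True) v (phi + beta / 2) ((beta - PI) / 2) = sector beta phi v.
Proof.
  intros Hb. apply functional_extensionality. intros p. apply propositional_extensionality.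
  unfold Om. rewrite <- (sector_ang beta phi v p Hb). tauto.
Qed.

Lemma Lambda_sector (beta : R) : Lambda beta = sector beta 0 (0, 0).
Proof.
  apply functional_extensionality. intros [x y]. apply propositional_extensionality. unfold sector. simpl.
  rewrite cos_0, sin_0. split.
  - intros H. exists (x, y). split; [assumption|]. simpl. f_equal; ring.
  - intros [[s t] [H E]]. simpl in E. injection E as -> ->.
    replace (0 + 1 * s - 0 * t) with s by ring. replace (0 + 0 * s + 1 * t) with t by ring. assumption.
Qed.

(** Each boundary ray is a path of unit speed from the vertex, an interior point of [K]; it consists
    of boundary points of the sector and so never meets the boundary of [K]. *)
Lemma rays_in_interior (K : pt -> Prop) (beta phi : R) (v : pt) : PI < beta <= 2 * PI -> interior2 K v ->
  (forall p, ~ (boundary2 K p /\ boundary2 (sector beta phi v) p)) ->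
  forall t s, 0 <= t -> s = 1 \/ s = - 1 -> interior2 K (ray v (phi + beta / 2) t (s * ((beta - PI) / 2 + PI / 2))).
Proof.
  intros Hb Hv Hd t s Ht Hs.
  apply (path_in_interior K (fun t => ray v (phi + beta / 2) t (s * ((beta - PI) / 2 + PI / 2)))); [| | |assumption].
  - intros t1 t2. right. apply Rsqr_inj; [apply pdist_pos|apply Rabs_pos|].
    rewrite <- Rsqr_abs, !Rsqr_pow2, ray_pdist, Rminus_diag, cos_0. ring.
  - rewrite ray0. assumption.
  - intros t' Ht' HKb. apply (Hd (ray v (phi + beta / 2) t' (s * ((beta - PI) / 2 + PI / 2)))).
    split; [exact HKb|]. rewrite <- (Om_full beta phi v Hb).
    apply (ray_boundary (fun _ => True)); [lra|intros; apply interior_full|assumption|assumption].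
Qed.

(* The Hardy constant of Omega = K ∩ Lambda exists and equals c_beta, the
   Hardy constant of Lambda_beta. *)
Theorem theorem5 (beta : R) (K : pt -> Prop) (phi : R) (v : pt) :
  PI < beta <= 2 * PI ->
  convex_set K -> unbounded_set K ->
  interior2 K v ->
  (forall p, ~ (boundary2 K p /\ boundary2 (sector beta phi v) p)) ->
  exists c, is_hardy_const (Lambda beta) c /\
            is_hardy_const (fun p => K p /\ sector beta phi v p) c.
Proof.
  intros Hb HK _ Hv Hd.
  destruct (critical_exists ((beta - PI) / 2)) as (c & Hc & Hs & Hmax); [lra|].
  exists c. split.
  - rewrite Lambda_sector, <- (Om_full beta 0 (0, 0) Hb).
    apply hardy_const_critical; try assumption; [lra|intros p q t _ _ _; exact I|apply interior_full|intros; apply interior_full].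
  - replace (fun p => K p /\ sector beta phi v p) with (Om K v (phi + beta / 2) ((beta - PI) / 2)).
    + apply hardy_const_critical; try assumption; [lra|]. apply rays_in_interior; assumption.
    + apply functional_extensionality. intros p. apply propositional_extensionality.
      unfold Om. rewrite <- (sector_ang beta phi v p Hb). reflexivity.
Qed.
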